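(* Let $P(\theta)=\sum_{l=-L}^{L}a_le^{il\theta}$ be the generating function of an isotropic continuous-time quantum walk with finite support on $\mathbb{Z}$ started from the origin, with transition amplitudes $\psi_l(t)$ from $0$ to $l$. Define the rescaled probability distribution and the average rescaled probability by $$p(\alpha,t)=t\,\bigl|\psi_{[\alpha t]}(t)\bigr|^2,\qquad \overline{p}(\alpha,T)=\frac{1}{\sqrt T}\int_T^{T+\sqrt T}p(\alpha,t)\,dt .$$ Suppose that the equation $P'(\theta)=-\alpha$ has $K>0$ real solutions $\theta_k=\theta_k(\alpha)$, $k=1,\dots,K$, in the interval $[0,2\pi)$, and that the numbers $$\omega_k:=P(\theta_k)+\alpha\theta_k$$ are all different. Then $$\lim_{T\to\infty}\overline{p}(\alpha,T)=\frac{1}{2\pi}\sum_{k=1}^{K}\frac{1}{|P''(\theta_k)|}.$$ If the equation $P'(\theta)=-\alpha$ has no real solutions, then $$\lim_{T\to\infty}\overline{p}(\alpha,T)=0.$$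
   Context: Let $\delta_l$, $l\in\mathbb{Z}$, be the delta function on $\mathbb{Z}$ concentrated at $l$, regarded as an element of $L^2(\mathbb{Z})=\ell^2(\mathbb{Z})$. A quantum walk on $\mathbb{Z}$ is given by a Hermitian operator $X$ on $L^2(\mathbb{Z})$ with matrix entries $X_{ij}$ and has evolution $U_t=\exp(itX)$; its transition amplitudes from $0$ are $\psi_l(t)=\langle\delta_l,U_t\delta_0\rangle=\sum_{k\ge0}(X^k)_{0l}(it)^k/k!$. The walk has finite support if there is a constant $L$ such that $X_{ij}=0$ whenever $|i-j|>L$. It is isotropic if $X_{ij}=a_{i-j}$ and $a_{-l}=\overline{a_l}$ for certain constants $a_l$. $[x]$ denotes the integer part of $x$.
   Formalization: In the case K>0 it is also assumed that ω_j ≠ ω_k + 2παn for j≠k and all integers n≠0; without this the claim fails (e.g. P=2cos θ, α=2 sin h, cot h=3π/2−h). Where P''(θ_k)=0, the term 1/|P''(θ_k)| is read as +∞, and the limit is then +∞. *)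

(* Defs.v *)
(* Stdlib reals with Coquelicot: [C], [Series], [RInt], [Derive], [is_lim]. *)
From Stdlib Require Import Reals Lra Lia ZArith List.
From Coquelicot Require Import Coquelicot.
Open Scope R_scope.

Definition hermitian (X : Z -> Z -> C) : Prop :=
  forall i j : Z, X i j = Cconj (X j i).

Definition finite_support (L : nat) (X : Z -> Z -> C) : Prop :=
  forall i j : Z, (Z.of_nat L < Z.abs (i - j))%Z -> X i j = RtoC 0.

Definition isotropic (a : Z -> C) (X : Z -> Z -> C) : Prop :=
  (forall i j : Z, X i j = a (i - j)%Z) /\
  (forall l : Z, a (- l)%Z = Cconj (a l)).

Definition SeriesC (u : nat -> C) : C :=
  (Series (fun n => Re (u n)), Series (fun n => Im (u n))).

(* Sum over all of Z, as the sum over l >= 0 plus the sum over l < 0. *)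
Definition SeriesZ (f : Z -> C) : C :=
  (SeriesC (fun n => f (Z.of_nat n))
   + SeriesC (fun n => f (- Z.of_nat (S n))%Z))%C.

Fixpoint mxpow (X : Z -> Z -> C) (k : nat) (i j : Z) : C :=
  match k with
  | O => if Z.eq_dec i j then RtoC 1 else RtoC 0
  | S k' => SeriesZ (fun m => (mxpow X k' i m * X m j)%C)
  end.

(* psi_l(t) = <delta_l, exp(itX) delta_0>, with the row convention
   X delta_i = sum_j X_ij delta_j for matrix entries: the entry used is
   (X^k)_{0l}, not (X^k)_{l0}.  The stationary points of the resulting phase
   t P(theta) + l theta solve P'(theta) = - l / t. *)
Definition amplitude (X : Z -> Z -> C) (l : Z) (t : R) : C :=
  SeriesC (fun k =>
    (mxpow X k 0%Z l * Cpow (Ci * RtoC t) k / RtoC (INR (fact k)))%C).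

Definition expi (x : R) : C := (cos x, sin x).

(* sum_{l=-L}^{L} a_l e^{i l theta} *)
Definition genfunC (L : nat) (a : Z -> C) (theta : R) : C :=
  sum_n (fun k : nat =>
    let l := (Z.of_nat k - Z.of_nat L)%Z in
    (a l * expi (IZR l * theta))%C) (2 * L).

(* The generating function of an isotropic walk is real valued
   ([genfunC_real]); [genfun] is the same function with codomain R. *)
Definition genfun (L : nat) (a : Z -> C) (theta : R) : R :=
  Re (genfunC L a theta).

(* [Int_part] is the floor function. *)
Definition rescaled_prob (X : Z -> Z -> C) (alpha t : R) : R :=
  t * Cmod (amplitude X (Int_part (alpha * t)) t) ^ 2.

Definition avg_rescaled_prob (X : Z -> Z -> C) (alpha T : R) : R :=
  / sqrt T * RInt (fun t => rescaled_prob X alpha t) T (T + sqrt T).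

Definition omega (L : nat) (a : Z -> C) (alpha theta : R) : R :=
  genfun L a theta + alpha * theta.

(* [theta] lists without repetition the solutions of P' = - alpha
   in [0, 2 pi). *)
Definition stationary_points
    (L : nat) (a : Z -> C) (alpha : R) (theta : list R) : Prop :=
  NoDup theta /\
  (forall x : R, In x theta <->
     0 <= x < 2 * PI /\ Derive (genfun L a) x = - alpha).

(* Moving a stationary point by 2 pi n moves its omega by 2 pi alpha n, while
   the walk, living on the integer sites [alpha t], does not distinguish the
   two choices.  If two of the omegas differ by such an amount, the corresponding
   interference term has a frequency commensurate with that of the fractional
   part of alpha t and need not average out. *)
Definition nonresonant
    (L : nat) (a : Z -> C) (alpha : R) (theta : list R) : Prop :=
  forall x y : R, In x theta -> In y theta -> x <> y ->
  forall n : Z, n <> 0%Z ->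
    omega L a alpha x <> omega L a alpha y + 2 * PI * alpha * IZR n.

(* 1 / x for x >= 0, with 1 / 0 = +infinity ([Rbar_inv 0] is the unspecified
   real [/ 0]). *)
Definition recip (x : R) : Rbar :=
  if Req_EM_T x 0 then p_infty else Finite (/ x).

(* 1 / (2 pi) * sum_k 1 / |P''(theta_k)| *)
Definition limit_prob (L : nat) (a : Z -> C) (theta : list R) : Rbar :=
  Rbar_mult (Finite (/ (2 * PI)))
    (fold_right Rbar_plus (Finite 0)
       (map (fun x => recip (Rabs (Derive_n (genfun L a) 2 x))) theta)).

Lemma sum_n_rev (u : nat -> C) (n : nat) :
  sum_n u n = sum_n (fun k => u (n - k)%nat) n.
Proof.
revert u; induction n as [|n IH]; intros u.
- now rewrite !sum_O.
- rewrite sum_Sn, IH; unfold sum_n.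
  rewrite (sum_Sn_m (fun k => u (S n - k)%nat) 0 (S n)) by lia.
  rewrite Nat.sub_0_r, <- (sum_n_m_S (fun k => u (S n - k)%nat) 0 n).
  apply plus_comm.
Qed.

Lemma Cconj_sum_n (u : nat -> C) (n : nat) :
  Cconj (sum_n u n) = sum_n (fun k => Cconj (u k)) n.
Proof.
induction n as [|n IH].
- now rewrite !sum_O.
- rewrite !sum_Sn, <- IH; apply Cplus_conj.
Qed.

Lemma genfunC_real (L : nat) (a : Z -> C) (theta : R) :
  (forall l : Z, a (- l)%Z = Cconj (a l)) ->
  genfunC L a theta = RtoC (genfun L a theta).
Proof.
intros ha.
assert (H : Cconj (genfunC L a theta) = genfunC L a theta).
{ unfold genfunC; rewrite Cconj_sum_n.
  rewrite (sum_n_rev (fun k => let l := (Z.of_nat k - Z.of_nat L)%Z in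
                        (a l * expi (IZR l * theta))%C)).
  apply sum_n_ext_loc; intros k hk; cbv zeta.
  replace (Z.of_nat (2 * L - k) - Z.of_nat L)%Z
    with (- (Z.of_nat k - Z.of_nat L))%Z by lia.
  rewrite Cmult_conj, ha; f_equal.
  unfold expi, Cconj; simpl.
  rewrite opp_IZR, Ropp_mult_distr_l_reverse, cos_neg, sin_neg.
  reflexivity. }
unfold genfun; destruct (genfunC L a theta) as [x y].
unfold Cconj in H; simpl in H; injection H as H.
unfold RtoC; simpl; f_equal; lra.
Qed.

(* Main.v *)
Require Import Defs.
From Stdlib Require Import Reals Lra Lia ZArith List Permutation Classical.
From Coquelicot Require Import Coquelicot.
Open Scope R_scope.

(** Summing the exponential series under the integral sign turns the amplitude into
    an oscillatory integral,
    [psi_l(t) = 1/(2 pi) int exp (i (t P + l theta)) d theta] over a period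
    ([amplitude_integral]). For [l = [alpha t]] its phase is [t phi - s theta], with
    [phi = P + alpha theta] and [s] the fractional part of [alpha t]. The stationary
    points of [phi] are the solutions of [P' = - alpha], and [s], although it
    oscillates with [t], stays in [[0, 1]]; all estimates are therefore uniform in
    [s].

    Stationary phase. Away from stationary points an integration by parts bounds the
    integral by [O(1/t)] ([osc_decay]). At a stationary point [x] of order [m], that
    is, where the derivatives of [phi] of orders [1, ..., m - 1] vanish and the one of
    order [m] does not, rescaling by [t^(1/m)] turns the phase into [y^m], and the
    contribution is [t^(-1/m) d exp (i (t phi(x) - s x))] up to a smaller error
    ([stationary_point_asymptotics]). Every stationary point has a finite order: a
    trigonometric polynomial has derivatives that grow at most geometrically, so
    infinite order would make [phi'] vanish on an interval, against the finiteness of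
    the list of solutions ([stationary_order]). The constant [d] is the improper
    integral of [exp (i y^m)] up to scaling. For [m = 2] this is the Fresnel
    integral and [|d|^2 = 2 pi / |P''(x)|]; for [m >= 3] it is enough that [d] is not
    zero, which follows from the positivity of its real part.

    Averaging. Let [M] be the largest order. Then [t^(2/M) |psi|^2] is close to the
    squared modulus of [1/(2 pi)] times a finite sum of waves
    [d exp (i (t phi(x) - s x))], where points of order less than [M] enter with
    [d = 0]. A cross term of two waves is a function [h] with
    [h(t + 1/|alpha|) = q h(t)], where [q = exp (i (phi(x) - phi(y)) / |alpha|)];
    [q = 1] is exactly the resonance [phi(x) - phi(y) = 2 pi alpha n] with an integer
    [n]; for [alpha = 0] other translations serve as well. If [q] is not
    1, comparing the integral of [h] with that of its translate shows that it stays
    bounded on all intervals ([CInt_beat_bounded]), so over windows of length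
    [sqrt T] only the diagonal [sum |d|^2] survives ([wave_energy]). If all
    stationary points are nondegenerate, then [M = 2] and the limit is
    [1/(4 pi^2) sum 2 pi / |P''|]. If some [P''] vanishes, then [M >= 3], the average
    grows like [T^(1 - 2/M)], and the right-hand side is infinite as well. Without
    stationary points the sum is empty and the limit is 0. *)

(** * Oscillatory integrals whose phase has no stationary point *)

Lemma bounded_on_segment (f : R -> R) (a b : R) :
  a <= b -> (forall x, a <= x <= b -> continuous f x) ->
  exists B, 0 < B /\ forall x, a <= x <= b -> Rabs (f x) <= B.
Proof.
intros hab hf.
destruct (continuity_ab_maj (fun x => Rabs (f x)) a b hab) as [M [hM _]].
{ intros c hc; apply continuity_pt_filterlim.
  apply (continuous_comp f Rabs); [now apply hf|apply continuous_Rabs]. }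
exists (Rabs (f M) + 1); split.
- pose proof (Rabs_pos (f M)); lra.
- intros x hx; specialize (hM x hx); lra.
Qed.

Lemma bounded_away_on_segment (f : R -> R) (a b : R) :
  a <= b -> (forall x, a <= x <= b -> continuous f x) ->
  (forall x, a <= x <= b -> f x <> 0) ->
  exists c, 0 < c /\ forall x, a <= x <= b -> c <= Rabs (f x).
Proof.
intros hab hf hn.
destruct (continuity_ab_min (fun x => Rabs (f x)) a b hab) as [m [hm hm']].
{ intros c hc; apply continuity_pt_filterlim.
  apply (continuous_comp f Rabs); [now apply hf|apply continuous_Rabs]. }
exists (Rabs (f m)); split; [now apply Rabs_pos_lt, hn|exact hm].
Qed.

Lemma ex_RInt_cont (f : R -> R) (a b : R) :
  a <= b -> (forall x, a <= x <= b -> continuous f x) -> ex_RInt f a b.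
Proof.
intros hab hf; apply (ex_RInt_continuous f); intros x hx; apply hf.
now rewrite Rmin_left, Rmax_right in hx.
Qed.

Lemma Rabs_RInt_le_majorant (f g : R -> R) (a b v : R) :
  a <= b -> ex_RInt f a b -> is_RInt g a b v ->
  (forall x, a < x < b -> Rabs (f x) <= g x) -> Rabs (RInt f a b) <= v.
Proof.
intros hab hf hg h.
apply Rabs_le; split.
- apply (is_RInt_le (fun x => - g x) f a b); auto.
  + apply (is_RInt_opp g _ _ _ hg).
  + exact (RInt_correct _ _ _ hf).
  + intros x hx; specialize (h x hx); apply Rabs_le_between in h; lra.
- apply (is_RInt_le f g a b); auto.
  + exact (RInt_correct _ _ _ hf).
  + intros x hx; specialize (h x hx); apply Rabs_le_between in h; lra.
Qed.

Lemma continuous_of_derive (f : R -> R) (x l : R) :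
  is_derive f x l -> continuous f x.
Proof. intros h; apply (ex_derive_continuous f); now exists l. Qed.

(** Integration by parts moves the oscillation into [sin Phi], which is bounded;
    what is left is the total variation of the amplitude [w]. *)
Lemma oscillatory_bound (w dw Phi dPhi g : R -> R) (a b v : R) :
  a <= b ->
  (forall x, a <= x <= b -> is_derive w x (dw x)) ->
  (forall x, a <= x <= b -> is_derive Phi x (dPhi x)) ->
  (forall x, a <= x <= b -> continuous dw x) ->
  (forall x, a <= x <= b -> continuous dPhi x) ->
  (forall x, a < x < b -> Rabs (dw x) <= g x) ->
  is_RInt g a b v ->
  Rabs (RInt (fun x => w x * dPhi x * cos (Phi x)) a b)
    <= Rabs (w a) + Rabs (w b) + v.
Proof.
intros hab hw hP cw cP hg hv.
assert (csin : forall x, a <= x <= b -> continuous (fun x => sin (Phi x)) x).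
{ intros x hx; apply (continuous_comp Phi sin);
  [exact (continuous_of_derive _ _ _ (hP x hx))|apply continuous_sin]. }
assert (ccos : forall x, a <= x <= b -> continuous (fun x => cos (Phi x)) x).
{ intros x hx; apply (continuous_comp Phi cos);
  [exact (continuous_of_derive _ _ _ (hP x hx))|apply continuous_cos]. }
assert (c1 : forall x, a <= x <= b -> continuous (fun x => dw x * sin (Phi x)) x).
{ intros x hx; apply (continuous_mult dw (fun x => sin (Phi x))); auto. }
assert (c2 : forall x, a <= x <= b ->
   continuous (fun x => w x * dPhi x * cos (Phi x)) x).
{ intros x hx.
  apply (continuous_mult (fun x => w x * dPhi x) (fun x => cos (Phi x))); auto.
  apply (continuous_mult w dPhi); auto.
  exact (continuous_of_derive _ _ _ (hw x hx)). }
assert (H : is_RInt (fun x => dw x * sin (Phi x) + w x * dPhi x * cos (Phi x))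
              a b (w b * sin (Phi b) - w a * sin (Phi a))).
{ apply (is_RInt_derive (fun x => w x * sin (Phi x))).
  - rewrite Rmin_left, Rmax_right by easy; intros x hx.
    auto_derive.
    + split; [exists (dw x); auto|split; [exists (dPhi x); auto|easy]].
    + replace (Derive (fun x0 : R => w x0) x) with (dw x)
        by (symmetry; apply is_derive_unique; auto).
      replace (Derive (fun x0 : R => Phi x0) x) with (dPhi x)
        by (symmetry; apply is_derive_unique; auto).
      ring.
  - rewrite Rmin_left, Rmax_right by easy; intros x hx.
    apply (continuous_plus (fun x => dw x * sin (Phi x))
             (fun x => w x * dPhi x * cos (Phi x))); auto. }
assert (e1 := ex_RInt_cont _ a b hab c1).
assert (e2 := ex_RInt_cont _ a b hab c2).
assert (H' := is_RInt_unique _ _ _ _ H); clear H; rename H' into H.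
rewrite (RInt_plus (fun x => dw x * sin (Phi x))
           (fun x => w x * dPhi x * cos (Phi x))) in H by easy.
change (RInt (fun x => dw x * sin (Phi x)) a b
        + RInt (fun x => w x * dPhi x * cos (Phi x)) a b
        = w b * sin (Phi b) - w a * sin (Phi a)) in H.
assert (B : Rabs (RInt (fun x => dw x * sin (Phi x)) a b) <= v).
{ apply (Rabs_RInt_le_majorant _ g); auto.
  intros x hx; rewrite Rabs_mult.
  assert (Rabs (sin (Phi x)) <= 1) by (apply Rabs_le, SIN_bound).
  pose proof (Rabs_pos (dw x)); pose proof (hg x hx).
  apply Rle_trans with (Rabs (dw x) * 1); [|lra].
  apply Rmult_le_compat_l; lra. }
assert (S : forall x, Rabs (w x * sin (Phi x)) <= Rabs (w x)).
{ intros x; rewrite Rabs_mult.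
  assert (Rabs (sin (Phi x)) <= 1) by (apply Rabs_le, SIN_bound).
  pose proof (Rabs_pos (w x)).
  apply Rle_trans with (Rabs (w x) * 1); [|lra].
  apply Rmult_le_compat_l; lra. }
replace (RInt (fun x => w x * dPhi x * cos (Phi x)) a b)
  with (w b * sin (Phi b) - w a * sin (Phi a)
        - RInt (fun x => dw x * sin (Phi x)) a b) by lra.
pose proof (S a); pose proof (S b).
unfold Rminus; repeat (eapply Rle_trans; [apply Rabs_triang|]).
rewrite !Rabs_Ropp.
pose proof (Rabs_triang (w b * sin (Phi b)) (- (w a * sin (Phi a)))).
rewrite Rabs_Ropp in *; lra.
Qed.

Section Phase.
Variables (Phi dPhi ddPhi : R -> R) (a b : R).
Hypothesis hab : a <= b.
Hypothesis hP : forall x, a <= x <= b -> is_derive Phi x (dPhi x).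
Hypothesis hdP : forall x, a <= x <= b -> is_derive dPhi x (ddPhi x).
Hypothesis cddP : forall x, a <= x <= b -> continuous ddPhi x.

Lemma oscillatory_bound_phase (g : R -> R) (v : R) :
  (forall x, a <= x <= b -> dPhi x <> 0) ->
  (forall x, a < x < b -> Rabs (- ddPhi x / dPhi x ^ 2) <= g x) ->
  is_RInt g a b v ->
  Rabs (RInt (fun x => cos (Phi x)) a b)
    <= Rabs (/ dPhi a) + Rabs (/ dPhi b) + v.
Proof.
intros h0 hg hv.
rewrite (RInt_ext _ (fun x => / dPhi x * dPhi x * cos (Phi x))).
2:{ rewrite Rmin_left, Rmax_right by easy; intros x hx.
    simpl; field; apply h0; lra. }
assert (cd : forall x, a <= x <= b -> continuous dPhi x).
{ intros x hx; exact (continuous_of_derive _ _ _ (hdP x hx)). }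
apply (oscillatory_bound (fun x => / dPhi x)
         (fun x => - ddPhi x / dPhi x ^ 2) Phi dPhi g a b v); auto.
- intros x hx; apply (is_derive_inv dPhi x (ddPhi x)); auto.
- intros x hx.
  apply (continuous_mult (fun x => - ddPhi x) (fun x => / dPhi x ^ 2)).
  + apply (continuous_opp ddPhi); auto.
  + apply (continuous_comp dPhi (fun y => / y ^ 2)); auto.
    apply (ex_derive_continuous (fun y => / y ^ 2)).
    auto_derive; simpl; rewrite Rmult_1_r.
    apply Rmult_integral_contrapositive_currified; auto.
Qed.

(** For a monotone derivative the variation of [1 / dPhi] telescopes, so the
    bound does not see the length of the interval (van der Corput). *)
Lemma van_der_corput (lam : R) :
  0 < lam ->
  (forall x, a <= x <= b -> lam <= dPhi x) ->
  (forall x, a <= x <= b -> 0 <= ddPhi x) ->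
  Rabs (RInt (fun x => cos (Phi x)) a b) <= 2 / lam.
Proof.
intros hl h1 h2.
assert (pos : forall x, a <= x <= b -> 0 < dPhi x)
  by (intros x hx; specialize (h1 x hx); lra).
assert (cd : forall x, a <= x <= b -> continuous dPhi x).
{ intros x hx; exact (continuous_of_derive _ _ _ (hdP x hx)). }
assert (I : is_RInt (fun x => ddPhi x / dPhi x ^ 2) a b (/ dPhi a - / dPhi b)).
{ replace (/ dPhi a - / dPhi b) with (minus (- / dPhi b) (- / dPhi a))
    by (unfold minus, plus, opp; simpl; ring).
  apply (is_RInt_derive (fun x => - / dPhi x)).
  - rewrite Rmin_left, Rmax_right by easy; intros x hx.
    replace (ddPhi x / dPhi x ^ 2) with (- (- ddPhi x / dPhi x ^ 2))
      by (specialize (pos x hx); field; lra).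
    apply (is_derive_opp (fun x => / dPhi x)).
    apply (is_derive_inv dPhi x (ddPhi x)); auto.
    specialize (pos x hx); lra.
  - rewrite Rmin_left, Rmax_right by easy; intros x hx.
    specialize (pos x hx).
    apply (continuous_mult ddPhi (fun x => / dPhi x ^ 2)); auto.
    apply (continuous_comp dPhi (fun y => / y ^ 2)); auto.
    apply (ex_derive_continuous (fun y => / y ^ 2)).
    auto_derive; simpl; rewrite Rmult_1_r.
    apply Rmult_integral_contrapositive_currified; lra. }
eapply Rle_trans.
- apply (oscillatory_bound_phase (fun x => ddPhi x / dPhi x ^ 2)
           (/ dPhi a - / dPhi b)); auto.
  + intros x hx; specialize (pos x hx); lra.
  + intros x hx.
    assert (hx' : a <= x <= b) by lra.
    specialize (pos x hx'); specialize (h2 x hx').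
    unfold Rdiv; rewrite Ropp_mult_distr_l_reverse, Rabs_Ropp.
    rewrite Rabs_pos_eq; [lra|].
    apply Rmult_le_pos; auto; left; apply Rinv_0_lt_compat, pow_lt; auto.
- assert (ha : a <= a <= b) by lra; assert (hb : a <= b <= b) by lra.
  pose proof (pos a ha); pose proof (pos b hb).
  pose proof (Rinv_0_lt_compat _ H); pose proof (Rinv_0_lt_compat _ H0).
  rewrite !Rabs_pos_eq by lra.
  pose proof (Rinv_le_contravar lam (dPhi a) hl (h1 a ha)).
  unfold Rdiv; lra.
Qed.

Lemma nonstationary_bound (lam B : R) :
  0 < lam ->
  (forall x, a <= x <= b -> lam <= Rabs (dPhi x)) ->
  (forall x, a <= x <= b -> Rabs (ddPhi x) <= B) ->
  Rabs (RInt (fun x => cos (Phi x)) a b) <= 2 / lam + (b - a) * (B / lam ^ 2).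
Proof.
intros hl h1 h2.
assert (nz : forall x, a <= x <= b -> dPhi x <> 0).
{ intros x hx e; specialize (h1 x hx); rewrite e, Rabs_R0 in h1; lra. }
eapply Rle_trans.
- apply (oscillatory_bound_phase (fun _ => B / lam ^ 2) ((b - a) * (B / lam ^ 2))); auto.
  + intros x hx; assert (hx' : a <= x <= b) by lra.
    unfold Rdiv; rewrite Rabs_mult, Rabs_Ropp, Rabs_inv.
    rewrite <- RPow_abs.
    apply Rmult_le_compat; auto using Rabs_pos.
    * left; apply Rinv_0_lt_compat, pow_lt, Rabs_pos_lt; auto.
    * apply Rinv_le_contravar; [apply pow_lt; auto|].
      apply pow_incr; split; [lra|auto].
  + apply (is_RInt_const a b (B / lam ^ 2)).
- assert (forall x, a <= x <= b -> Rabs (/ dPhi x) <= / lam).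
  { intros x hx; rewrite Rabs_inv; apply Rinv_le_contravar; auto. }
  assert (Rabs (/ dPhi a) <= / lam) by (apply H; lra).
  assert (Rabs (/ dPhi b) <= / lam) by (apply H; lra).
  unfold Rdiv; lra.
Qed.
End Phase.

(** * The model integrals of [cos (tau + y^m)] and the Fresnel integral *)

Ltac continuous_by_derivative :=
  apply (ex_derive_continuous (V := R_NormedModule)); auto_derive; auto.

Lemma is_derive_monomial (n : nat) (x : R) :
  is_derive (fun y => y ^ S n) x (INR (S n) * x ^ n).
Proof. apply is_derive_Reals, (derivable_pt_lim_pow x (S n)). Qed.

Definition model_integral (m : nat) (tau A : R) : R :=
  RInt (fun y => cos (tau + y ^ m)) 0 A.

Lemma ex_RInt_model (m : nat) (tau a b : R) :
  ex_RInt (fun y => cos (tau + y ^ m)) a b.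
Proof.
apply (ex_RInt_continuous (V := R_CompleteNormedModule)); intros z _; continuous_by_derivative.
Qed.

Lemma model_tail (m : nat) (tau lam A B : R) :
  (2 <= m)%nat -> 1 <= A <= B -> 0 < lam <= INR m * A ^ (m - 1) ->
  Rabs (RInt (fun y => cos (tau + y ^ m)) A B) <= 2 / lam.
Proof.
intros hm hA hlam.
destruct m as [|[|n]]; try lia.
apply (van_der_corput (fun y => tau + y ^ S (S n))
         (fun y => INR (S (S n)) * y ^ S n)
         (fun y => INR (S (S n)) * (INR (S n) * y ^ n))).
- lra.
- intros x _; rewrite <- (Rplus_0_l (_ * _)).
  apply (is_derive_plus (fun _ => tau) (fun y => y ^ S (S n))).
  + apply is_derive_Reals, derivable_pt_lim_const.
  + apply is_derive_monomial.
- intros x _; apply (is_derive_scal (fun y => y ^ S n)), is_derive_monomial.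
- intros x _; continuous_by_derivative.
- lra.
- intros x hx; apply Rle_trans with (INR (S (S n)) * A ^ S n).
  { replace (S (S n) - 1)%nat with (S n) in hlam by lia; lra. }
  apply Rmult_le_compat_l; [apply pos_INR|apply pow_incr; lra].
- intros x hx; repeat apply Rmult_le_pos; try apply pos_INR; apply pow_le; lra.
Qed.

Lemma model_integral_diff (m : nat) (tau A B : R) :
  model_integral m tau B - model_integral m tau A
  = RInt (fun y => cos (tau + y ^ m)) A B.
Proof.
unfold model_integral.
pose proof (RInt_Chasles (fun y => cos (tau + y ^ m)) 0 A B
  (ex_RInt_model _ _ _ _) (ex_RInt_model _ _ _ _)) as H.
unfold plus in H; simpl in H; lra.
Qed.

Lemma model_cauchy (m : nat) (tau A B : R) :
  (2 <= m)%nat -> 1 <= A -> 1 <= B ->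
  Rabs (model_integral m tau B - model_integral m tau A) <= / Rmin A B.
Proof.
intros hm.
assert (W : forall A B, 1 <= A <= B ->
  Rabs (model_integral m tau B - model_integral m tau A) <= / A).
{ intros A' B' h; rewrite model_integral_diff.
  replace (/ A') with (2 / (2 * A')) by (field; lra).
  apply model_tail; auto; split; [lra|].
  assert (2 <= INR m) by (apply (le_INR 2 m); auto).
  assert (A' <= A' ^ (m - 1)).
  { rewrite <- (pow_1 A') at 1; apply Rle_pow; [lra|lia]. }
  apply Rmult_le_compat; lra. }
intros hA hB; destruct (Rle_dec A B).
- rewrite Rmin_left by easy; apply W; lra.
- rewrite Rmin_right by lra; rewrite Rabs_minus_sym; apply W; lra.
Qed.

(** [int_0^oo cos (tau + y^m) dy], an improper integral. *)
Definition model_limit (m : nat) (tau : R) : R :=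
  real (Lim_seq (fun n => model_integral m tau (INR n))).

Lemma model_limit_close (m : nat) (tau A : R) :
  (2 <= m)%nat -> 1 <= A ->
  Rabs (model_integral m tau A - model_limit m tau) <= / A.
Proof.
intros hm hA.
assert (L : is_lim_seq (fun n => model_integral m tau (INR n)) (model_limit m tau)).
{ apply Lim_seq_correct', ex_lim_seq_cauchy_corr; intros eps.
  destruct (nfloor_ex (/ eps)) as [N hN].
  { left; apply Rinv_0_lt_compat, cond_pos. }
  exists (S N); intros p q hp hq.
  apply Rle_lt_trans with (/ Rmin (INR q) (INR p)).
  - apply model_cauchy; auto; apply (le_INR 1); lia.
  - rewrite <- (Rinv_inv eps); apply Rinv_lt_contravar.
    + apply Rmult_lt_0_compat; [apply Rinv_0_lt_compat, cond_pos|].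
      apply Rmin_pos; apply (lt_INR 0); lia.
    + apply le_INR in hp, hq; rewrite S_INR in hp, hq.
      apply Rmin_glb_lt; lra. }
assert (U := is_lim_seq_minus' _ _ _ _
  (is_lim_seq_const (model_integral m tau A)) L).
apply (is_lim_seq_abs) in U.
apply (is_lim_seq_le_loc _ _ _ _) with (2 := U) (3 := is_lim_seq_const (/ A)).
destruct (nfloor_ex A) as [N hN]; [lra|].
exists (S N); intros n hn; apply le_INR in hn; rewrite S_INR in hn.
replace (/ A) with (/ Rmin (INR n) A) by (rewrite Rmin_right; lra).
apply model_cauchy; auto; lra.
Qed.

(** For [m >= 3] the mass of [cos (y^m)] on [[0, 1]] is at least [5/6], and the
    oscillating rest contributes at most [2/m], which is smaller. *)
Lemma model_limit_pos (m : nat) : (3 <= m)%nat -> 0 < model_limit m 0.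
Proof.
intros hm.
assert (hm' : (2 <= m)%nat) by lia.
assert (h3 : 3 <= INR m) by (apply (le_INR 3 m) in hm; simpl in hm; lra).
assert (H1 : 5 / 6 <= model_integral m 0 1).
{ unfold model_integral.
  apply (is_RInt_le (fun y => 1 - y ^ 2 / 2) (fun y => cos (0 + y ^ m)) 0 1); [lra| | |].
  - replace (5 / 6) with (minus ((fun y => y - y ^ 3 / 6) 1) ((fun y => y - y ^ 3 / 6) 0))
      by (unfold minus, plus, opp; simpl; lra).
    apply (is_RInt_derive (fun y => y - y ^ 3 / 6)).
    + intros x _; auto_derive; auto; simpl; lra.
    + intros x _; continuous_by_derivative.
  - apply (RInt_correct (V := R_CompleteNormedModule)), ex_RInt_model.
  - intros x hx.
    assert (P0 : 0 <= x ^ m) by (apply pow_le; lra).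
    assert (P1 : x ^ m <= x).
    { destruct m as [|m]; [lia|]; simpl.
      assert (x ^ m <= 1) by (rewrite <- (pow1 m); apply pow_incr; lra).
      nra. }
    rewrite Rplus_0_l.
    assert (x ^ m < 2) by lra.
    destruct (pre_cos_bound (x ^ m) 0) as [c _]; [lra|lra|].
    unfold cos_approx, cos_term in c; simpl in c.
    assert (x ^ m * x ^ m <= x * x) by (apply Rmult_le_compat; lra).
    lra. }
assert (H2 : Rabs (model_integral m 0 13 - model_integral m 0 1) <= 2 / 3).
{ rewrite model_integral_diff; apply model_tail; auto; [lra|].
  rewrite pow1; lra. }
assert (H3 := model_limit_close m 0 13 hm' ltac:(lra)).
apply Rabs_le_between in H2; apply Rabs_le_between in H3.
lra.
Qed.

(** The addition formula for the cosine: the phase offset only rotates the pair of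
    the cosine and sine integrals. *)
Lemma model_integral_add (m : nat) (tau sigma A : R) :
  model_integral m (tau + sigma) A
  = cos sigma * model_integral m tau A - sin sigma * model_integral m (- (PI / 2) + tau) A.
Proof.
unfold model_integral.
rewrite <- (RInt_scal (V := R_CompleteNormedModule) _ _ _ (cos sigma)) by apply ex_RInt_model.
rewrite <- (RInt_scal (V := R_CompleteNormedModule) _ _ _ (sin sigma)) by apply ex_RInt_model.
rewrite <- (RInt_minus (V := R_CompleteNormedModule)).
2, 3: apply (ex_RInt_scal (V := R_CompleteNormedModule)); apply ex_RInt_model.
apply (RInt_ext (V := R_CompleteNormedModule)); intros x _.
unfold minus, plus, opp, scal, mult; simpl; unfold mult; simpl.
replace (tau + sigma + x ^ m) with (sigma + (tau + x ^ m)) by ring.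
replace (- (PI / 2) + tau + x ^ m) with (- (PI / 2 - (tau + x ^ m))) by ring.
rewrite cos_plus, cos_neg, cos_shift; ring.
Qed.

Lemma is_derive_model_integral (m : nat) (tau t : R) :
  is_derive (model_integral m tau) t (cos (tau + t ^ m)).
Proof.
apply (is_derive_RInt (V := R_NormedModule) (fun y => cos (tau + y ^ m)) _ 0).
- exists (mkposreal 1 Rlt_0_1); intros y _.
  apply (RInt_correct (V := R_CompleteNormedModule)), ex_RInt_model.
- continuous_by_derivative.
Qed.

(** For [tau = 0] and [tau = - pi/2], the real and imaginary parts of
    [int_0^1 exp (i t^2 (1 + x^2)) / (1 + x^2) dx], whose derivative in [t] is [i]
    times that of [(int_0^t exp (i x^2) dx)^2]. *)
Definition fresnel_companion (tau t : R) : R :=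
  RInt (fun x => cos (tau + t ^ 2 * (1 + x ^ 2)) / (1 + x ^ 2)) 0 1.

Lemma one_plus_sqr_pos (x : R) : 0 < 1 + x ^ 2.
Proof. nra. Qed.

Lemma ex_RInt_companion (tau t a b : R) :
  ex_RInt (fun x => cos (tau + t ^ 2 * (1 + x ^ 2)) / (1 + x ^ 2)) a b.
Proof.
apply (ex_RInt_continuous (V := R_CompleteNormedModule)); intros z _; continuous_by_derivative.
pose proof (one_plus_sqr_pos z); simpl in *; lra.
Qed.

Lemma is_derive_companion (tau t : R) :
  is_derive (fresnel_companion tau) t
    (- (2 * model_integral 2 (- (PI / 2) + tau + t ^ 2) t)).
Proof.
assert (D : forall u x, is_derive
   (fun z => cos (tau + z ^ 2 * (1 + x ^ 2)) / (1 + x ^ 2)) u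
   (- (2 * u * sin (tau + u ^ 2 * (1 + x ^ 2))))).
{ intros u x; auto_derive; auto.
  pose proof (one_plus_sqr_pos x); simpl in *; field; lra. }
replace (- (2 * model_integral 2 (- (PI / 2) + tau + t ^ 2) t))
  with (RInt (fun x => Derive
     (fun z => cos (tau + z ^ 2 * (1 + x ^ 2)) / (1 + x ^ 2)) t) 0 1).
- apply (is_derive_RInt_param
    (fun z x => cos (tau + z ^ 2 * (1 + x ^ 2)) / (1 + x ^ 2))).
  + exists (mkposreal 1 Rlt_0_1); intros y _ x _; eexists; apply D.
  + intros x _.
    apply continuity_2d_pt_ext
      with (fun u v => - (2 * u * sin (tau + u ^ 2 * (1 + v ^ 2)))).
    { intros u v; symmetry; apply is_derive_unique, D. }
    apply continuity_2d_pt_opp, continuity_2d_pt_mult.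
    * apply continuity_2d_pt_mult; [apply continuity_2d_pt_const|apply continuity_2d_pt_id1].
    * apply (continuity_1d_2d_pt_comp sin (fun u v => tau + u ^ 2 * (1 + v ^ 2))).
      { apply continuity_sin. }
      simpl; repeat first
        [ apply continuity_2d_pt_plus | apply continuity_2d_pt_mult
        | apply continuity_2d_pt_const | apply continuity_2d_pt_id1
        | apply continuity_2d_pt_id2 ].
  + exists (mkposreal 1 Rlt_0_1); intros y _; apply ex_RInt_companion.
- unfold model_integral.
  pose proof (RInt_comp_lin (V := R_CompleteNormedModule)
    (fun y => cos (- (PI / 2) + tau + t ^ 2 + y ^ 2)) t 0 0 1) as E.
  replace (t * 0 + 0) with 0 in E by ring; replace (t * 1 + 0) with t in E by ring.
  rewrite <- E by apply ex_RInt_model.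
  match goal with |- _ = - (2 * ?I) => replace (- (2 * I)) with (scal (-2) I)
    by (unfold scal; simpl; unfold mult; simpl; ring) end.
  rewrite <- (RInt_scal (V := R_CompleteNormedModule)).
  + apply (RInt_ext (V := R_CompleteNormedModule)); intros x _.
    unfold scal; simpl; unfold mult; simpl.
    match goal with |- Derive ?f t = _ =>
      replace (Derive f t) with (- (2 * t * sin (tau + t ^ 2 * (1 + x ^ 2))))
        by (symmetry; apply is_derive_unique, D) end.
    simpl.
    replace (- (PI / 2) + tau + t * (t * 1) + (t * x + 0) * ((t * x + 0) * 1))
      with (- (PI / 2 - (tau + t * (t * 1) * (1 + x * (x * 1))))) by ring.
    rewrite cos_neg, cos_shift; ring.
  + apply (ex_RInt_continuous (V := R_CompleteNormedModule)); intros z _.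
    unfold scal; simpl; unfold mult; simpl; continuous_by_derivative.
Qed.

(** The phase [t^2 (1 + x^2)] is stationary at [x = 0], so the piece below [1 / t] is
    estimated trivially and only the rest is integrated by parts. *)
Lemma companion_decay (tau t : R) : 1 <= t -> Rabs (fresnel_companion tau t) <= 2 / t.
Proof.
intros ht; unfold fresnel_companion.
assert (it : 0 < / t <= 1).
{ split; [apply Rinv_0_lt_compat; lra|].
  rewrite <- Rinv_1; apply Rinv_le_contravar; lra. }
rewrite <- (RInt_Chasles (V := R_CompleteNormedModule) _ 0 (/ t) 1)
  by apply ex_RInt_companion.
assert (B1 : Rabs (RInt (fun x => cos (tau + t ^ 2 * (1 + x ^ 2)) / (1 + x ^ 2)) 0 (/ t))
  <= (/ t - 0) * 1).
{ apply abs_RInt_le_const; [lra|apply ex_RInt_companion|].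
  intros x _; unfold Rdiv; rewrite Rabs_mult.
  assert (Rabs (cos (tau + t ^ 2 * (1 + x ^ 2))) <= 1) by apply Rabs_le, COS_bound.
  assert (0 < / (1 + x ^ 2) <= 1).
  { split; [apply Rinv_0_lt_compat, one_plus_sqr_pos|].
    rewrite <- Rinv_1; apply Rinv_le_contravar; nra. }
  rewrite (Rabs_pos_eq (/ _)) by lra.
  pose proof (Rabs_pos (cos (tau + t ^ 2 * (1 + x ^ 2)))); nra. }
set (w := fun x => / ((1 + x ^ 2) * (2 * t ^ 2 * x))).
set (dw := fun x => - ((1 + 3 * x ^ 2) * (2 * t ^ 2)) / ((1 + x ^ 2) * (2 * t ^ 2 * x)) ^ 2).
assert (pos : forall x, / t <= x -> 0 < (1 + x ^ 2) * (2 * t ^ 2 * x)).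
{ intros x hx; apply Rmult_lt_0_compat; [apply one_plus_sqr_pos|].
  apply Rmult_lt_0_compat; nra. }
assert (Dw : forall x, / t <= x -> is_derive w x (dw x)).
{ intros x hx; specialize (pos x hx); unfold w, dw; auto_derive.
  - simpl in *; lra.
  - simpl in *; field; repeat split; intros e; rewrite ?e in pos; try nra. }
assert (Cw : forall x, / t <= x -> continuous dw x).
{ intros x hx; specialize (pos x hx); unfold dw; continuous_by_derivative.
  simpl in *; rewrite Rmult_1_r; apply Rmult_integral_contrapositive_currified; lra. }
assert (B2 : Rabs (RInt (fun x => cos (tau + t ^ 2 * (1 + x ^ 2)) / (1 + x ^ 2)) (/ t) 1)
  <= Rabs (w (/ t)) + Rabs (w 1) + (w (/ t) - w 1)).
{ rewrite (RInt_ext (V := R_CompleteNormedModule) _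
    (fun x => w x * (2 * t ^ 2 * x) * cos (tau + t ^ 2 * (1 + x ^ 2)))).
  2:{ intros x hx; rewrite Rmin_left, Rmax_right in hx by lra.
      assert (hx' : / t <= x) by lra; specialize (pos x hx').
      pose proof (one_plus_sqr_pos x).
      unfold w; simpl; field; simpl in *; repeat split; nra. }
  apply (oscillatory_bound w dw (fun x => tau + t ^ 2 * (1 + x ^ 2))
           (fun x => 2 * t ^ 2 * x) (fun x => - dw x)); try lra.
  - intros x hx; apply Dw; lra.
  - intros x hx; auto_derive; auto; simpl; ring.
  - intros x hx; apply Cw; lra.
  - intros x hx; continuous_by_derivative.
  - intros x hx; assert (hx' : / t <= x) by lra; specialize (pos x hx').
    rewrite <- Rabs_Ropp, Rabs_pos_eq; [lra|].
    unfold dw, Rdiv; rewrite Ropp_mult_distr_l_reverse, Ropp_involutive.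
    apply Rmult_le_pos; [nra|left; apply Rinv_0_lt_compat, pow_lt; auto].
  - replace (w (/ t) - w 1) with (minus (- w 1) (- w (/ t)))
      by (unfold minus, plus, opp; simpl; ring).
    apply (is_RInt_derive (V := R_CompleteNormedModule) (fun x => - w x) (fun x => - dw x)).
    + rewrite Rmin_left, Rmax_right by lra; intros x hx.
      apply (is_derive_opp w), Dw; lra.
    + rewrite Rmin_left, Rmax_right by lra; intros x hx.
      apply (continuous_opp dw), Cw; lra. }
assert (w1 : 0 < w 1) by (apply Rinv_0_lt_compat, pos; lra).
assert (wt : 0 < w (/ t)) by (apply Rinv_0_lt_compat, pos; lra).
assert (wt' : w (/ t) <= / (2 * t)).
{ unfold w; apply Rinv_le_contravar; [lra|].
  replace ((1 + (/ t) ^ 2) * (2 * t ^ 2 * / t)) with (2 * t * (1 + (/ t) ^ 2))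
    by (field; lra).
  nra. }
rewrite (Rabs_pos_eq (w 1)), (Rabs_pos_eq (w (/ t))) in B2 by lra.
eapply Rle_trans; [apply Rabs_triang|].
replace (2 / t) with (/ t + 2 * / (2 * t)) by (field; lra).
lra.
Qed.

(** The square of the truncated integral plus [i] times the complex companion does
    not depend on [t]; at [t = 0] it is [i int_0^1 dx / (1 + x^2) = i pi / 4]. Since
    the companion tends to 0, the square tends to [i pi / 4], of modulus [pi / 4].
    [U] and [V] are the real and imaginary parts of the constant. *)
Lemma fresnel : model_limit 2 0 ^ 2 + model_limit 2 (- (PI / 2)) ^ 2 = PI / 4.
Proof.
set (c := model_integral 2 0); set (s := model_integral 2 (- (PI / 2))).
assert (dc : forall t, is_derive c t (cos (t ^ 2))).
{ intros t; unfold c; rewrite <- (Rplus_0_l (t ^ 2)); apply is_derive_model_integral. }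
assert (ds : forall t, is_derive s t (sin (t ^ 2))).
{ intros t; unfold s; rewrite <- cos_shift, <- cos_neg.
  replace (- (PI / 2 - t ^ 2)) with (- (PI / 2) + t ^ 2) by ring.
  apply is_derive_model_integral. }
assert (M : forall sigma t, model_integral 2 sigma t = cos sigma * c t - sin sigma * s t).
{ intros sigma t; rewrite <- (Rplus_0_l sigma) at 1.
  rewrite model_integral_add, Rplus_0_r; reflexivity. }
assert (c0 : c 0 = 0) by apply (RInt_point (V := R_CompleteNormedModule) 0).
assert (s0 : s 0 = 0) by apply (RInt_point (V := R_CompleteNormedModule) 0).
set (V := fun t => 2 * (c t * s t) + fresnel_companion 0 t).
set (U := fun t => c t * c t - s t * s t - fresnel_companion (- (PI / 2)) t).
assert (dV : forall t, is_derive V t 0).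
{ intros t.
  replace 0 with (2 * (cos (t ^ 2) * s t + c t * sin (t ^ 2))
     + - (2 * model_integral 2 (- (PI / 2) + 0 + t ^ 2) t)).
  - unfold V; apply (is_derive_plus (fun t => 2 * (c t * s t)) (fresnel_companion 0)).
    + apply (is_derive_scal (fun t => c t * s t)).
      apply (is_derive_mult c s); auto using Rmult_comm.
    + apply is_derive_companion.
  - rewrite M, Rplus_0_r.
    replace (- (PI / 2) + t ^ 2) with (- (PI / 2 - t ^ 2)) by ring.
    rewrite cos_neg, sin_neg, cos_shift, sin_shift; ring. }
assert (dU : forall t, is_derive U t 0).
{ intros t.
  replace 0 with (cos (t ^ 2) * c t + c t * cos (t ^ 2)
     - (sin (t ^ 2) * s t + s t * sin (t ^ 2))
     - - (2 * model_integral 2 (- (PI / 2) + - (PI / 2) + t ^ 2) t)).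
  - unfold U; apply (is_derive_minus (fun t => c t * c t - s t * s t) (fresnel_companion (- (PI / 2)))).
    + apply (is_derive_minus (fun t => c t * c t) (fun t => s t * s t)).
      * apply (is_derive_mult c c); auto using Rmult_comm.
      * apply (is_derive_mult s s); auto using Rmult_comm.
    + apply is_derive_companion.
  - rewrite M.
    replace (- (PI / 2) + - (PI / 2) + t ^ 2) with (t ^ 2 + - PI) by field.
    rewrite cos_plus, sin_plus, cos_neg, sin_neg, cos_PI, sin_PI; ring. }
assert (Vc : forall t, 0 < t -> V t = PI / 4).
{ intros t ht.
  rewrite <- (eq_is_derive V 0 t (fun x _ => dV x) ht).
  unfold V; rewrite c0, s0, <- atan_1; unfold fresnel_companion.
  rewrite (RInt_ext (V := R_CompleteNormedModule) _ (fun x => / (1 + x ^ 2))).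
  - rewrite (is_RInt_unique (V := R_CompleteNormedModule) _ _ _ (minus (atan 1) (atan 0))).
    + rewrite atan_0; unfold minus, plus, opp; simpl; ring.
    + apply (is_RInt_derive (V := R_CompleteNormedModule) atan).
      * intros x _; apply is_derive_Reals.
        apply derivable_pt_lim_atan.
      * intros x _; continuous_by_derivative; pose proof (one_plus_sqr_pos x); simpl in *; lra.
  - intros x _; simpl; rewrite Rmult_0_l, Rmult_0_l, Rplus_0_l, cos_0.
    unfold Rdiv; ring. }
assert (Uc : forall t, 0 < t -> U t = 0).
{ intros t ht.
  rewrite <- (eq_is_derive U 0 t (fun x _ => dU x) ht).
  unfold U; rewrite c0, s0; unfold fresnel_companion.
  rewrite (RInt_ext (V := R_CompleteNormedModule) _ (fun x => 0)).
  - rewrite (RInt_const (V := R_CompleteNormedModule)).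
    unfold scal; simpl; unfold mult; simpl; ring.
  - intros x _; simpl; rewrite Rmult_0_l, Rmult_0_l, Rplus_0_r, cos_neg, cos_PI2.
    unfold Rdiv; ring. }
assert (lim : forall tau, is_lim_seq (fun n => model_integral 2 tau (INR (S n)))
                            (model_limit 2 tau)).
{ intros tau.
  apply is_lim_seq_le_le with (u := fun n => model_limit 2 tau - / INR (S n))
    (w := fun n => model_limit 2 tau + / INR (S n)).
  - intros n.
    assert (h := model_limit_close 2 tau (INR (S n)) (le_n _)
                   (le_INR 1 (S n) ltac:(lia))).
    apply Rabs_le_between in h; lra.
  - replace (Finite (model_limit 2 tau)) with (Finite (model_limit 2 tau - 0))
      by (f_equal; ring).
    apply is_lim_seq_minus'; [apply is_lim_seq_const|].
    apply (is_lim_seq_incr_1 (fun n => / INR n)).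
    apply (is_lim_seq_inv INR p_infty); [apply is_lim_seq_INR|easy].
  - replace (Finite (model_limit 2 tau)) with (Finite (model_limit 2 tau + 0))
      by (f_equal; ring).
    apply is_lim_seq_plus'; [apply is_lim_seq_const|].
    apply (is_lim_seq_incr_1 (fun n => / INR n)).
    apply (is_lim_seq_inv INR p_infty); [apply is_lim_seq_INR|easy]. }
assert (dec : forall tau, is_lim_seq (fun n => fresnel_companion tau (INR (S n))) 0).
{ intros tau; apply is_lim_seq_abs_0.
  apply is_lim_seq_le_le with (u := fun n => 0) (w := fun n => 2 * / INR (S n)).
  - intros n; split; [apply Rabs_pos|apply companion_decay, (le_INR 1); lia].
  - apply is_lim_seq_const.
  - replace (Finite 0) with (Rbar_mult 2 0) by (simpl; f_equal; ring).
    apply is_lim_seq_scal_l.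
    apply (is_lim_seq_incr_1 (fun n => / INR n)).
    apply (is_lim_seq_inv INR p_infty); [apply is_lim_seq_INR|easy]. }
set (cl := model_limit 2 0); set (sl := model_limit 2 (- (PI / 2))).
assert (pos : forall n, 0 < INR (S n)) by (intros n; apply (lt_INR 0); lia).
assert (EV : 2 * (cl * sl) + 0 = PI / 4).
{ assert (H : is_lim_seq (fun n => V (INR (S n))) (2 * (cl * sl) + 0)).
  { unfold V; apply is_lim_seq_plus'; [|apply dec].
    apply (is_lim_seq_scal_l _ 2 (cl * sl)), is_lim_seq_mult'; apply lim. }
  apply (is_lim_seq_ext _ (fun _ => PI / 4)) in H; [|intros n; apply Vc, pos].
  apply is_lim_seq_unique in H; rewrite Lim_seq_const in H; now injection H. }
assert (EU : cl * cl - sl * sl - 0 = 0).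
{ assert (H : is_lim_seq (fun n => U (INR (S n))) (cl * cl - sl * sl - 0)).
  { unfold U; apply is_lim_seq_minus'; [|apply dec].
    apply is_lim_seq_minus'; apply is_lim_seq_mult'; apply lim. }
  apply (is_lim_seq_ext _ (fun _ => 0)) in H; [|intros n; apply Uc, pos].
  apply is_lim_seq_unique in H; rewrite Lim_seq_const in H; now injection H. }
assert (Q : (cl ^ 2 + sl ^ 2) ^ 2 = (PI / 4) ^ 2).
{ replace ((cl ^ 2 + sl ^ 2) ^ 2)
    with ((cl * cl - sl * sl) ^ 2 + (2 * (cl * sl)) ^ 2) by ring.
  replace (cl * cl - sl * sl) with 0 by lra.
  replace (2 * (cl * sl)) with (PI / 4) by lra; ring. }
pose proof PI_RGT_0.
assert (0 <= cl ^ 2 + sl ^ 2) by nra.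
nra.
Qed.

(** * One side of a stationary point *)

Definition deriv_chain (f : nat -> R -> R) : Prop :=
  forall n x, is_derive (f n) x (f (S n) x).

Lemma chain_continuous (f : nat -> R -> R) (n : nat) (x : R) :
  deriv_chain f -> continuous (f n) x.
Proof. intros hf; exact (continuous_of_derive _ _ _ (hf n x)). Qed.

Lemma increment_bound (g dg : R -> R) (a b B : R) :
  (forall u, Rmin a b <= u <= Rmax a b -> is_derive g u (dg u)) ->
  (forall u, Rmin a b <= u <= Rmax a b -> Rabs (dg u) <= B) ->
  Rabs (g b - g a) <= B * Rabs (b - a).
Proof.
intros hg hB.
destruct (MVT_gen g a b dg) as [c [hc e]].
- intros x hx; apply hg; lra.
- intros x hx; apply continuity_pt_filterlim, (continuous_of_derive g x (dg x)), hg, hx.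
- rewrite e, Rabs_mult; apply Rmult_le_compat_r; [apply Rabs_pos|auto].
Qed.

Lemma cos_lipschitz (x y : R) : Rabs (cos x - cos y) <= Rabs (x - y).
Proof.
rewrite <- (Rmult_1_l (Rabs (x - y))).
apply (increment_bound cos (fun u => - sin u) y x 1).
- intros u _; apply is_derive_Reals, derivable_pt_lim_cos.
- intros u _; rewrite Rabs_Ropp; apply Rabs_le, SIN_bound.
Qed.

(** The Lipschitz bound for the derivative of order [j + m], integrated [m] times
    without any care for the constant. *)
Lemma flat_taylor (f : nat -> R -> R) (m j : nat) :
  deriv_chain f -> (forall i, (j <= i < j + m)%nat -> f i 0 = 0) ->
  exists C, 0 < C /\ forall x, 0 <= x <= 1 ->
    Rabs (f j x - f (j + m)%nat 0 * x ^ m / INR (fact m)) <= C * x ^ S m.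
Proof.
intros hf; revert j; induction m as [|m IH]; intros j h0.
- destruct (bounded_on_segment (f (S j)) 0 1) as [C [hC hB]]; [lra| |].
  { intros x _; now apply chain_continuous. }
  exists C; split; auto; intros x hx.
  replace (f j x - f (j + 0)%nat 0 * x ^ 0 / INR (fact 0)) with (f j x - f j 0)
    by (rewrite Nat.add_0_r; simpl; field).
  replace (C * x ^ 1) with (C * Rabs (x - 0))
    by (rewrite Rminus_0_r, Rabs_pos_eq by lra; ring).
  apply (increment_bound (f j) (f (S j))).
  + intros u _; apply hf.
  + rewrite Rmin_left, Rmax_right by lra; intros u hu; apply hB; lra.
- destruct (IH (S j)) as [C [hC hB]].
  { intros i hi; apply h0; lia. }
  exists C; split; auto; intros x hx.
  replace (S j + m)%nat with (j + S m)%nat in hB by lia.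
  set (c := f (j + S m)%nat 0) in *.
  pose proof (INR_fact_neq_0 m) as nf.
  assert (nS : INR (S m) <> 0) by (apply not_0_INR; lia).
  assert (nfS : INR (fact (S m)) = INR (S m) * INR (fact m))
    by (rewrite <- mult_INR; f_equal).
  set (g := fun u => f j u - c / INR (fact (S m)) * u ^ S m).
  replace (f j x - c * x ^ S m / INR (fact (S m))) with (g x - g 0).
  2:{ unfold g; rewrite (h0 j) by lia; rewrite nfS; simpl (_ ^ S m); field; auto. }
  replace (C * x ^ S (S m)) with (C * x ^ S m * Rabs (x - 0))
    by (rewrite Rminus_0_r, Rabs_pos_eq by lra; simpl; ring).
  apply (increment_bound g (fun u => f (S j) u - c * u ^ m / INR (fact m))).
  + intros u _.
    replace (c * u ^ m / INR (fact m)) with (c / INR (fact (S m)) * (INR (S m) * u ^ m))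
      by (rewrite nfS; field; auto).
    apply (is_derive_minus (f j) (fun u => c / INR (fact (S m)) * u ^ S m)).
    * apply hf.
    * apply (is_derive_scal (fun u => u ^ S m)), is_derive_monomial.
  + rewrite Rmin_left, Rmax_right by lra; intros u hu.
    apply Rle_trans with (C * u ^ S m); [apply hB; lra|].
    apply Rmult_le_compat_l; [lra|apply pow_incr; lra].
Qed.

Lemma ex_RInt_phase (f : R -> R) (tau t s a b : R) :
  (forall x, continuous f x) ->
  ex_RInt (fun x => cos (tau + (t * f x + s * x))) a b.
Proof.
intros hf; apply (ex_RInt_continuous (V := R_CompleteNormedModule)); intros x _.
apply (continuous_comp (fun x => tau + (t * f x + s * x)) cos);
  [|apply continuous_cos].
apply (continuous_plus (fun _ => tau) (fun x => t * f x + s * x)).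
- apply continuous_const.
- apply (continuous_plus (fun x => t * f x) (fun x => s * x)).
  + apply (continuous_mult (fun _ => t) f); [apply continuous_const|apply hf].
  + continuous_by_derivative.
Qed.

(** One side of a stationary point of order [m]. On the scale [x = y / r], where
    [r^m = t f_m(0) / m!], the phase becomes [y^m], uniformly for [y <= A]; beyond
    [A / r] it is steep and convex, and van der Corput's bound, multiplied by
    [r], is [O(1 / A)] uniformly in [t] and in the bounded drift [s]. *)
Lemma one_sided_asymptotics (f : nat -> R -> R) (m : nat) (tau : R) :
  deriv_chain f -> (2 <= m)%nat ->
  (forall i, (i < m)%nat -> f i 0 = 0) -> 0 < f m 0 ->
  exists d0, 0 < d0 /\ forall d, 0 < d <= d0 -> forall eps, 0 < eps ->
  exists t0, forall t, t0 <= t -> forall s, Rabs s <= 1 ->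
  forall r, 0 < r -> r ^ m = t * (f m 0 / INR (fact m)) ->
  Rabs (r * RInt (fun x => cos (tau + (t * f 0%nat x + s * x))) 0 d
        - model_limit m tau) <= eps.
Proof.
intros hf hm h0 hpos.
set (ka := f m 0 / INR (fact m)).
assert (pka : 0 < ka) by (apply Rdiv_lt_0_compat; [auto|apply INR_fact_lt_0]).
destruct (flat_taylor f m 0 hf) as [C0 [pC0 T0]]; [intros i hi; apply h0; lia|].
destruct (flat_taylor f (m - 1) 1 hf) as [C1 [pC1 T1]]; [intros i hi; apply h0; lia|].
destruct (flat_taylor f (m - 2) 2 hf) as [C2 [pC2 T2]]; [intros i hi; apply h0; lia|].
replace (0 + m)%nat with m in T0 by lia.
replace (1 + (m - 1))%nat with m in T1 by lia.
replace (2 + (m - 2))%nat with m in T2 by lia.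
set (k2 := f m 0 / INR (fact (m - 2))).
assert (pk2 : 0 < k2) by (apply Rdiv_lt_0_compat; [auto|apply INR_fact_lt_0]).
assert (k1 : 2 * ka <= f m 0 / INR (fact (m - 1))).
{ unfold ka; destruct m as [|n]; [lia|].
  replace (S n - 1)%nat with n by lia.
  change (fact (S n)) with (S n * fact n)%nat; rewrite mult_INR.
  pose proof (INR_fact_lt_0 n).
  assert (2 <= INR (S n)) by (apply (le_INR 2); lia).
  replace (2 * (f (S n) 0 / (INR (S n) * INR (fact n))))
    with (2 / INR (S n) * (f (S n) 0 / INR (fact n))) by (field; split; lra).
  rewrite <- (Rmult_1_l (f (S n) 0 / INR (fact n))) at 2.
  apply Rmult_le_compat_r; [left; apply Rdiv_lt_0_compat; auto|].
  apply (Rdiv_le_1 2 (INR (S n))); lra. }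
exists (Rmin 1 (Rmin (ka / C1) (k2 / C2))); split.
{ repeat apply Rmin_pos; try lra; apply Rdiv_lt_0_compat; auto. }
intros d [pd hd].
assert (d1 : d <= 1) by (eapply Rle_trans; [exact hd|apply Rmin_l]).
assert (dC1 : d * C1 <= ka).
{ apply (Rle_div_r d ka C1); [lra|].
  eapply Rle_trans; [exact hd|]; eapply Rle_trans; [apply Rmin_r|apply Rmin_l]. }
assert (dC2 : d * C2 <= k2).
{ apply (Rle_div_r d k2 C2); [lra|].
  eapply Rle_trans; [exact hd|]; eapply Rle_trans; [apply Rmin_r|apply Rmin_r]. }
assert (F1 : forall x, 0 <= x <= d -> ka * x ^ (m - 1) <= f 1%nat x).
{ intros x hx; specialize (T1 x ltac:(lra)); apply Rabs_le_between in T1.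
  assert (px : 0 <= x ^ (m - 1)) by (apply pow_le; lra).
  simpl (x ^ S (m - 1)) in T1.
  assert (x * C1 <= ka) by nra.
  assert (C1 * (x * x ^ (m - 1)) <= ka * x ^ (m - 1)) by nra.
  assert (2 * ka * x ^ (m - 1) <= f m 0 * x ^ (m - 1) / INR (fact (m - 1))).
  { replace (f m 0 * x ^ (m - 1) / INR (fact (m - 1)))
      with (f m 0 / INR (fact (m - 1)) * x ^ (m - 1)) by (unfold Rdiv; ring).
    apply Rmult_le_compat_r; auto. }
  lra. }
assert (F2 : forall x, 0 <= x <= d -> 0 <= f 2%nat x).
{ intros x hx; specialize (T2 x ltac:(lra)); apply Rabs_le_between in T2.
  assert (px : 0 <= x ^ (m - 2)) by (apply pow_le; lra).
  simpl (x ^ S (m - 2)) in T2.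
  assert (x * C2 <= k2) by nra.
  assert (C2 * (x * x ^ (m - 2)) <= k2 * x ^ (m - 2)) by nra.
  assert (k2 * x ^ (m - 2) = f m 0 * x ^ (m - 2) / INR (fact (m - 2)))
    by (unfold k2, Rdiv; ring).
  lra. }
intros eps he.
(* van der Corput's bound costs [4 / A] and the truncation of the model integral
   [1 / A], together half of [eps] *)
set (A := Rmax 1 (10 / eps)).
assert (A1 : 1 <= A) by apply Rmax_l.
assert (A2 : 5 / A <= eps / 2).
{ assert (10 / eps <= A) by apply Rmax_r.
  apply (Rle_div_l 10 A eps) in H; [|lra].
  apply (Rle_div_l 5 (eps / 2) A); lra. }
set (Q := A * (C0 * A ^ S m / ka + A)).
assert (pQ : 0 < Q).
{ apply Rmult_lt_0_compat; [lra|].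
  assert (0 < C0 * A ^ S m / ka); [|lra].
  apply Rdiv_lt_0_compat; auto; apply Rmult_lt_0_compat; auto; apply pow_lt; lra. }
set (R0 := Rmax 2 (Rmax (A / d) (2 * Q / eps))).
exists ((R0 ^ m + 1) / ka).
intros t ht s hs r pr er; fold ka in er.
assert (rR0 : R0 <= r).
{ apply Rnot_lt_le; intros hlt.
  assert (r ^ m <= R0 ^ m) by (apply pow_incr; lra).
  apply (Rle_div_l (R0 ^ m + 1) t ka) in ht; lra. }
assert (r2 : 2 <= r) by (eapply Rle_trans; [apply Rmax_l|exact rR0]).
assert (rA : A / r <= d).
{ apply (Rle_div_l A d r); [lra|rewrite Rmult_comm].
  apply (Rle_div_l A r d); [lra|].
  eapply Rle_trans; [|exact rR0]; eapply Rle_trans; [apply Rmax_l|apply Rmax_r]. }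
assert (rQ : Q / r <= eps / 2).
{ apply (Rle_div_l Q (eps / 2) r); [lra|].
  assert (H : 2 * Q / eps <= r)
    by (eapply Rle_trans; [|exact rR0]; eapply Rle_trans; [apply Rmax_r|apply Rmax_r]).
  apply (Rle_div_l (2 * Q) r eps) in H; lra. }
assert (pAr : 0 < A / r) by (apply Rdiv_lt_0_compat; lra).
assert (te : t = r ^ m / ka) by (rewrite er; field; lra).
assert (pt : 0 < t) by (rewrite te; apply Rdiv_lt_0_compat; auto; apply pow_lt; auto).
assert (cf : forall x, continuous (f 0%nat) x) by (intros x; now apply chain_continuous).
rewrite <- (RInt_Chasles (V := R_CompleteNormedModule) _ 0 (A / r) d)
  by now apply ex_RInt_phase.
set (I1 := RInt _ 0 (A / r)); set (I2 := RInt _ (A / r) d).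
(* the window [x <= A / r] *)
assert (H1 : Rabs (r * I1 - model_integral m tau A) <= Q / r).
{ assert (E : model_integral m tau A
    = r * RInt (fun x => cos (tau + (r * x) ^ m)) 0 (A / r)).
  { unfold model_integral.
    pose proof (RInt_comp_lin (V := R_CompleteNormedModule)
      (fun y => cos (tau + y ^ m)) r 0 0 (A / r) (ex_RInt_model _ _ _ _)) as E.
    replace (r * 0 + 0) with 0 in E by ring.
    replace (r * (A / r) + 0) with A in E by (field; lra).
    rewrite <- E.
    rewrite <- (RInt_scal (V := R_CompleteNormedModule)).
    - apply (RInt_ext (V := R_CompleteNormedModule)); intros x _.
      now rewrite Rplus_0_r.
    - apply (ex_RInt_continuous (V := R_CompleteNormedModule)); intros z _; continuous_by_derivative. }
  rewrite E; clear E.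
  assert (ex2 : ex_RInt (fun x => cos (tau + (r * x) ^ m)) 0 (A / r)).
  { apply (ex_RInt_continuous (V := R_CompleteNormedModule)); intros z _; continuous_by_derivative. }
  rewrite <- Rmult_minus_distr_l, Rabs_mult, (Rabs_pos_eq r) by lra.
  unfold I1.
  pose proof (RInt_minus (V := R_CompleteNormedModule) _ _ 0 (A / r)
    (ex_RInt_phase (f 0%nat) tau t s _ _ cf) ex2) as E.
  unfold minus in E; unfold plus, opp in E; simpl in E.
  unfold Rminus; rewrite <- E; clear E.
  replace (Q / r) with (r * ((A / r - 0) * ((C0 * A ^ S m / ka + A) / r)))
    by (unfold Q; field; lra).
  apply Rmult_le_compat_l; [lra|].
  apply abs_RInt_le_const; [lra| |].
  { apply (ex_RInt_minus (V := R_CompleteNormedModule));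
      [now apply ex_RInt_phase|exact ex2]. }
  intros x hx; eapply Rle_trans; [apply cos_lipschitz|].
  specialize (T0 x ltac:(lra)).
  replace (tau + (t * f 0%nat x + s * x) - (tau + (r * x) ^ m))
    with (t * (f 0%nat x - f m 0 * x ^ m / INR (fact m)) + s * x).
  2:{ rewrite Rpow_mult_distr, er; unfold ka, Rdiv; ring. }
  eapply Rle_trans; [apply Rabs_triang|].
  rewrite !Rabs_mult, (Rabs_pos_eq t), (Rabs_pos_eq x) by lra.
  replace ((C0 * A ^ S m / ka + A) / r)
    with (t * (C0 * (A / r) ^ S m) + A / r).
  2:{ unfold Rdiv at 1; rewrite Rpow_mult_distr, pow_inv, te; simpl (r ^ S m).
      field; repeat split; try lra; apply pow_nonzero; lra. }
  apply Rplus_le_compat.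
  - apply Rmult_le_compat_l; [lra|].
    eapply Rle_trans; [exact T0|].
    apply Rmult_le_compat_l; [lra|apply pow_incr; lra].
  - rewrite <- (Rmult_1_l (A / r)); apply Rmult_le_compat; try lra; apply Rabs_pos. }
(* the rest, by van der Corput *)
assert (H2 : Rabs I2 <= 2 / (r * A / 2)).
{ apply (van_der_corput (fun x => tau + (t * f 0%nat x + s * x))
    (fun x => t * f 1%nat x + s) (fun x => t * f 2%nat x)); auto.
  - intros x _.
    replace (t * f 1%nat x + s) with (0 + (t * f 1%nat x + s * 1)) by ring.
    apply (is_derive_plus (fun _ => tau) (fun x => t * f 0%nat x + s * x)).
    + apply is_derive_Reals, derivable_pt_lim_const.
    + apply (is_derive_plus (fun x => t * f 0%nat x) (fun x => s * x)).
      * apply (is_derive_scal (f 0%nat)), hf.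
      * apply (is_derive_scal (fun x => x)), is_derive_Reals, derivable_pt_lim_id.
  - intros x _.
    rewrite <- (Rplus_0_r (t * f 2%nat x)).
    apply (is_derive_plus (fun x => t * f 1%nat x) (fun x => s)).
    + apply (is_derive_scal (f 1%nat)), hf.
    + apply is_derive_Reals, derivable_pt_lim_const.
  - intros x _.
    apply (continuous_mult (fun _ => t) (f 2%nat));
      [apply continuous_const|now apply chain_continuous].
  - nra.
  - intros x hx.
    assert (G : r * A <= t * f 1%nat x).
    { apply Rle_trans with (t * (ka * (A / r) ^ (m - 1))).
      - apply Rle_trans with (r * A ^ (m - 1)).
        + apply Rmult_le_compat_l; [lra|].
          rewrite <- (pow_1 A) at 1; apply Rle_pow; [lra|lia].
        + right; unfold Rdiv; rewrite Rpow_mult_distr, pow_inv, te.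
          destruct m as [|n]; [lia|]; replace (S n - 1)%nat with n by lia.
          simpl (r ^ S n); field; repeat split; try lra; apply pow_nonzero; lra.
      - apply Rmult_le_compat_l; [lra|].
        eapply Rle_trans; [|apply F1; lra].
        apply Rmult_le_compat_l; [lra|apply pow_incr; lra]. }
    apply Rabs_le_between in hs; nra.
  - intros x hx; apply Rmult_le_pos; [lra|apply F2; lra]. }
assert (H3 := model_limit_close m tau A hm A1).
assert (H4 : Rabs (r * I2) <= 4 / A).
{ rewrite Rabs_mult, (Rabs_pos_eq r) by lra.
  replace (4 / A) with (r * (2 / (r * A / 2))) by (field; lra).
  apply Rmult_le_compat_l; lra. }
unfold plus; simpl.
replace (r * (I1 + I2) - model_limit m tau)
  with ((r * I1 - model_integral m tau A)
        + (model_integral m tau A - model_limit m tau) + r * I2) by ring.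
eapply Rle_trans; [apply Rabs_triang|].
eapply Rle_trans; [apply Rplus_le_compat_r, Rabs_triang|].
replace (5 / A) with (4 / A + / A) in A2 by (field; lra).
lra.
Qed.

(** * Complex integrals and the contribution of one stationary point *)

Definition ex_CInt (f : R -> C) (a b : R) : Prop :=
  ex_RInt (fun x => Re (f x)) a b /\ ex_RInt (fun x => Im (f x)) a b.

Definition CInt (f : R -> C) (a b : R) : C :=
  (RInt (fun x => Re (f x)) a b, RInt (fun x => Im (f x)) a b).

Lemma CInt_ext (f g : R -> C) (a b : R) :
  (forall x, Rmin a b < x < Rmax a b -> f x = g x) -> CInt f a b = CInt g a b.
Proof.
intros h; unfold CInt; f_equal; apply (RInt_ext (V := R_CompleteNormedModule));
intros x hx; now rewrite h.
Qed.

Lemma CInt_Chasles (f : R -> C) (a b c : R) :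
  ex_CInt f a b -> ex_CInt f b c -> (CInt f a b + CInt f b c)%C = CInt f a c.
Proof.
intros [h1 h2] [h3 h4]; unfold CInt, Cplus; simpl; f_equal.
- exact (RInt_Chasles (V := R_CompleteNormedModule) _ _ _ _ h1 h3).
- exact (RInt_Chasles (V := R_CompleteNormedModule) _ _ _ _ h2 h4).
Qed.

Lemma is_RInt_lin2 (f g : R -> R) (a b u v : R) :
  ex_RInt f a b -> ex_RInt g a b ->
  is_RInt (fun x => u * f x + v * g x) a b (u * RInt f a b + v * RInt g a b).
Proof.
intros hf hg.
apply (is_RInt_plus (V := R_NormedModule) (fun x => u * f x) (fun x => v * g x)).
- apply (is_RInt_scal (V := R_NormedModule) f), (RInt_correct (V := R_CompleteNormedModule)), hf.
- apply (is_RInt_scal (V := R_NormedModule) g), (RInt_correct (V := R_CompleteNormedModule)), hg.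
Qed.

Lemma CInt_scal (c : C) (f : R -> C) (a b : R) :
  ex_CInt f a b ->
  ex_CInt (fun x => c * f x)%C a b /\ CInt (fun x => c * f x)%C a b = (c * CInt f a b)%C.
Proof.
intros [h1 h2].
assert (R1 := is_RInt_lin2 _ _ a b (Re c) (- Im c) h1 h2).
assert (R2 := is_RInt_lin2 _ _ a b (Re c) (Im c) h2 h1).
apply (is_RInt_ext (V := R_NormedModule) _ (fun x => Re (c * f x)%C)) in R1.
2:{ intros x _; unfold Cmult, Re, Im; simpl; ring. }
apply (is_RInt_ext (V := R_NormedModule) _ (fun x => Im (c * f x)%C)) in R2.
2:{ intros x _; unfold Cmult, Re, Im; simpl; ring. }
split; [split; eexists; eauto|].
unfold CInt.
rewrite (is_RInt_unique (V := R_CompleteNormedModule) _ _ _ _ R1).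
rewrite (is_RInt_unique (V := R_CompleteNormedModule) _ _ _ _ R2).
unfold Cmult, Re, Im; simpl; f_equal; ring.
Qed.

Lemma CInt_plus (f g : R -> C) (a b : R) :
  ex_CInt f a b -> ex_CInt g a b ->
  ex_CInt (fun x => f x + g x)%C a b
  /\ CInt (fun x => f x + g x)%C a b = (CInt f a b + CInt g a b)%C.
Proof.
intros [h1 h2] [h3 h4]; split.
- split; apply (ex_RInt_plus (V := R_CompleteNormedModule)); auto.
- unfold CInt, Cplus; f_equal; apply (RInt_plus (V := R_CompleteNormedModule)); auto.
Qed.

Lemma Cmod_le_Re_Im (z : C) : Cmod z <= Rabs (Re z) + Rabs (Im z).
Proof.
destruct z as [x y]; unfold Re, Im; simpl.
replace (x, y) with (RtoC x + (0, y))%C by (unfold Cplus, RtoC; simpl; f_equal; ring).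
eapply Rle_trans; [apply Cmod_triangle|].
rewrite Cmod_R; apply Rplus_le_compat_l.
unfold Cmod; simpl; right; rewrite <- sqrt_Rsqr_abs; f_equal; unfold Rsqr; ring.
Qed.

Lemma Cmod_CInt_le (f : R -> C) (a b B : R) :
  a <= b -> ex_CInt f a b -> (forall x, a <= x <= b -> Cmod (f x) <= B) ->
  Cmod (CInt f a b) <= 2 * ((b - a) * B).
Proof.
intros hab [h1 h2] hB.
eapply Rle_trans; [apply Cmod_le_Re_Im|].
unfold CInt, Re at 1, Im at 2; simpl.
assert (Rabs (RInt (fun x => Re (f x)) a b) <= (b - a) * B).
{ apply abs_RInt_le_const; auto; intros x hx.
  eapply Rle_trans; [apply re_le_Cmod|auto]. }
assert (Rabs (RInt (fun x => Im (f x)) a b) <= (b - a) * B).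
{ apply abs_RInt_le_const; auto; intros x hx.
  eapply Rle_trans; [apply Rmax_r|]; eapply Rle_trans; [apply Rmax_Cmod|auto]. }
lra.
Qed.

Lemma expi_plus (x y : R) : expi (x + y) = (expi x * expi y)%C.
Proof.
unfold expi, Cmult; simpl; rewrite cos_plus, sin_plus; f_equal; ring.
Qed.

Lemma Cmod_expi (x : R) : Cmod (expi x) = 1.
Proof.
unfold Cmod, expi; simpl; rewrite !Rmult_1_r.
rewrite Rplus_comm; fold (Rsqr (sin x)) (Rsqr (cos x)).
now rewrite sin2_cos2, sqrt_1.
Qed.

Lemma ex_CInt_expi (f : R -> R) (a b : R) :
  (forall x, continuous f x) -> ex_CInt (fun x => expi (f x)) a b.
Proof.
intros hf; split; apply (ex_RInt_continuous (V := R_CompleteNormedModule)); intros x _.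
- apply (continuous_comp f cos); [auto|apply continuous_cos].
- apply (continuous_comp f sin); [auto|apply continuous_sin].
Qed.

(** The amplitude integral of the walk, for the phase [phi = P + alpha theta];
    [s] is the fractional part of [alpha t]. *)
Definition osc (phi : R -> R) (t s a b : R) : C :=
  CInt (fun x => expi (t * phi x - s * x)) a b.

Definition wave (phi : R -> R) (ld : list (R * C)) (t s : R) : C :=
  fold_right (fun p z => snd p * expi (t * phi (fst p) - s * fst p) + z)%C (RtoC 0) ld.

Definition root (M : nat) (t : R) : R := Rpower t (/ INR M).

(** The bound has to be uniform in [s]: along the walk [s] is the fractional part of
    [alpha t], which does not converge. *)
Definition asymptotics (phi : R -> R) (M : nat) (a b : R) (ld : list (R * C)) : Prop :=
  forall eps, 0 < eps -> exists t0, forall t, t0 <= t -> forall s, 0 <= s <= 1 ->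
    Cmod (RtoC (root M t) * osc phi t s a b - wave phi ld t s) <= eps.

Lemma continuous_phase (phi : R -> R) (t s : R) :
  (forall x, continuous phi x) -> forall x, continuous (fun x => t * phi x - s * x) x.
Proof.
intros hf x.
apply (continuous_minus (fun x => t * phi x) (fun x => s * x)).
- apply (continuous_mult (fun _ => t) phi); [apply continuous_const|auto].
- continuous_by_derivative.
Qed.

Lemma root_pos (M : nat) (t : R) : 0 < root M t.
Proof. apply exp_pos. Qed.

Lemma root_pow (M : nat) (t : R) : (1 <= M)%nat -> 0 < t -> root M t ^ M = t.
Proof.
intros hM ht; unfold root.
rewrite <- Rpower_pow by apply root_pos.
rewrite Rpower_mult, Rinv_l; [now apply Rpower_1|apply not_0_INR; lia].
Qed.

Lemma Rpower_decay (eta eps : R) : 0 < eta -> 0 < eps ->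
  exists t0, 1 <= t0 /\ forall t, t0 <= t -> Rpower t (- eta) <= eps.
Proof.
intros he hp.
exists (Rmax 1 (Rpower (/ eps) (/ eta))); split; [apply Rmax_l|].
intros t ht.
assert (H : Rpower (/ eps) (/ eta) <= t) by (eapply Rle_trans; [apply Rmax_r|exact ht]).
assert (pe : 0 < / eps) by now apply Rinv_0_lt_compat.
rewrite Rpower_Ropp, <- (Rinv_inv eps).
apply Rinv_le_contravar; auto.
replace (/ eps) with (Rpower (Rpower (/ eps) (/ eta)) eta).
- apply Rle_Rpower_l; [lra|split; [apply exp_pos|auto]].
- rewrite Rpower_mult, Rinv_l by lra; now apply Rpower_1.
Qed.

(** A negative leading coefficient is reduced to a positive one by replacing the
    phase by its opposite, which flips the sign of the offset [tau]. *)
Lemma one_sided_signed (f : nat -> R -> R) (m : nat) (sg tau : R) :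
  sg = 1 \/ sg = -1 ->
  deriv_chain f -> (2 <= m)%nat ->
  (forall i, (i < m)%nat -> f i 0 = 0) -> 0 < sg * f m 0 ->
  exists d0, 0 < d0 /\ forall d, 0 < d <= d0 -> forall eps, 0 < eps ->
  exists t0, forall t, t0 <= t -> forall s, Rabs s <= 1 ->
  forall r, 0 < r -> r ^ m = t * (Rabs (f m 0) / INR (fact m)) ->
  Rabs (r * RInt (fun x => cos (tau + (t * f 0%nat x + s * x))) 0 d
        - model_limit m (sg * tau)) <= eps.
Proof.
intros hsg hf hm h0 hpos.
destruct (one_sided_asymptotics (fun n x => sg * f n x) m (sg * tau)) as [d0 [pd H]]; auto.
- intros n x; apply (is_derive_scal (f n)), hf.
- intros i hi; rewrite h0; auto; ring.
- exists d0; split; auto; intros d hd eps he.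
  destruct (H d hd eps he) as [t0 Ht]; exists t0; intros t ht s hs r hr er.
  rewrite (RInt_ext (V := R_CompleteNormedModule) _
    (fun x => cos (sg * tau + (t * (sg * f 0%nat x) + sg * s * x)))).
  + apply Ht; auto.
    * destruct hsg as [-> | ->]; [now rewrite Rmult_1_l|].
      now replace (-1 * s) with (- s) by ring; rewrite Rabs_Ropp.
    * rewrite er; do 2 f_equal; rewrite <- (Rabs_pos_eq (sg * f m 0)) by lra.
      rewrite Rabs_mult; destruct hsg as [-> | ->].
      -- rewrite Rabs_R1; ring.
      -- rewrite Rabs_m1; ring.
  + intros x _; destruct hsg as [-> | ->]; [f_equal; ring|].
    rewrite <- cos_neg; f_equal; ring.
Qed.

Lemma model_limit_opp_sqr (m : nat) :
  model_limit m (PI / 2) ^ 2 = model_limit m (- (PI / 2)) ^ 2.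
Proof.
replace (model_limit m (PI / 2)) with (- model_limit m (- (PI / 2))); [ring|].
unfold model_limit.
rewrite (Lim_seq_ext (fun n => model_integral m (PI / 2) (INR n))
           (fun n => - model_integral m (- (PI / 2)) (INR n))).
- rewrite Lim_seq_opp; destruct (Lim_seq _); simpl; ring.
- intros n.
  replace (PI / 2) with (- (PI / 2) + PI) at 1 by field.
  rewrite model_integral_add, cos_PI, sin_PI; ring.
Qed.

(** Both sides of a stationary point of order [m]. The real part of the constant
    is [2 int_0^oo cos (y^m) dy] whatever the signs, so it cannot vanish. *)
Lemma stationary_point_asymptotics (phi : nat -> R -> R) (m : nat) (x0 : R) :
  deriv_chain phi -> (2 <= m)%nat ->
  (forall i, (1 <= i < m)%nat -> phi i x0 = 0) -> phi m x0 <> 0 ->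
  exists D : C, ((3 <= m)%nat -> D <> RtoC 0) /\ (m = 2%nat -> Cmod D ^ 2 = PI) /\
  exists d0, 0 < d0 /\ forall d, 0 < d <= d0 -> forall eps, 0 < eps ->
  exists t0, forall t, t0 <= t -> forall s, 0 <= s <= 1 ->
  forall r, 0 < r -> r ^ m = t * (Rabs (phi m x0) / INR (fact m)) ->
  Cmod (RtoC r * osc (phi 0%nat) t s (x0 - d) (x0 + d)
        - D * expi (t * phi 0%nat x0 - s * x0)) <= eps.
Proof.
intros hphi hm h0 hn.
assert (SG : exists sg, (sg = 1 \/ sg = -1) /\ 0 < sg * phi m x0).
{ destruct (Rle_lt_dec 0 (phi m x0)).
  - exists 1; split; [auto|lra].
  - exists (-1); split; [auto|lra]. }
destruct SG as [sg [hsg psg]].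
set (sl := sg * (-1) ^ m).
assert (E2 : (-1) ^ m * (-1) ^ m = 1).
{ rewrite <- Rpow_mult_distr; replace (-1 * -1) with 1 by ring; apply pow1. }
assert (E1 : (-1) ^ m = 1 \/ (-1) ^ m = -1).
{ destruct (Rmult_integral ((-1) ^ m - 1) ((-1) ^ m + 1)); [|left|right]; lra. }
assert (hsl : sl = 1 \/ sl = -1).
{ unfold sl; destruct hsg as [-> | ->], E1 as [-> | ->]; lra. }
set (fr := fun n y => phi n (x0 + y) - match n with O => phi 0%nat x0 | _ => 0 end).
set (fl := fun n y => (-1) ^ n * phi n (x0 - y) - match n with O => phi 0%nat x0 | _ => 0 end).
assert (cr : deriv_chain fr).
{ intros n y; unfold fr at 2; rewrite Rminus_0_r.
  rewrite <- (Rminus_0_r (phi (S n) (x0 + y))).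
  apply (is_derive_minus (fun y => phi n (x0 + y)) (fun _ => match n with O => phi 0%nat x0 | _ => 0 end)).
  - rewrite <- (Rmult_1_l (phi (S n) (x0 + y))).
    apply (is_derive_comp (phi n) (fun y => x0 + y)); [apply hphi|].
    auto_derive; auto.
  - apply is_derive_Reals, derivable_pt_lim_const. }
assert (cl : deriv_chain fl).
{ intros n y; unfold fl at 2; rewrite Rminus_0_r.
  rewrite <- (Rminus_0_r ((-1) ^ S n * phi (S n) (x0 - y))).
  apply (is_derive_minus (fun y => (-1) ^ n * phi n (x0 - y)) (fun _ => match n with O => phi 0%nat x0 | _ => 0 end)).
  - replace ((-1) ^ S n * phi (S n) (x0 - y)) with ((-1) ^ n * (-1 * phi (S n) (x0 - y)))
      by (simpl; ring).
    apply (is_derive_scal (fun y => phi n (x0 - y))).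
    apply (is_derive_comp (phi n) (fun y => x0 - y)); [apply hphi|].
    auto_derive; auto; ring.
  - apply is_derive_Reals, derivable_pt_lim_const. }
assert (zr : forall i, (i < m)%nat -> fr i 0 = 0).
{ intros [|i] hi; unfold fr; rewrite Rplus_0_r; [ring|rewrite h0 by lia; ring]. }
assert (zl : forall i, (i < m)%nat -> fl i 0 = 0).
{ intros [|i] hi; unfold fl; rewrite ?(Rminus_0_r x0); [simpl; ring|rewrite h0 by lia; ring]. }
assert (vr : fr m 0 = phi m x0).
{ unfold fr; rewrite Rplus_0_r; destruct m; [lia|ring]. }
assert (vl : fl m 0 = (-1) ^ m * phi m x0).
{ unfold fl; rewrite (Rminus_0_r x0); destruct m; [lia|ring]. }
assert (pr : 0 < sg * fr m 0) by (rewrite vr; auto).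
assert (pl : 0 < sl * fl m 0).
{ rewrite vl; unfold sl.
  replace (sg * (-1) ^ m * ((-1) ^ m * phi m x0))
    with (sg * phi m x0 * ((-1) ^ m * (-1) ^ m)) by ring.
  rewrite E2; lra. }
assert (al : Rabs (fl m 0) = Rabs (phi m x0)).
{ rewrite vl, Rabs_mult; destruct E1 as [-> | ->]; rewrite ?Rabs_R1, ?Rabs_m1; ring. }
set (D := (2 * model_limit m 0,
           model_limit m (sg * - (PI / 2)) + model_limit m (sl * - (PI / 2))) : C).
exists D; split; [|split].
- intros h3 e; injection e as e _.
  pose proof (model_limit_pos m h3); lra.
- intros ->.
  assert (sl = sg) as esl by (unfold sl; simpl; ring).
  unfold D; rewrite esl.
  assert (HS : model_limit 2 (sg * - (PI / 2)) ^ 2 = model_limit 2 (- (PI / 2)) ^ 2).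
  { destruct hsg as [-> | ->].
    - now rewrite Rmult_1_l.
    - replace (-1 * - (PI / 2)) with (PI / 2) by ring; apply model_limit_opp_sqr. }
  unfold Cmod; rewrite pow2_sqrt.
  + simpl fst; simpl snd; pose proof fresnel; nra.
  + simpl fst; simpl snd; apply Rplus_le_le_0_compat; apply pow2_ge_0.
- destruct (one_sided_signed fr m sg 0 hsg cr hm zr pr) as [d1 [pd1 A1]].
  destruct (one_sided_signed fr m sg (- (PI / 2)) hsg cr hm zr pr) as [d2 [pd2 A2]].
  destruct (one_sided_signed fl m sl 0 hsl cl hm zl pl) as [d3 [pd3 A3]].
  destruct (one_sided_signed fl m sl (- (PI / 2)) hsl cl hm zl pl) as [d4 [pd4 A4]].
  rewrite vr in A1, A2; rewrite al in A3, A4.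
  exists (Rmin (Rmin d1 d2) (Rmin d3 d4)); split; [repeat apply Rmin_pos; auto|].
  intros d [pd hd] eps he.
  pose proof (Rmin_l (Rmin d1 d2) (Rmin d3 d4)); pose proof (Rmin_r (Rmin d1 d2) (Rmin d3 d4)).
  pose proof (Rmin_l d1 d2); pose proof (Rmin_r d1 d2).
  pose proof (Rmin_l d3 d4); pose proof (Rmin_r d3 d4).
  assert (he4 : 0 < eps / 4) by lra.
  destruct (A1 d ltac:(lra) _ he4) as [t1 B1]; clear A1.
  destruct (A2 d ltac:(lra) _ he4) as [t2 B2]; clear A2.
  destruct (A3 d ltac:(lra) _ he4) as [t3 B3]; clear A3.
  destruct (A4 d ltac:(lra) _ he4) as [t4 B4]; clear A4.
  exists (Rmax (Rmax t1 t2) (Rmax t3 t4)); intros t ht s hs r hr er.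
  pose proof (Rmax_l (Rmax t1 t2) (Rmax t3 t4)); pose proof (Rmax_r (Rmax t1 t2) (Rmax t3 t4)).
  pose proof (Rmax_l t1 t2); pose proof (Rmax_r t1 t2).
  pose proof (Rmax_l t3 t4); pose proof (Rmax_r t3 t4).
  assert (hs1 : Rabs s <= 1) by (apply Rabs_le; lra).
  assert (hs2 : Rabs (- s) <= 1) by now rewrite Rabs_Ropp.
  specialize (B1 t ltac:(lra) (- s) hs2 r hr er).
  specialize (B2 t ltac:(lra) (- s) hs2 r hr er).
  specialize (B3 t ltac:(lra) s hs1 r hr er).
  specialize (B4 t ltac:(lra) s hs1 r hr er).
  assert (c0 : forall x, continuous (phi 0%nat) x) by (intros x; now apply chain_continuous).
  set (g := fun x => t * (phi 0%nat x - phi 0%nat x0) - s * (x - x0)).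
  assert (cg : forall x, continuous g x).
  { intros x; unfold g.
    apply (continuous_minus (fun x => t * (phi 0%nat x - phi 0%nat x0)) (fun x => s * (x - x0))).
    - apply (continuous_mult (fun _ => t) (fun x => phi 0%nat x - phi 0%nat x0));
        [apply continuous_const|].
      apply (continuous_minus (phi 0%nat) (fun _ => phi 0%nat x0)); [auto|apply continuous_const].
    - continuous_by_derivative. }
  assert (EO : osc (phi 0%nat) t s (x0 - d) (x0 + d)
    = (expi (t * phi 0%nat x0 - s * x0) * CInt (fun x => expi (g x)) (x0 - d) (x0 + d))%C).
  { rewrite <- (proj2 (CInt_scal _ _ _ _ (ex_CInt_expi g _ _ cg))).
    apply CInt_ext; intros x _; rewrite <- expi_plus; f_equal; unfold g; ring. }
  assert (J : forall tau, RInt (fun x => cos (tau + g x)) (x0 - d) (x0 + d)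
    = RInt (fun y => cos (tau + (t * fr 0%nat y + - s * y))) 0 d
      + RInt (fun y => cos (tau + (t * fl 0%nat y + s * y))) 0 d).
  { intros tau.
    assert (ex : forall u v, ex_RInt (fun x => cos (tau + g x)) u v).
    { intros u v; apply (ex_RInt_continuous (V := R_CompleteNormedModule)); intros x _.
      apply (continuous_comp (fun x => tau + g x) cos); [|apply continuous_cos].
      apply (continuous_plus (fun _ => tau) g); [apply continuous_const|auto]. }
    rewrite <- (RInt_Chasles (V := R_CompleteNormedModule) _ (x0 - d) x0 (x0 + d)) by auto.
    unfold plus; simpl; rewrite Rplus_comm; f_equal.
    - pose proof (RInt_comp_lin (V := R_CompleteNormedModule)
        (fun x => cos (tau + g x)) 1 x0 0 d (ex _ _)) as E.
      replace (1 * 0 + x0) with x0 in E by ring; replace (1 * d + x0) with (x0 + d) in E by ring.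
      rewrite <- E; apply (RInt_ext (V := R_CompleteNormedModule)); intros y _.
      unfold scal; simpl; unfold mult; simpl; rewrite Rmult_1_l; f_equal.
      unfold g, fr; replace (1 * y + x0) with (x0 + y) by ring; ring.
    - pose proof (RInt_comp_lin (V := R_CompleteNormedModule)
        (fun x => cos (tau + g x)) (-1) x0 0 d (ex _ _)) as E.
      replace (-1 * 0 + x0) with x0 in E by ring; replace (-1 * d + x0) with (x0 - d) in E by ring.
      rewrite <- (opp_RInt_swap (V := R_CompleteNormedModule)) by auto.
      rewrite <- E, <- (RInt_opp (V := R_CompleteNormedModule)).
      + apply (RInt_ext (V := R_CompleteNormedModule)); intros y _.
        unfold opp, scal; simpl; unfold mult; simpl.
        replace (-1 * y + x0) with (x0 - y) by ring.
        replace (tau + g (x0 - y)) with (tau + (t * fl 0%nat y + s * y))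
          by (unfold g, fl; simpl; ring).
        ring.
      + apply (ex_RInt_comp_lin (V := R_NormedModule) (fun x => cos (tau + g x))); auto. }
  rewrite EO.
  set (w := expi (t * phi 0%nat x0 - s * x0)); set (K := CInt _ _ _).
  replace (RtoC r * (w * K) - D * w)%C with (w * (RtoC r * K - D))%C by ring.
  rewrite Cmod_mult; unfold w; rewrite Cmod_expi, Rmult_1_l.
  assert (K1 : Re K = RInt (fun x => cos (0 + g x)) (x0 - d) (x0 + d)).
  { apply (RInt_ext (V := R_CompleteNormedModule)); intros x _; rewrite Rplus_0_l; reflexivity. }
  assert (K2 : Im K = RInt (fun x => cos (- (PI / 2) + g x)) (x0 - d) (x0 + d)).
  { apply (RInt_ext (V := R_CompleteNormedModule)); intros x _.
    replace (- (PI / 2) + g x) with (- (PI / 2 - g x)) by ring.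
    rewrite cos_neg, cos_shift; reflexivity. }
  rewrite J in K1, K2.
  eapply Rle_trans; [apply Cmod_le_Re_Im|].
  replace (Re (RtoC r * K - D)%C) with (r * Re K - 2 * model_limit m 0)
    by (unfold Re; destruct K; simpl; ring).
  replace (Im (RtoC r * K - D)%C)
    with (r * Im K - (model_limit m (sg * - (PI / 2)) + model_limit m (sl * - (PI / 2))))
    by (unfold Im; destruct K; simpl; ring).
  rewrite K1, K2.
  rewrite Rmult_0_r in B1, B3.
  apply Rabs_le_between in B1; apply Rabs_le_between in B2.
  apply Rabs_le_between in B3; apply Rabs_le_between in B4.
  replace eps with (eps / 2 + eps / 2) by lra.
  apply Rplus_le_compat; apply Rabs_le; lra.
Qed.

(** * Stationary phase on an interval *)

(** Uniformity in [s] costs nothing: for large [t] the term [s] is at most half of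
    [t |phi'|]. *)
Lemma osc_decay (phi : nat -> R -> R) (a b : R) :
  deriv_chain phi -> a <= b -> (forall x, a <= x <= b -> phi 1%nat x <> 0) ->
  exists K t0, 0 < K /\ 1 <= t0 /\ forall t, t0 <= t -> forall s, 0 <= s <= 1 ->
    Cmod (osc (phi 0%nat) t s a b) <= K / t.
Proof.
intros hphi hab hn.
destruct (bounded_away_on_segment (phi 1%nat) a b hab) as [c [pc hc]]; auto.
{ intros x _; now apply chain_continuous. }
destruct (bounded_on_segment (phi 2%nat) a b hab) as [B [pB hB]].
{ intros x _; now apply chain_continuous. }
set (K0 := 4 / c + (b - a) * (4 * B / c ^ 2)).
assert (pK0 : 0 < K0).
{ apply Rplus_lt_le_0_compat; [apply Rdiv_lt_0_compat; lra|].
  apply Rmult_le_pos; [lra|]; left; apply Rdiv_lt_0_compat; [lra|apply pow_lt; auto]. }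
exists (2 * K0), (Rmax 1 (2 / c)); split; [lra|split; [apply Rmax_l|]].
intros t ht s hs.
assert (t1 : 1 <= t) by (eapply Rle_trans; [apply Rmax_l|exact ht]).
assert (tc : 2 <= t * c).
{ apply (Rle_div_l 2 t c); auto; eapply Rle_trans; [apply Rmax_r|exact ht]. }
assert (N : forall tau,
  Rabs (RInt (fun x => cos (tau + (t * phi 0%nat x - s * x))) a b) <= K0 / t).
{ intros tau.
  replace (K0 / t) with (2 / (t * c / 2) + (b - a) * (t * B / (t * c / 2) ^ 2))
    by (unfold K0; field; lra).
  apply (nonstationary_bound (fun x => tau + (t * phi 0%nat x - s * x))
    (fun x => t * phi 1%nat x - s) (fun x => t * phi 2%nat x)); auto; try lra.
  - intros x _.
    replace (t * phi 1%nat x - s) with (0 + (t * phi 1%nat x - s * 1)) by ring.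
    apply (is_derive_plus (fun _ => tau) (fun x => t * phi 0%nat x - s * x)).
    + apply is_derive_Reals, derivable_pt_lim_const.
    + apply (is_derive_minus (fun x => t * phi 0%nat x) (fun x => s * x)).
      * apply (is_derive_scal (phi 0%nat)), hphi.
      * apply (is_derive_scal (fun x => x)), is_derive_Reals, derivable_pt_lim_id.
  - intros x _.
    rewrite <- (Rminus_0_r (t * phi 2%nat x)).
    apply (is_derive_minus (fun x => t * phi 1%nat x) (fun x => s)).
    + apply (is_derive_scal (phi 1%nat)), hphi.
    + apply is_derive_Reals, derivable_pt_lim_const.
  - intros x _.
    apply (continuous_mult (fun _ => t) (phi 2%nat));
      [apply continuous_const|now apply chain_continuous].
  - intros x hx; specialize (hc x hx).
    pose proof (Rabs_triang_inv (t * phi 1%nat x) s) as h.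
    rewrite Rabs_mult, (Rabs_pos_eq t), (Rabs_pos_eq s) in h by lra.
    nra.
  - intros x hx; specialize (hB x hx).
    rewrite Rabs_mult, (Rabs_pos_eq t) by lra; apply Rmult_le_compat_l; lra. }
eapply Rle_trans; [apply Cmod_le_Re_Im|].
pose proof (N 0) as N1; pose proof (N (- (PI / 2))) as N2.
rewrite (RInt_ext (V := R_CompleteNormedModule) _
  (fun x => Re (expi (t * phi 0%nat x - s * x)))) in N1.
2:{ intros x _; now rewrite Rplus_0_l. }
rewrite (RInt_ext (V := R_CompleteNormedModule) _
  (fun x => Im (expi (t * phi 0%nat x - s * x)))) in N2.
2:{ intros x _.
    replace (- (PI / 2) + (t * phi 0%nat x - s * x))
      with (- (PI / 2 - (t * phi 0%nat x - s * x))) by ring.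
    rewrite cos_neg, cos_shift; reflexivity. }
replace (2 * K0 / t) with (K0 / t + K0 / t) by (field; lra).
apply Rplus_le_compat; auto.
Qed.

Lemma asymptotics_nonstationary (phi : nat -> R -> R) (M : nat) (a b : R) :
  deriv_chain phi -> (2 <= M)%nat -> a <= b ->
  (forall x, a <= x <= b -> phi 1%nat x <> 0) ->
  asymptotics (phi 0%nat) M a b nil.
Proof.
intros hphi hM hab hn eps he.
destruct (osc_decay phi a b hphi hab hn) as [K [t1 [pK [h1 H]]]].
assert (hM' : 2 <= INR M) by (apply (le_INR 2); auto).
assert (eta : 0 < 1 - / INR M).
{ assert (/ INR M <= / 2) by (apply Rinv_le_contravar; lra); lra. }
destruct (Rpower_decay (1 - / INR M) (eps / K) eta) as [t2 [h2 H2]].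
{ apply Rdiv_lt_0_compat; auto. }
exists (Rmax t1 t2); intros t ht s hs.
pose proof (Rmax_l t1 t2); pose proof (Rmax_r t1 t2).
specialize (H t ltac:(lra) s hs); specialize (H2 t ltac:(lra)).
unfold wave; simpl.
replace (RtoC (root M t) * osc (phi 0%nat) t s a b - 0)%C
  with (RtoC (root M t) * osc (phi 0%nat) t s a b)%C by ring.
rewrite Cmod_mult, Cmod_R, Rabs_pos_eq by (left; apply root_pos).
apply Rle_trans with (root M t * (K / t)).
{ apply Rmult_le_compat_l; [left; apply root_pos|auto]. }
replace (root M t * (K / t)) with (K * Rpower t (- (1 - / INR M))).
- apply Rle_trans with (K * (eps / K)); [apply Rmult_le_compat_l; lra|].
  right; field; lra.
- replace (- (1 - / INR M)) with (/ INR M + - (1)) by ring.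
  rewrite Rpower_plus, Rpower_Ropp, Rpower_1 by lra.
  unfold root; field; lra.
Qed.

(** The contribution of the stationary point [x] on the scale [t^(-1/M)]: [d = 0]
    when [x] is of order less than [M]. *)
Definition local_coefficient (phi : R -> R) (M : nat) (x : R) (d : C) : Prop :=
  exists d0, 0 < d0 /\ forall e, 0 < e <= d0 ->
    asymptotics phi M (x - e) (x + e) ((x, d) :: nil).

Definition order (phi : nat -> R -> R) (x : R) (m : nat) : Prop :=
  (2 <= m)%nat /\ (forall i, (1 <= i < m)%nat -> phi i x = 0) /\ phi m x <> 0.

Lemma local_coefficient_exists (phi : nat -> R -> R) (M m : nat) (x : R) :
  deriv_chain phi -> order phi x m -> (m <= M)%nat ->
  exists d : C, local_coefficient (phi 0%nat) M x d
   /\ (m = M -> (3 <= M)%nat -> d <> RtoC 0)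
   /\ (M = 2%nat -> Cmod d ^ 2 = 2 * PI / Rabs (phi 2%nat x)).
Proof.
intros hphi [hm [h0 hn]] hmM.
destruct (stationary_point_asymptotics phi m x hphi hm h0 hn)
  as [D [D3 [D2 [d0 [pd H]]]]].
set (ka := Rabs (phi m x) / INR (fact m)) in *.
assert (pka : 0 < ka) by (apply Rdiv_lt_0_compat; [now apply Rabs_pos_lt|apply INR_fact_lt_0]).
set (c := root m ka).
assert (pc : 0 < c) by apply root_pos.
assert (nc : RtoC c <> RtoC 0) by (intros e; injection e; lra).
assert (rc : forall t, 0 < t -> (root m t * c) ^ m = t * ka).
{ intros t ht; rewrite Rpow_mult_distr; unfold c; rewrite !root_pow; auto; lia. }
(* division by [c] brings the scale [(t ka)^(1/m)] back to [t^(1/m)] *)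
assert (H' : forall e, 0 < e <= d0 -> forall eps, 0 < eps -> exists t0, 1 <= t0 /\
  forall t, t0 <= t -> forall s, 0 <= s <= 1 ->
  Cmod (RtoC (root m t) * osc (phi 0%nat) t s (x - e) (x + e)
        - D / RtoC c * expi (t * phi 0%nat x - s * x)) <= eps).
{ intros e hee eps he.
  destruct (H e hee (eps * c)) as [t0 Ht]; [apply Rmult_lt_0_compat; auto|].
  exists (Rmax 1 t0); split; [apply Rmax_l|]; intros t ht s hs.
  pose proof (Rmax_l 1 t0); pose proof (Rmax_r 1 t0).
  specialize (Ht t ltac:(lra) s hs (root m t * c)).
  apply Rmult_le_reg_r with c; auto.
  rewrite <- (Rabs_pos_eq c) at 2 by lra; rewrite <- Cmod_R, <- Cmod_mult.
  refine (Rle_trans _ _ _ _ (Ht _ _)).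
  - right; f_equal; rewrite RtoC_mult; field; auto.
  - apply Rmult_lt_0_compat; auto; apply root_pos.
  - apply rc; lra. }
destruct (Nat.eq_dec m M) as [->|ne].
- exists (D / RtoC c)%C; split; [|split].
  + exists d0; split; auto; intros e hee eps he.
    destruct (H' e hee eps he) as [t0 [_ Ht]]; exists t0; intros t ht s hs.
    unfold wave; simpl.
    replace (D / RtoC c * expi (t * phi 0%nat x - s * x) + 0)%C
      with (D / RtoC c * expi (t * phi 0%nat x - s * x))%C by ring.
    apply Ht; auto.
  + intros _ h3 E; apply (D3 h3).
    replace D with (D / RtoC c * RtoC c)%C by (field; auto).
    rewrite E; ring.
  + intros ->; rewrite Cmod_div, Cmod_R, Rabs_pos_eq by (auto; lra).
    unfold Rdiv at 1; rewrite Rpow_mult_distr, (D2 eq_refl), pow_inv.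
    unfold c; rewrite root_pow by (auto; lia).
    unfold ka; simpl (INR _); field.
    now apply Rabs_no_R0.
- exists (RtoC 0); split; [|split; [easy|lia]].
  exists d0; split; auto; intros e hee eps he.
  destruct (H' e hee 1 Rlt_0_1) as [t0 [h1 Ht]].
  assert (pm : 0 < INR m) by (apply (lt_INR 0); lia).
  assert (eta : 0 < / INR m - / INR M).
  { assert (/ INR M < / INR m); [|lra].
    apply Rinv_0_lt_contravar; auto; apply lt_INR; lia. }
  set (B := Cmod (D / RtoC c) + 1).
  assert (pB : 0 < B) by (pose proof (Cmod_ge_0 (D / RtoC c)); unfold B; lra).
  destruct (Rpower_decay _ (eps / B) eta) as [t2 [h2 H2]]; [apply Rdiv_lt_0_compat; auto|].
  exists (Rmax t0 t2); intros t ht s hs.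
  pose proof (Rmax_l t0 t2); pose proof (Rmax_r t0 t2).
  specialize (Ht t ltac:(lra) s hs); specialize (H2 t ltac:(lra)).
  set (O := osc (phi 0%nat) t s (x - e) (x + e)) in *.
  set (w := expi (t * phi 0%nat x - s * x)) in *.
  unfold wave; simpl.
  replace (RtoC (root M t) * O - (0 * expi (t * phi 0%nat x - s * x) + 0))%C
    with (RtoC (root M t) * O)%C by ring.
  replace (root M t) with (Rpower t (- (/ INR m - / INR M)) * root m t).
  2:{ unfold root; rewrite <- Rpower_plus; f_equal; ring. }
  rewrite RtoC_mult, <- Cmult_assoc, Cmod_mult, Cmod_R.
  rewrite Rabs_pos_eq by (left; apply exp_pos).
  assert (Cmod (RtoC (root m t) * O) <= B).
  { replace (RtoC (root m t) * O)%C
      with (D / RtoC c * w + (RtoC (root m t) * O - D / RtoC c * w))%C by ring.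
    eapply Rle_trans; [apply Cmod_triangle|].
    rewrite Cmod_mult; unfold w at 1; rewrite Cmod_expi, Rmult_1_r.
    unfold B; lra. }
  apply Rle_trans with (eps / B * B); [|right; field; lra].
  apply Rmult_le_compat; auto; [left; apply exp_pos|apply Cmod_ge_0].
Qed.

Lemma wave_app (phi : R -> R) (l1 l2 : list (R * C)) (t s : R) :
  wave phi (l1 ++ l2) t s = (wave phi l1 t s + wave phi l2 t s)%C.
Proof.
induction l1 as [|p l1 IH]; unfold wave in *; simpl; [ring|].
rewrite IH; ring.
Qed.

Lemma wave_perm (phi : R -> R) (l1 l2 : list (R * C)) (t s : R) :
  Permutation l1 l2 -> wave phi l1 t s = wave phi l2 t s.
Proof.
intros h; induction h as [|p l l' h IH|p q l|l l' l'' h IH h' IH'];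
  unfold wave in *; simpl; auto.
- now rewrite IH.
- ring.
- now rewrite IH.
Qed.

Lemma asymptotics_Chasles (phi : R -> R) (M : nat) (a b c : R) (l1 l2 : list (R * C)) :
  (forall x, continuous phi x) ->
  asymptotics phi M a b l1 -> asymptotics phi M b c l2 ->
  asymptotics phi M a c (l1 ++ l2).
Proof.
intros hc h1 h2 eps he.
destruct (h1 (eps / 2) ltac:(lra)) as [t1 H1].
destruct (h2 (eps / 2) ltac:(lra)) as [t2 H2].
exists (Rmax t1 t2); intros t ht s hs.
pose proof (Rmax_l t1 t2); pose proof (Rmax_r t1 t2).
specialize (H1 t ltac:(lra) s hs); specialize (H2 t ltac:(lra) s hs).
assert (E : osc phi t s a c = (osc phi t s a b + osc phi t s b c)%C).
{ symmetry; apply CInt_Chasles; apply (ex_CInt_expi (fun x => t * phi x - s * x));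
    now apply continuous_phase. }
rewrite E, wave_app.
match goal with |- Cmod ?z <= _ => replace z with
  ((RtoC (root M t) * osc phi t s a b - wave phi l1 t s)
   + (RtoC (root M t) * osc phi t s b c - wave phi l2 t s))%C by ring end.
eapply Rle_trans; [apply Cmod_triangle|lra].
Qed.

Lemma exists_leftmost (l : list (R * C)) :
  l <> nil -> exists p l', Permutation l (p :: l') /\ forall q, In q l' -> fst p <= fst q.
Proof.
induction l as [|p l IH]; [easy|intros _].
destruct l as [|q l].
- exists p, nil; split; [apply Permutation_refl|easy].
- destruct IH as [r [l' [hp hr]]]; [easy|].
  destruct (Rle_lt_dec (fst p) (fst r)).
  + exists p, (q :: l); split; [apply Permutation_refl|].
    intros u hu; apply (Permutation_in _ hp) in hu.
    destruct hu as [<-|hu]; [auto|specialize (hr u hu); lra].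
  + exists r, (p :: l'); split.
    * eapply Permutation_trans; [apply perm_skip, hp|apply perm_swap].
    * intros u [<-|hu]; [lra|auto].
Qed.

Lemma exists_gap (x : R) (l : list (R * C)) :
  (forall q, In q l -> x < fst q) ->
  exists g, 0 < g /\ forall q, In q l -> x + g < fst q.
Proof.
induction l as [|p l IH]; intros h.
- exists 1; split; [lra|easy].
- destruct IH as [g [pg hg]]; [intros q hq; apply h; now right|].
  pose proof (h p (or_introl eq_refl)).
  exists (Rmin g ((fst p - x) / 2)); split; [apply Rmin_pos; lra|].
  pose proof (Rmin_l g ((fst p - x) / 2)); pose proof (Rmin_r g ((fst p - x) / 2)).
  intros q [<-|hq]; [lra|specialize (hg q hq); lra].
Qed.

(** Cutting out the leftmost stationary point leaves a piece without stationary
    points on its left and a piece with fewer of them on its right. *)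
Lemma stationary_phase (phi : nat -> R -> R) (M : nat) :
  deriv_chain phi -> (2 <= M)%nat -> forall (ld : list (R * C)) (a b : R),
  a <= b -> NoDup (map fst ld) ->
  (forall p, In p ld -> a < fst p < b /\ local_coefficient (phi 0%nat) M (fst p) (snd p)) ->
  (forall x, a <= x <= b -> phi 1%nat x = 0 -> In x (map fst ld)) ->
  asymptotics (phi 0%nat) M a b ld.
Proof.
intros hphi hM ld.
remember (length ld) as n eqn:hn; revert ld hn.
induction n as [|n IH]; intros ld hn a b hab nd hp hs.
- destruct ld; [|easy].
  apply asymptotics_nonstationary; auto; intros x hx e; exact (hs x hx e).
- destruct (exists_leftmost ld) as [[x d] [l [P hmin]]]; [now destruct ld|].
  assert (nd' : NoDup (map fst ((x, d) :: l))).
  { eapply Permutation_NoDup; [apply Permutation_map, P|exact nd]. }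
  apply NoDup_cons_iff in nd'; destruct nd' as [nx nd']; simpl in nx.
  assert (hlt : forall q, In q l -> x < fst q).
  { intros q hq; destruct (hmin q hq) as [h|h]; auto.
    simpl in h; exfalso; apply nx; rewrite h; now apply in_map. }
  destruct (exists_gap x l hlt) as [g [pg hg]].
  destruct (hp (x, d)) as [hx [d0 [pd loc]]].
  { apply (Permutation_in _ (Permutation_sym P)); now left. }
  simpl in hx, loc.
  set (e := Rmin (Rmin g d0) (Rmin ((x - a) / 2) ((b - x) / 2))).
  assert (pe : 0 < e) by (repeat apply Rmin_pos; lra).
  pose proof (Rmin_l (Rmin g d0) (Rmin ((x - a) / 2) ((b - x) / 2))) as e1.
  pose proof (Rmin_r (Rmin g d0) (Rmin ((x - a) / 2) ((b - x) / 2))) as e2.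
  pose proof (Rmin_l g d0); pose proof (Rmin_r g d0).
  pose proof (Rmin_l ((x - a) / 2) ((b - x) / 2)).
  pose proof (Rmin_r ((x - a) / 2) ((b - x) / 2)).
  fold e in e1, e2.
  assert (inx : forall y, a <= y <= b -> phi 1%nat y = 0 -> y = x \/ In y (map fst l)).
  { intros y hy ey; pose proof (hs y hy ey) as h.
    apply (Permutation_in _ (Permutation_map fst P)) in h.
    destruct h as [h|h]; [left; now rewrite <- h|now right]. }
  assert (A1 : asymptotics (phi 0%nat) M a (x - e) nil).
  { apply asymptotics_nonstationary; auto; [lra|].
    intros y hy ey; destruct (inx y ltac:(lra) ey) as [->|h]; [lra|].
    apply in_map_iff in h; destruct h as [q [<- hq]]; specialize (hlt q hq); lra. }
  assert (A2 := loc e ltac:(lra)).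
  assert (A3 : asymptotics (phi 0%nat) M (x + e) b l).
  { apply IH; auto; try lra.
    - apply Permutation_length in P; simpl in P; lia.
    - intros q hq; destruct (hp q) as [h1 h2].
      { apply (Permutation_in _ (Permutation_sym P)); now right. }
      specialize (hg q hq); split; [lra|auto].
    - intros y hy ey; destruct (inx y ltac:(lra) ey) as [->|h]; [lra|auto]. }
  assert (c0 : forall x, continuous (phi 0%nat) x) by (intros y; now apply chain_continuous).
  pose proof (asymptotics_Chasles _ _ _ _ _ _ _ c0
    (asymptotics_Chasles _ _ _ _ _ _ _ c0 A1 A2) A3) as A.
  simpl in A; intros eps he; destruct (A eps he) as [t0 Ht]; exists t0; intros t ht s hs'.
  rewrite (wave_perm _ _ _ t s P); auto.
Qed.

(** * The phase of the walk and the orders of its stationary points *)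

Lemma list_misses_interval (l : list R) (u v : R) :
  u < v -> exists x, u < x < v /\ ~ In x l.
Proof.
revert u v; induction l as [|p l IH]; intros u v h.
- exists ((u + v) / 2); split; [lra|easy].
- destruct (Rlt_dec u p) as [h1|h1]; [destruct (Rlt_dec p v) as [h2|h2]|].
  + destruct (IH u p h1) as [x [hx nx]]; exists x; split; [lra|].
    intros [e|e]; [lra|auto].
  + destruct (IH u v h) as [x [hx nx]]; exists x; split; [lra|].
    intros [e|e]; [lra|auto].
  + destruct (IH u v h) as [x [hx nx]]; exists x; split; [lra|].
    intros [e|e]; [lra|auto].
Qed.

(** If all derivatives vanish at [x0], integrating [n] times from [x0] bounds [phi 1]
    by a constant times [(B |x - x0|)^n], which tends to 0 near [x0]. *)
Lemma flat_or_finite_order (phi : nat -> R -> R) (Mb B x0 : R) :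
  deriv_chain phi -> 0 < B ->
  (forall n x, (1 <= n)%nat -> Rabs (phi n x) <= Mb * B ^ n) ->
  phi 1%nat x0 = 0 ->
  (exists m, order phi x0 m) \/
  (forall x, Rabs (x - x0) <= / (2 * B) -> phi 1%nat x = 0).
Proof.
intros hphi pB hb h1.
destruct (classic (exists m, (1 <= m)%nat /\ phi m x0 <> 0)) as [[m [hm hn]]|H].
- left; revert hm hn; induction m as [m IH] using (well_founded_induction lt_wf).
  intros hm hn.
  destruct (classic (exists i, (1 <= i < m)%nat /\ phi i x0 <> 0)) as [[i [hi hi']]|H].
  + apply (IH i); auto; lia.
  + exists m; split; [|split; auto].
    * destruct m as [|[|m]]; [lia|now destruct hn|lia].
    * intros i hi; apply NNPP; intros e; apply H; now exists i.
- right; intros x hx.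
  assert (hz : forall j, (1 <= j)%nat -> phi j x0 = 0).
  { intros j hj; apply NNPP; intros e; apply H; now exists j. }
  assert (G : forall n j y, (1 <= j)%nat ->
    Rabs (phi j y) <= Mb * B ^ (j + n) * Rabs (y - x0) ^ n).
  { induction n as [|n IH]; intros j y hj.
    - rewrite Nat.add_0_r; simpl; rewrite Rmult_1_r; auto.
    - rewrite <- (Rminus_0_r (phi j y)), <- (hz j hj).
      replace (Mb * B ^ (j + S n) * Rabs (y - x0) ^ S n)
        with (Mb * B ^ (S j + n) * Rabs (y - x0) ^ n * Rabs (y - x0))
        by (replace (j + S n)%nat with (S j + n)%nat by lia; simpl; ring).
      apply (increment_bound (phi j) (phi (S j))); [intros u _; apply hphi|].
      intros u hu; eapply Rle_trans; [apply IH; lia|].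
      apply Rmult_le_compat_l.
      + apply Rmult_le_pos; [|apply pow_le; lra].
        assert (0 <= Mb * B ^ 1).
        { eapply Rle_trans; [apply Rabs_pos|apply (hb 1%nat x0); lia]. }
        simpl in H0; nra.
      + apply pow_incr; split; [apply Rabs_pos|].
        unfold Rmin, Rmax in hu; destruct (Rle_dec x0 y).
        * rewrite !Rabs_pos_eq; lra.
        * rewrite (Rabs_left1 (u - x0)), (Rabs_left1 (y - x0)); lra. }
  assert (G' : forall n, Rabs (phi 1%nat x) <= Mb * B * (1 / 2) ^ n).
  { intros n; eapply Rle_trans; [apply (G n 1%nat); lia|].
    simpl (B ^ (1 + n)).
    replace (Mb * (B * B ^ n) * Rabs (x - x0) ^ n)
      with (Mb * B * (B * Rabs (x - x0)) ^ n) by (rewrite Rpow_mult_distr; ring).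
    apply Rmult_le_compat_l.
    - eapply Rle_trans; [apply Rabs_pos|].
      eapply Rle_trans; [apply (hb 1%nat x0); lia|right; ring].
    - apply pow_incr; split; [apply Rmult_le_pos; [lra|apply Rabs_pos]|].
      apply Rle_trans with (B * / (2 * B)); [apply Rmult_le_compat_l; lra|].
      right; field; lra. }
  assert (L : is_lim_seq (fun n => Mb * B * (1 / 2) ^ n) 0).
  { replace (Finite 0) with (Rbar_mult (Mb * B) 0) by (simpl; f_equal; ring).
    apply is_lim_seq_scal_l, is_lim_seq_geom; rewrite Rabs_pos_eq; lra. }
  pose proof (is_lim_seq_le _ _ _ _ G' (is_lim_seq_const _) L) as E; simpl in E.
  pose proof (Rabs_pos (phi 1%nat x)).
  apply NNPP; intros e; apply Rabs_pos_lt in e; lra.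
Qed.

Definition freq (L k : nat) : R := IZR (Z.of_nat k - Z.of_nat L).

(** The [n]-th derivative of the generating function; the phase shift by
    [n pi / 2] differentiates sine and cosine uniformly. *)
Definition genfun_deriv (L : nat) (a : Z -> C) (n : nat) (x : R) : R :=
  sum_n (fun k => freq L k ^ n *
    (Re (a (Z.of_nat k - Z.of_nat L)%Z) * cos (freq L k * x + INR n * (PI / 2))
     - Im (a (Z.of_nat k - Z.of_nat L)%Z) * sin (freq L k * x + INR n * (PI / 2))))
    (2 * L).

Lemma genfun_deriv_0 (L : nat) (a : Z -> C) (x : R) : genfun_deriv L a 0 x = genfun L a x.
Proof.
unfold genfun_deriv, genfun, genfunC.
generalize (2 * L)%nat; intros N; induction N as [|N IH].
- rewrite !sum_O; unfold Re, Im, freq, expi; simpl; rewrite Rmult_0_l, Rplus_0_r; ring.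
- rewrite !sum_Sn, IH; unfold plus; simpl; f_equal.
  unfold Re, Im, freq, expi; simpl; rewrite Rmult_0_l, Rplus_0_r; ring.
Qed.

Lemma genfun_deriv_chain (L : nat) (a : Z -> C) : deriv_chain (genfun_deriv L a).
Proof.
intros n x; unfold genfun_deriv.
apply (is_derive_sum_n (V := R_NormedModule)); intros k _.
set (u := Re _); set (v := Im _); set (l := freq L k).
assert (E1 : l * x + INR (S n) * (PI / 2) = PI / 2 + (l * x + INR n * (PI / 2)))
  by (rewrite S_INR; ring).
rewrite E1, <- cos_sin.
replace (cos (PI / 2 + (l * x + INR n * (PI / 2)))) with (- sin (l * x + INR n * (PI / 2))).
2:{ rewrite sin_cos; ring. }
auto_derive; auto; simpl; ring.
Qed.

Lemma genfun_deriv_bound (L : nat) (a : Z -> C) : exists Mb, 0 <= Mb /\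
  forall n x, Rabs (genfun_deriv L a n x) <= Mb * INR (S L) ^ n.
Proof.
exists (sum_n (fun k => Rabs (Re (a (Z.of_nat k - Z.of_nat L)%Z))
                 + Rabs (Im (a (Z.of_nat k - Z.of_nat L)%Z))) (2 * L)).
assert (pS : forall n, 0 <= INR (S L) ^ n) by (intros n; apply pow_le, pos_INR).
assert (Hk : forall n k x, (k <= 2 * L)%nat ->
  Rabs (freq L k ^ n *
    (Re (a (Z.of_nat k - Z.of_nat L)%Z) * cos (freq L k * x + INR n * (PI / 2))
     - Im (a (Z.of_nat k - Z.of_nat L)%Z) * sin (freq L k * x + INR n * (PI / 2))))
  <= (Rabs (Re (a (Z.of_nat k - Z.of_nat L)%Z))
      + Rabs (Im (a (Z.of_nat k - Z.of_nat L)%Z))) * INR (S L) ^ n).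
{ intros n k x hk; rewrite Rabs_mult, <- RPow_abs, Rmult_comm.
  apply Rmult_le_compat; try apply Rabs_pos.
  - apply pow_le, Rabs_pos.
  - eapply Rle_trans; [apply Rabs_triang|].
    rewrite Rabs_Ropp, !Rabs_mult.
    assert (Rabs (cos (freq L k * x + INR n * (PI / 2))) <= 1) by apply Rabs_le, COS_bound.
    assert (Rabs (sin (freq L k * x + INR n * (PI / 2))) <= 1) by apply Rabs_le, SIN_bound.
    pose proof (Rabs_pos (Re (a (Z.of_nat k - Z.of_nat L)%Z))).
    pose proof (Rabs_pos (Im (a (Z.of_nat k - Z.of_nat L)%Z))).
    nra.
  - apply pow_incr; split; [apply Rabs_pos|].
    unfold freq; rewrite <- abs_IZR, INR_IZR_INZ; apply IZR_le; lia. }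
split.
- generalize (2 * L)%nat; intros N; induction N as [|N IH].
  + rewrite sum_O; apply Rplus_le_le_0_compat; apply Rabs_pos.
  + rewrite sum_Sn; apply Rplus_le_le_0_compat; [auto|].
    apply Rplus_le_le_0_compat; apply Rabs_pos.
- intros n x; unfold genfun_deriv; revert Hk.
  generalize (2 * L)%nat; intros N Hk; induction N as [|N IH].
  + rewrite !sum_O; apply Hk; lia.
  + rewrite !sum_Sn; unfold plus; simpl.
    eapply Rle_trans; [apply Rabs_triang|].
    rewrite Rmult_plus_distr_r; apply Rplus_le_compat.
    * apply IH; intros; apply Hk; lia.
    * apply Hk; lia.
Qed.

(** [phase 0] is [P + alpha theta], whose stationary points are the solutions of
    [P' = - alpha]; the index counts derivatives. *)
Definition phase (L : nat) (a : Z -> C) (alpha : R) (n : nat) (x : R) : R :=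
  genfun_deriv L a n x + match n with O => alpha * x | 1%nat => alpha | _ => 0 end.

Lemma phase_chain (L : nat) (a : Z -> C) (alpha : R) : deriv_chain (phase L a alpha).
Proof.
intros n x; unfold phase.
apply (is_derive_plus (genfun_deriv L a n)
  (fun x => match n with O => alpha * x | 1%nat => alpha | _ => 0 end)).
- apply genfun_deriv_chain.
- destruct n as [|[|n]]; auto_derive; auto; ring.
Qed.

Lemma phase_0 (L : nat) (a : Z -> C) (alpha x : R) :
  phase L a alpha 0 x = omega L a alpha x.
Proof. unfold phase, omega; now rewrite genfun_deriv_0. Qed.

Lemma Derive_genfun (L : nat) (a : Z -> C) (x : R) :
  Derive (genfun L a) x = genfun_deriv L a 1 x.
Proof.
apply is_derive_unique.
apply (is_derive_ext (genfun_deriv L a 0)); [apply genfun_deriv_0|].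
apply genfun_deriv_chain.
Qed.

Lemma phase_1 (L : nat) (a : Z -> C) (alpha x : R) :
  phase L a alpha 1 x = Derive (genfun L a) x + alpha.
Proof. unfold phase; now rewrite Derive_genfun. Qed.

Lemma phase_2 (L : nat) (a : Z -> C) (alpha x : R) :
  phase L a alpha 2 x = Derive_n (genfun L a) 2 x.
Proof.
unfold phase; rewrite Rplus_0_r; symmetry; simpl.
rewrite (Derive_ext _ (genfun_deriv L a 1)).
- apply is_derive_unique, genfun_deriv_chain.
- intros t; apply Derive_genfun.
Qed.

Lemma cos_sin_period (y : R) (j : Z) :
  cos (y + 2 * PI * IZR j) = cos y /\ sin (y + 2 * PI * IZR j) = sin y.
Proof.
assert (Q : forall y m, cos (y + 2 * PI * INR m) = cos y /\ sin (y + 2 * PI * INR m) = sin y).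
{ intros z m; replace (2 * PI * INR m) with (2 * INR m * PI) by ring.
  split; [apply cos_period|apply sin_period]. }
destruct (Z_le_gt_dec 0 j).
- replace (IZR j) with (INR (Z.to_nat j)) by (rewrite INR_IZR_INZ, Z2Nat.id; auto).
  apply Q.
- destruct (Q (y + 2 * PI * IZR j) (Z.to_nat (- j))) as [q1 q2].
  rewrite <- q1, <- q2.
  replace (y + 2 * PI * IZR j + 2 * PI * INR (Z.to_nat (- j))) with y; auto.
  rewrite INR_IZR_INZ, Z2Nat.id, opp_IZR by lia; ring.
Qed.

Lemma genfun_deriv_periodic (L : nat) (a : Z -> C) (n : nat) (x : R) (z : Z) :
  genfun_deriv L a n (x + 2 * PI * IZR z) = genfun_deriv L a n x.
Proof.
apply sum_n_ext; intros k; unfold freq.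
replace (IZR (Z.of_nat k - Z.of_nat L) * (x + 2 * PI * IZR z) + INR n * (PI / 2))
  with (IZR (Z.of_nat k - Z.of_nat L) * x + INR n * (PI / 2)
        + 2 * PI * IZR ((Z.of_nat k - Z.of_nat L) * z))
  by (rewrite mult_IZR; ring).
now destruct (cos_sin_period (IZR (Z.of_nat k - Z.of_nat L) * x + INR n * (PI / 2))
  ((Z.of_nat k - Z.of_nat L) * z)%Z) as [-> ->].
Qed.

(** Infinite order would put a whole interval of stationary points into the finite
    list [theta]. *)
Lemma stationary_order (L : nat) (a : Z -> C) (alpha : R) (theta : list R) (x : R) :
  stationary_points L a alpha theta -> In x theta -> exists m, order (phase L a alpha) x m.
Proof.
intros [nd st] hx.
destruct (genfun_deriv_bound L a) as [Mb [pM hM]].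
assert (B1 : 1 <= INR (S L)) by (apply (le_INR 1); lia).
destruct (flat_or_finite_order (phase L a alpha) (Mb + Rabs alpha) (INR (S L)) x)
  as [H|H]; auto.
- apply phase_chain.
- lra.
- intros n y hn; unfold phase.
  eapply Rle_trans; [apply Rabs_triang|].
  rewrite Rmult_plus_distr_r; apply Rplus_le_compat; [apply hM|].
  assert (1 <= INR (S L) ^ n) by (apply pow_R1_Rle; lra).
  pose proof (Rabs_pos alpha).
  destruct n as [|[|n]]; [lia|nra|].
  rewrite Rabs_R0; apply Rmult_le_pos; lra.
- rewrite phase_1; apply st in hx; lra.
- exfalso; apply st in hx.
  set (v := Rmin (2 * PI) (x + / (2 * INR (S L)))).
  assert (pv : x < v).
  { apply Rmin_glb_lt; [lra|].
    assert (0 < / (2 * INR (S L))) by (apply Rinv_0_lt_compat; lra); lra. }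
  destruct (list_misses_interval theta x v pv) as [y [hy ny]].
  pose proof (Rmin_l (2 * PI) (x + / (2 * INR (S L)))).
  pose proof (Rmin_r (2 * PI) (x + / (2 * INR (S L)))).
  fold v in H0, H1.
  apply ny, st; split; [lra|].
  specialize (H y); rewrite phase_1 in H.
  rewrite Rabs_pos_eq in H by lra; lra.
Qed.

(** * The amplitude as an oscillatory integral *)

Ltac ring_as T := match goal with |- ?u = ?v => change (@eq T u v) end; ring.

Lemma SeriesC_finite (u : nat -> C) (N : nat) :
  (forall n, (N < n)%nat -> u n = RtoC 0) -> SeriesC u = sum_n u N.
Proof.
intros h.
assert (S : forall v : nat -> R, (forall n, (N < n)%nat -> v n = 0) -> Series v = sum_n v N).
{ intros v hv; apply is_series_unique.
  assert (E : forall n, (N <= n)%nat -> sum_n v n = sum_n v N).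
  { intros n hn; induction hn as [|n hn IH]; auto.
    rewrite sum_Sn, IH, hv by lia; apply (plus_zero_r (G := R_AbelianMonoid)). }
  apply (filterlim_ext_loc (fun _ => sum_n v N)).
  - exists N; intros n hn; symmetry; now apply E.
  - apply filterlim_const. }
unfold SeriesC; rewrite !S.
2, 3: intros n hn; now rewrite h.
clear h S; induction N as [|N IH].
- rewrite !sum_O; now destruct (u 0%nat).
- rewrite !sum_Sn, <- IH; reflexivity.
Qed.

Lemma sum_n_trim_left (f : Z -> C) (p : Z) (n i : nat) :
  (forall m, (m < p)%Z -> f m = RtoC 0) ->
  sum_n (fun j => f (p - Z.of_nat i + Z.of_nat j)%Z) (n + i)
  = sum_n (fun j => f (p + Z.of_nat j)%Z) n.
Proof.
intros h; induction i as [|i IH].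
- rewrite Nat.add_0_r; apply sum_n_ext; intros j; f_equal; lia.
- rewrite <- IH; unfold sum_n.
  rewrite sum_Sn_m by lia.
  rewrite (h (p - Z.of_nat (S i) + Z.of_nat 0)%Z) by lia.
  rewrite (plus_zero_l (G := C_AbelianMonoid)).
  replace (n + S i)%nat with (S (n + i)) by lia; rewrite <- sum_n_m_S.
  apply sum_n_m_ext; intros j; f_equal; lia.
Qed.

Lemma sum_n_trim_right (f : Z -> C) (p : Z) (n i : nat) :
  (forall m, (p + Z.of_nat n < m)%Z -> f m = RtoC 0) ->
  sum_n (fun j => f (p + Z.of_nat j)%Z) (n + i)
  = sum_n (fun j => f (p + Z.of_nat j)%Z) n.
Proof.
intros h; induction i as [|i IH].
- now rewrite Nat.add_0_r.
- rewrite Nat.add_succ_r, sum_Sn, IH, h by lia.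
  apply (plus_zero_r (G := C_AbelianMonoid)).
Qed.

(** Both half-line series are cut at a common [N] that covers the window around [l],
    joined, and trimmed to the window. *)
Lemma SeriesZ_finite (f : Z -> C) (l : Z) (L : nat) :
  (forall m, (Z.of_nat L < Z.abs (m - l))%Z -> f m = RtoC 0) ->
  SeriesZ f = sum_n (fun j => f (l - Z.of_nat L + Z.of_nat j)%Z) (2 * L).
Proof.
intros h.
set (N := (Z.abs_nat l + L)%nat).
unfold SeriesZ.
rewrite (SeriesC_finite _ N) by (intros n hn; apply h; lia).
rewrite (SeriesC_finite _ N) by (intros n hn; apply h; lia).
assert (E : (sum_n (fun n => f (Z.of_nat n)) N + sum_n (fun n => f (- Z.of_nat (S n))%Z) N)%C
  = sum_n (fun j => f (- Z.of_nat (S N) + Z.of_nat j)%Z) (N + S N)).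
{ unfold sum_n at 3; rewrite (sum_n_m_Chasles _ 0 N (N + S N)) by lia.
  rewrite Cplus_comm; apply (f_equal2 Cplus).
  - change (sum_n_m ?g 0 N) with (sum_n g N).
    rewrite (sum_n_rev (fun n => f (- Z.of_nat (S n))%Z)).
    apply sum_n_ext_loc; intros j hj; f_equal; lia.
  - assert (H : forall M, sum_n (fun n => f (Z.of_nat n)) M
      = sum_n_m (fun j => f (- Z.of_nat (S N) + Z.of_nat j)%Z) (S N) (M + S N)).
    { induction M as [|M IH].
      - rewrite sum_O, Nat.add_0_l, sum_n_n; f_equal; lia.
      - rewrite sum_Sn, IH, Nat.add_succ_l, sum_n_Sm by lia.
        apply (f_equal2 plus); auto; f_equal; lia. }
    apply H. }
rewrite E.
set (p := (l - Z.of_nat L)%Z).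
set (i := Z.to_nat (p + Z.of_nat (S N))).
set (j := (N + S N - i - 2 * L)%nat).
rewrite <- (sum_n_trim_left f p (2 * L) i) by (intros m hm; apply h; lia).
rewrite <- (sum_n_trim_right f (p - Z.of_nat i) (2 * L + i) j)
  by (intros m hm; apply h; lia).
replace (2 * L + i + j)%nat with (N + S N)%nat by lia.
apply sum_n_ext; intros k; f_equal; lia.
Qed.

Lemma CInt_sum_n (f : nat -> R -> C) (a b : R) (n : nat) :
  (forall k, (k <= n)%nat -> ex_CInt (f k) a b) ->
  ex_CInt (fun x => sum_n (fun k => f k x) n) a b
  /\ CInt (fun x => sum_n (fun k => f k x) n) a b = sum_n (fun k => CInt (f k) a b) n.
Proof.
intros h; induction n as [|n IH].
- specialize (h O (le_n _)); rewrite sum_O; split.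
  + destruct h as [h1 h2]; split;
    [revert h1|revert h2]; apply ex_RInt_ext; intros x _; now rewrite sum_O.
  + apply CInt_ext; intros x _; now rewrite sum_O.
- destruct IH as [I1 I2]; [intros k hk; apply h; lia|].
  destruct (CInt_plus _ _ _ _ I1 (h (S n) (le_n _))) as [P1 P2].
  rewrite sum_Sn, <- I2; split.
  + destruct P1 as [h1 h2]; split;
    [revert h1|revert h2]; apply ex_RInt_ext; intros x _; now rewrite sum_Sn.
  + etransitivity; [|exact P2]; apply CInt_ext; intros x _; now rewrite sum_Sn.
Qed.

Lemma genfun_continuous (L : nat) (a : Z -> C) (x : R) : continuous (genfun L a) x.
Proof.
apply (continuous_ext (genfun_deriv L a 0)); [apply genfun_deriv_0|].
apply (chain_continuous _ 0), genfun_deriv_chain.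
Qed.

Lemma ex_CInt_weight (g f : R -> R) (a b : R) :
  (forall x, continuous g x) -> (forall x, continuous f x) ->
  ex_CInt (fun x => RtoC (g x) * expi (f x))%C a b.
Proof.
intros hg hf; split; apply (ex_RInt_continuous (V := R_CompleteNormedModule)); intros x _.
- apply (continuous_ext (fun x => g x * cos (f x))).
  { intros y; unfold Re, Cmult, expi; simpl; ring. }
  apply (continuous_mult g (fun x => cos (f x))); auto.
  apply (continuous_comp f cos); [auto|apply continuous_cos].
- apply (continuous_ext (fun x => g x * sin (f x))).
  { intros y; unfold Im, Cmult, expi; simpl; ring. }
  apply (continuous_mult g (fun x => sin (f x))); auto.
  apply (continuous_comp f sin); [auto|apply continuous_sin].
Qed.

Lemma continuous_Rmult_l (c x : R) : continuous (fun y => c * y) x.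
Proof. continuous_by_derivative. Qed.

Lemma continuous_Rpow (f : R -> R) (k : nat) (x : R) :
  continuous f x -> continuous (fun y => f y ^ k) x.
Proof.
intros hf; apply (continuous_comp f (fun y => y ^ k)); auto; continuous_by_derivative.
Qed.

Lemma CInt_mode (l : Z) (b : R) :
  CInt (fun x => expi (IZR l * x)) b (b + 2 * PI)
  = if Z.eq_dec 0 l then RtoC (2 * PI) else RtoC 0.
Proof.
destruct (Z.eq_dec 0 l) as [<-|h].
- rewrite (CInt_ext _ (fun _ => RtoC 1)).
  + unfold CInt, RtoC; simpl; rewrite !(RInt_const (V := R_CompleteNormedModule)).
    unfold scal; simpl; unfold mult; simpl; f_equal; ring.
  + intros x _; unfold expi, RtoC; rewrite Rmult_0_l, cos_0, sin_0; auto.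
- assert (hl : IZR l <> 0) by (intros e; apply eq_IZR in e; auto).
  assert (P : cos (IZR l * (b + 2 * PI)) = cos (IZR l * b)
           /\ sin (IZR l * (b + 2 * PI)) = sin (IZR l * b)).
  { replace (IZR l * (b + 2 * PI)) with (IZR l * b + 2 * PI * IZR l) by ring.
    apply cos_sin_period. }
  destruct P as [Pc Ps].
  unfold CInt, RtoC; f_equal.
  + rewrite (is_RInt_unique (V := R_CompleteNormedModule) _ _ _
      (minus ((fun x => sin (IZR l * x) / IZR l) (b + 2 * PI))
             ((fun x => sin (IZR l * x) / IZR l) b))).
    * rewrite Ps; apply (minus_eq_zero (G := R_AbelianGroup)).
    * apply (is_RInt_derive (V := R_CompleteNormedModule) (fun x => sin (IZR l * x) / IZR l)).
      -- intros x _; auto_derive; auto; simpl; field; auto.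
      -- intros x _; apply (continuous_comp (fun x => IZR l * x) cos);
           [apply continuous_Rmult_l|apply continuous_cos].
  + rewrite (is_RInt_unique (V := R_CompleteNormedModule) _ _ _
      (minus ((fun x => - cos (IZR l * x) / IZR l) (b + 2 * PI))
             ((fun x => - cos (IZR l * x) / IZR l) b))).
    * rewrite Pc; apply (minus_eq_zero (G := R_AbelianGroup)).
    * apply (is_RInt_derive (V := R_CompleteNormedModule) (fun x => - cos (IZR l * x) / IZR l)).
      -- intros x _; auto_derive; auto; simpl; field; auto.
      -- intros x _; apply (continuous_comp (fun x => IZR l * x) sin);
           [apply continuous_Rmult_l|apply continuous_sin].
Qed.

Lemma sum_n_Cmult_r (u : nat -> C) (c : C) (n : nat) :
  sum_n (fun k => u k * c)%C n = (sum_n u n * c)%C.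
Proof.
induction n as [|n IH]; [now rewrite !sum_O|].
rewrite !sum_Sn, IH; unfold plus; simpl; ring.
Qed.

(** On the Fourier side convolution with [a] is multiplication by its symbol, which
    is real by the symmetry of [a]. *)
Lemma mxpow_fourier (X : Z -> Z -> C) (L : nat) (a : Z -> C) (b : R) (k : nat) (l : Z) :
  finite_support L X -> isotropic a X ->
  (RtoC (2 * PI) * mxpow X k 0%Z l)%C
  = CInt (fun x => RtoC (genfun L a x ^ k) * expi (IZR l * x))%C b (b + 2 * PI).
Proof.
intros hfs [hX ha]; revert l; induction k as [|k IH]; intros l.
- change (mxpow X 0 0 l) with (if Z.eq_dec 0 l then RtoC 1 else RtoC 0).
  rewrite (CInt_ext _ (fun x => expi (IZR l * x))) by (intros x _; rewrite pow_O; ring).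
  rewrite CInt_mode; destruct (Z.eq_dec 0 l); ring.
- simpl mxpow.
  rewrite (SeriesZ_finite _ l L).
  2:{ intros m hm; rewrite hfs by auto; ring. }
  rewrite Cmult_comm, <- sum_n_Cmult_r.
  set (g := fun j x => (a (Z.of_nat j - Z.of_nat L)%Z *
     (RtoC (genfun L a x ^ k)
      * expi (IZR (l - Z.of_nat L + Z.of_nat j) * x)))%C).
  assert (G : forall j,
    ex_CInt (fun x => RtoC (genfun L a x ^ k)
      * expi (IZR (l - Z.of_nat L + Z.of_nat j) * x))%C b (b + 2 * PI)).
  { intros j; apply (ex_CInt_weight (fun x => genfun L a x ^ k)
      (fun x => IZR (l - Z.of_nat L + Z.of_nat j) * x)).
    - intros x; apply continuous_Rpow, genfun_continuous.
    - intros x; apply continuous_Rmult_l. }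
  rewrite (sum_n_ext _ (fun j => CInt (g j) b (b + 2 * PI))).
  2:{ intros j; unfold g.
      rewrite (proj2 (CInt_scal _ _ _ _ (G j))), <- IH, hX.
      replace (l - Z.of_nat L + Z.of_nat j - l)%Z with (Z.of_nat j - Z.of_nat L)%Z by lia.
      ring_as C. }
  rewrite <- (proj2 (CInt_sum_n g b (b + 2 * PI) (2 * L)
    (fun j _ => proj1 (CInt_scal _ _ _ _ (G j))))).
  apply CInt_ext; intros x _.
  rewrite (sum_n_ext _ (fun j => (a (Z.of_nat j - Z.of_nat L)%Z
      * expi (IZR (Z.of_nat j - Z.of_nat L) * x))
      * (RtoC (genfun L a x ^ k) * expi (IZR l * x)))%C).
  2:{ intros j; unfold g.
      replace (IZR (l - Z.of_nat L + Z.of_nat j) * x)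
        with (IZR (Z.of_nat j - Z.of_nat L) * x + IZR l * x)
        by (rewrite plus_IZR, !minus_IZR; ring).
      rewrite expi_plus; ring_as C. }
  rewrite sum_n_Cmult_r.
  pose proof (genfunC_real L a x ha) as E; unfold genfunC in E; cbv zeta in E.
  match type of E with ?s = _ => match goal with |- (?s' * _)%C = _ =>
    change s' with s end end.
  rewrite E; simpl; rewrite RtoC_mult; ring.
Qed.

(** Taylor polynomials of [exp (i z)], in the form in which they occur in the
    amplitude. *)
Definition exp_partial (n : nat) (z : R) : C :=
  sum_n (fun k => Cpow Ci k * RtoC (z ^ k / INR (fact k)))%C n.

(** Integrates the Taylor remainder once, keeping the factorial. *)
Lemma pow_fact_growth (g dg : R -> R) (n : nat) :
  g 0 = 0 -> (forall u, is_derive g u (dg u)) ->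
  (forall u, Rabs (dg u) <= Rabs u ^ n / INR (fact n)) ->
  forall z, Rabs (g z) <= Rabs z ^ S n / INR (fact (S n)).
Proof.
assert (W : forall g dg : R -> R, g 0 = 0 ->
  (forall u, 0 <= u -> is_derive g u (dg u)) ->
  (forall u, 0 <= u -> dg u <= u ^ n / INR (fact n)) ->
  forall z, 0 <= z -> g z <= z ^ S n / INR (fact (S n))).
{ intros f df f0 hf hb z hz.
  assert (nf := INR_fact_neq_0 n).
  assert (nS : INR (S n) <> 0) by (apply not_0_INR; lia).
  destruct (MVT_gen (fun u => / INR (fact (S n)) * u ^ S n - f u) 0 z
    (fun u => / INR (fact (S n)) * (INR (S n) * u ^ n) - df u)) as [c [hc E]].
  - rewrite Rmin_left, Rmax_right by lra; intros u hu.
    apply (is_derive_minus (fun u => / INR (fact (S n)) * u ^ S n) f).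
    + apply (is_derive_scal (fun u => u ^ S n)), is_derive_monomial.
    + apply hf; lra.
  - rewrite Rmin_left, Rmax_right by lra; intros u hu.
    apply continuity_pt_filterlim.
    apply (continuous_minus (fun u => / INR (fact (S n)) * u ^ S n) f).
    + continuous_by_derivative.
    + apply (continuous_of_derive f u (df u)), hf; lra.
  - rewrite Rmin_left, Rmax_right in hc by lra.
    specialize (hb c ltac:(lra)).
    replace (/ INR (fact (S n)) * (INR (S n) * c ^ n)) with (c ^ n / INR (fact n)) in E.
    + rewrite f0 in E; simpl (0 ^ S n) in E; rewrite Rmult_0_l, Rmult_0_r in E.
      unfold Rdiv; rewrite (Rmult_comm (z ^ S n)); nra.
    + change (fact (S n)) with (S n * fact n)%nat; rewrite mult_INR; field; auto. }
assert (W2 : forall g dg : R -> R, g 0 = 0 ->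
  (forall u, 0 <= u -> is_derive g u (dg u)) ->
  (forall u, 0 <= u -> Rabs (dg u) <= u ^ n / INR (fact n)) ->
  forall z, 0 <= z -> Rabs (g z) <= z ^ S n / INR (fact (S n))).
{ intros f df f0 hf hb z hz; apply Rabs_le; split.
  - enough (- f z <= z ^ S n / INR (fact (S n))) by lra.
    apply (W (fun u => - f u) (fun u => - df u)); auto.
    + rewrite f0; ring.
    + intros u hu; apply (is_derive_opp f), hf, hu.
    + intros u hu; specialize (hb u hu); apply Rabs_le_between in hb; lra.
  - apply (W f df); auto.
    intros u hu; specialize (hb u hu); apply Rabs_le_between in hb; lra. }
intros g0 hg hb z; destruct (Rle_lt_dec 0 z) as [hz|hz].
- rewrite (Rabs_pos_eq z) by auto; apply (W2 g dg); auto.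
  intros u hu; rewrite <- (Rabs_pos_eq u) at 2; auto.
- rewrite (Rabs_left z) by auto.
  replace (g z) with (g (- - z)) by (f_equal; ring).
  apply (W2 (fun u => g (- u)) (fun u => - dg (- u))); try lra.
  + now rewrite Ropp_0.
  + intros u _; replace (- dg (- u)) with (-1 * dg (- u)) by ring.
    apply (is_derive_comp g (fun u => - u)); [apply hg|].
    auto_derive; auto; ring.
  + intros u hu; rewrite Rabs_Ropp.
    rewrite <- (Rabs_pos_eq u) at 2 by auto; rewrite <- (Rabs_Ropp u); apply hb.
Qed.

Lemma exp_partial_derive (n : nat) (z : R) :
  is_derive (fun u => Re (exp_partial (S n) u)) z (- Im (exp_partial n z)) /\
  is_derive (fun u => Im (exp_partial (S n) u)) z (Re (exp_partial n z)).
Proof.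
assert (T : forall k, is_derive (fun u => u ^ S k / INR (fact (S k))) z (z ^ k / INR (fact k))).
{ intros k.
  assert (nf := INR_fact_neq_0 k).
  assert (nS : INR (S k) <> 0) by (apply not_0_INR; lia).
  replace (z ^ k / INR (fact k)) with (/ INR (fact (S k)) * (INR (S k) * z ^ k)).
  - apply (is_derive_ext (fun u => / INR (fact (S k)) * u ^ S k)).
    { intros u; apply Rmult_comm. }
    apply (is_derive_scal (fun u => u ^ S k)), is_derive_monomial.
  - change (fact (S k)) with (S k * fact k)%nat; rewrite mult_INR; field; auto. }
unfold exp_partial; induction n as [|n [IH1 IH2]].
- split.
  + apply (is_derive_ext (fun _ => 1)).
    { intros u0; generalize (u0 : R); clear u0; intros u; rewrite sum_Sn, sum_O; unfold plus, Re; simpl; match goal with |- ?u = ?v => change (@eq R u v) end; field. }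
    rewrite sum_O; replace (- Im _) with 0 by (unfold Im; simpl; ring).
    apply is_derive_Reals, derivable_pt_lim_const.
  + apply (is_derive_ext (fun u => u)).
    { intros u0; generalize (u0 : R); clear u0; intros u; rewrite sum_Sn, sum_O; unfold plus, Im; simpl; match goal with |- ?u = ?v => change (@eq R u v) end; field. }
    rewrite sum_O; replace (Re _) with 1 by (unfold Re; simpl; field).
    apply is_derive_Reals, derivable_pt_lim_id.
- split.
  + apply (is_derive_ext (fun u => Re (sum_n (fun k => Cpow Ci k * RtoC (u ^ k / INR (fact k)))%C (S n))
       + Re (Cpow Ci (S (S n))) * (u ^ S (S n) / INR (fact (S (S n)))))).
    { intros u0; generalize (u0 : R); clear u0; intros u; rewrite (sum_Sn _ (S n)); unfold plus, Re, Im; simpl; ring_as R. }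
    rewrite sum_Sn.
    match goal with |- is_derive _ _ (- Im (plus ?p ?q)) =>
      replace (- Im (plus p q)) with
       (- Im p + Re (Cpow Ci (S (S n))) * (z ^ S n / INR (fact (S n)))) end.
    * apply (is_derive_plus (V := R_NormedModule)); [exact IH1|].
      apply (is_derive_scal (fun u => u ^ S (S n) / INR (fact (S (S n))))), T.
    * unfold plus, Re, Im; simpl; ring.
  + apply (is_derive_ext (fun u => Im (sum_n (fun k => Cpow Ci k * RtoC (u ^ k / INR (fact k)))%C (S n))
       + Im (Cpow Ci (S (S n))) * (u ^ S (S n) / INR (fact (S (S n)))))).
    { intros u0; generalize (u0 : R); clear u0; intros u; rewrite (sum_Sn _ (S n)); unfold plus, Re, Im; simpl; ring_as R. }
    rewrite sum_Sn.
    match goal with |- is_derive _ _ (Re (plus ?p ?q)) =>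
      replace (Re (plus p q)) with
       (Re p + Im (Cpow Ci (S (S n))) * (z ^ S n / INR (fact (S n)))) end.
    * apply (is_derive_plus (V := R_NormedModule)); [exact IH2|].
      apply (is_derive_scal (fun u => u ^ S (S n) / INR (fact (S (S n))))), T.
    * unfold plus, Re, Im; simpl; ring.
Qed.

Lemma exp_partial_0 (n : nat) : exp_partial n 0 = RtoC 1.
Proof.
unfold exp_partial; induction n as [|n IH].
- rewrite sum_O; unfold RtoC, Cmult; simpl; f_equal; field.
- rewrite sum_Sn, IH; unfold plus; simpl.
  unfold RtoC, Cmult, Cplus, Rdiv; simpl; f_equal; ring.
Qed.

Lemma exp_partial_error (n : nat) (z : R) :
  Cmod (expi z - exp_partial n z) <= 2 * (Rabs z ^ S n / INR (fact (S n))).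
Proof.
assert (H : forall z, Rabs (cos z - Re (exp_partial n z)) <= Rabs z ^ S n / INR (fact (S n))
  /\ Rabs (sin z - Im (exp_partial n z)) <= Rabs z ^ S n / INR (fact (S n))).
{ clear z; induction n as [|n IH]; intros z.
  - replace (Rabs z ^ 1 / INR (fact 1)) with (Rabs z) by (simpl; field).
    unfold exp_partial; rewrite sum_O; unfold Re, Im; simpl; split.
    + replace ((1 * (1 / 1) - 0 * 0)) with (cos 0) by (rewrite cos_0; field).
      rewrite <- (Rminus_0_r z) at 2; apply cos_lipschitz.
    + replace ((1 * 0 + 0 * (1 / 1))) with (sin 0) by (rewrite sin_0; field).
      rewrite <- !cos_shift; eapply Rle_trans; [apply cos_lipschitz|].
      rewrite <- Rabs_Ropp; right; f_equal; ring.
  - split.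
    + apply (pow_fact_growth (fun u => cos u - Re (exp_partial (S n) u))
        (fun u => - sin u - - Im (exp_partial n u))).
      * rewrite exp_partial_0, cos_0; simpl; ring.
      * intros u; apply (is_derive_minus cos (fun u => Re (exp_partial (S n) u))).
        -- apply is_derive_Reals, derivable_pt_lim_cos.
        -- apply exp_partial_derive.
      * intros u; rewrite <- Rabs_Ropp.
        replace (- (- sin u - - Im (exp_partial n u))) with (sin u - Im (exp_partial n u)) by ring.
        apply IH.
    + apply (pow_fact_growth (fun u => sin u - Im (exp_partial (S n) u))
        (fun u => cos u - Re (exp_partial n u))).
      * rewrite exp_partial_0, sin_0; simpl; ring.
      * intros u; apply (is_derive_minus sin (fun u => Im (exp_partial (S n) u))).
        -- apply is_derive_Reals, derivable_pt_lim_sin.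
        -- apply exp_partial_derive.
      * intros u; apply IH. }
destruct (H z) as [H1 H2].
eapply Rle_trans; [apply Cmod_le_Re_Im|].
replace (Re (expi z - exp_partial n z)) with (cos z - Re (exp_partial n z))
  by (unfold Re; simpl; ring).
replace (Im (expi z - exp_partial n z)) with (sin z - Im (exp_partial n z))
  by (unfold Im; simpl; ring).
lra.
Qed.

Lemma SeriesC_limit (u : nat -> C) (z : C) :
  is_lim_seq (fun n => Cmod (z - sum_n u n)) 0 -> SeriesC u = z.
Proof.
intros h.
assert (Er : forall n, Re (sum_n u n) = sum_n (fun k => Re (u k)) n).
{ induction n as [|n IH]; [now rewrite !sum_O|rewrite !sum_Sn, <- IH; reflexivity]. }
assert (Ei : forall n, Im (sum_n u n) = sum_n (fun k => Im (u k)) n).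
{ induction n as [|n IH]; [now rewrite !sum_O|rewrite !sum_Sn, <- IH; reflexivity]. }
assert (W : forall (v : nat -> R) (x : R),
  (forall n, Rabs (x - sum_n v n) <= Cmod (z - sum_n u n)) -> Series v = x).
{ intros v x hv; apply is_series_unique.
  assert (Lm : is_lim_seq (fun n => x - sum_n v n) 0).
  { apply is_lim_seq_abs_0.
    apply (is_lim_seq_le_le (fun _ => 0) _ (fun n => Cmod (z - sum_n u n))); auto.
    - intros n; split; [apply Rabs_pos|apply hv].
    - apply is_lim_seq_const. }
  change (is_lim_seq (sum_n v) x).
  apply (is_lim_seq_ext (fun n => x - (x - sum_n v n))).
  { intros n; ring. }
  replace (Finite x) with (Finite (x - 0)) by (f_equal; ring).
  apply is_lim_seq_minus'; [apply is_lim_seq_const|exact Lm]. }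
unfold SeriesC; rewrite (W _ (Re z)), (W _ (Im z)).
- now destruct z.
- intros n; rewrite <- Ei; eapply Rle_trans; [|eapply Rle_trans; [apply Rmax_r|apply Rmax_Cmod]].
  right; f_equal; unfold Im; simpl; ring.
- intros n; rewrite <- Er; eapply Rle_trans; [|apply re_le_Cmod].
  right; f_equal; unfold Re; simpl; ring.
Qed.

(** The exponential series converges uniformly on a period and can be integrated
    term by term. The start [b] of the period is free, so that no stationary point
    needs to sit on its boundary. *)
Lemma amplitude_integral (X : Z -> Z -> C) (L : nat) (a : Z -> C) (b : R) (l : Z) (t : R) :
  finite_support L X -> isotropic a X ->
  amplitude X l t
  = (RtoC (/ (2 * PI))
     * CInt (fun x => expi (t * genfun L a x + IZR l * x)) b (b + 2 * PI))%C.
Proof.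
intros hfs hi; unfold amplitude.
pose proof PI_RGT_0 as pPI.
assert (nPI : RtoC (2 * PI) <> RtoC 0) by (intros e; injection e; lra).
apply SeriesC_limit.
destruct (bounded_on_segment (genfun L a) b (b + 2 * PI)) as [B [pB hB]]; [lra| |].
{ intros x _; apply genfun_continuous. }
set (F := fun n x => (exp_partial n (t * genfun L a x) * expi (IZR l * x))%C).
set (f := fun k x => ((Cpow (Ci * RtoC t) k / RtoC (INR (fact k)))
   * (RtoC (genfun L a x ^ k) * expi (IZR l * x)))%C).
assert (G : forall k, ex_CInt (fun x => RtoC (genfun L a x ^ k)
      * expi (IZR l * x))%C b (b + 2 * PI)).
{ intros k; apply (ex_CInt_weight (fun x => genfun L a x ^ k) (fun x => IZR l * x)).
  - intros x; apply continuous_Rpow, genfun_continuous.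
  - intros x; apply continuous_Rmult_l. }
assert (Gf : forall k, ex_CInt (f k) b (b + 2 * PI)) by (intros k; apply CInt_scal, G).
assert (FE : forall n x, sum_n (fun k => f k x) n = F n x).
{ intros n x; unfold F, exp_partial; rewrite <- sum_n_Cmult_r.
  apply sum_n_ext; intros k; unfold f.
  assert (nf : RtoC (INR (fact k)) <> RtoC 0)
    by (intros e; injection e; apply INR_fact_neq_0).
  rewrite Cpow_mult_l, <- (RtoC_pow t), Rpow_mult_distr; unfold Rdiv.
  rewrite !RtoC_mult, RtoC_inv by apply INR_fact_neq_0.
  match goal with |- ?u = ?v => change (@eq C u v) end; field; auto. }
assert (ExF : forall n, ex_CInt (F n) b (b + 2 * PI)).
{ intros n; destruct (proj1 (CInt_sum_n f b (b + 2 * PI) n (fun k _ => Gf k))) as [h1 h2].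
  split; [revert h1|revert h2]; apply ex_RInt_ext; intros x _; now rewrite FE. }
assert (SE : forall n, sum_n (fun k => mxpow X k 0%Z l * Cpow (Ci * RtoC t) k
     / RtoC (INR (fact k)))%C n = (RtoC (/ (2 * PI)) * CInt (F n) b (b + 2 * PI))%C).
{ intros n.
  rewrite (CInt_ext (F n) (fun x => sum_n (fun k => f k x) n)) by (intros x _; now rewrite FE).
  rewrite (proj2 (CInt_sum_n f b (b + 2 * PI) n (fun k _ => Gf k))),
    (Cmult_comm (RtoC (/ (2 * PI)))), <- sum_n_Cmult_r.
  apply sum_n_ext; intros k; unfold f.
  assert (nf : RtoC (INR (fact k)) <> RtoC 0)
    by (intros e; injection e; apply INR_fact_neq_0).
  rewrite (proj2 (CInt_scal _ _ _ _ (G k))), <- (mxpow_fourier X) by auto.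
  rewrite RtoC_inv by lra; match goal with |- ?u = ?v => change (@eq C u v) end; field; split; auto. }
set (E := fun x => expi (t * genfun L a x + IZR l * x)).
assert (ExE : ex_CInt E b (b + 2 * PI)).
{ apply (ex_CInt_expi (fun x => t * genfun L a x + IZR l * x)); intros x.
  apply (continuous_plus (fun x => t * genfun L a x) (fun x => IZR l * x)).
  - apply (continuous_mult (fun _ => t) (genfun L a));
      [apply continuous_const|apply genfun_continuous].
  - apply continuous_Rmult_l. }
apply (is_lim_seq_le_le (fun _ => 0) _
  (fun n => / (2 * PI) * (2 * ((2 * PI) * 2)) * ((Rabs t * B) ^ S n / INR (fact (S n))))).
- intros n; split; [apply Cmod_ge_0|rewrite SE].
  destruct (CInt_scal (RtoC (-1)) (F n) _ _ (ExF n)) as [X1 X2].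
  destruct (CInt_plus _ _ _ _ ExE X1) as [Y1 Y2].
  match goal with |- Cmod ?z <= _ => replace z with
    (RtoC (/ (2 * PI)) * CInt (fun x => E x + RtoC (-1) * F n x)%C b (b + 2 * PI))%C end.
  2:{ rewrite Y2, X2; unfold E; ring. }
  rewrite Cmod_mult, Cmod_R, Rabs_pos_eq by (left; apply Rinv_0_lt_compat; lra).
  rewrite Rmult_assoc; apply Rmult_le_compat_l; [left; apply Rinv_0_lt_compat; lra|].
  rewrite !Rmult_assoc.
  replace (2 * (2 * (PI * (2 * ((Rabs t * B) ^ S n / INR (fact (S n)))))))
    with (2 * ((b + 2 * PI - b) * (2 * ((Rabs t * B) ^ S n / INR (fact (S n))))))
    by ring.
  apply Cmod_CInt_le; [lra|exact Y1|].
  intros x hx; unfold E, F; rewrite expi_plus.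
  match goal with |- Cmod ?z <= _ => replace z with
    ((expi (t * genfun L a x) - exp_partial n (t * genfun L a x)) * expi (IZR l * x))%C
    by ring end.
  rewrite Cmod_mult, Cmod_expi, Rmult_1_r.
  eapply Rle_trans; [apply exp_partial_error|].
  apply Rmult_le_compat_l; [lra|].
  apply Rmult_le_compat_r; [left; apply Rinv_0_lt_compat, INR_fact_lt_0|].
  apply pow_incr; split; [apply Rabs_pos|].
  rewrite Rabs_mult; apply Rmult_le_compat_l; [apply Rabs_pos|auto].
- apply is_lim_seq_const.
- match goal with |- is_lim_seq (fun n => ?c * _) _ =>
    replace (Finite 0) with (Rbar_mult c 0) by (simpl; f_equal; ring) end.
  apply is_lim_seq_scal_l.
  apply (is_lim_seq_incr_1 (fun n => (Rabs t * B) ^ n / INR (fact n))).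
  apply is_lim_seq_Reals, cv_speed_pow_fact.
Qed.

(** * Averages over windows of length [sqrt T] *)

Lemma Int_part_add (x : R) (z : Z) : Int_part (x + IZR z) = (Int_part x + z)%Z.
Proof.
symmetry; apply Int_part_spec; rewrite plus_IZR.
destruct (base_Int_part x); lra.
Qed.

Lemma ex_RInt_floor_cell (G : Z -> R -> R) (alpha : R) (n : Z) :
  (forall l t, continuous (G l) t) -> alpha <> 0 ->
  ex_RInt (fun t => G (Int_part (alpha * t)) t) (IZR n / alpha) (IZR (n + 1) / alpha).
Proof.
intros hG ha.
apply (ex_RInt_ext (G n)).
- intros t ht; f_equal; apply Int_part_spec.
  assert (E1 : alpha * (IZR n / alpha) = IZR n) by (field; auto).
  assert (E2 : alpha * (IZR (n + 1) / alpha) = IZR n + 1) by (rewrite plus_IZR; field; auto).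
  destruct (Rdichotomy _ _ ha) as [h|h].
  + assert (IZR (n + 1) / alpha <= IZR n / alpha) by nra.
    rewrite Rmin_right, Rmax_left in ht by auto; nra.
  + assert (IZR n / alpha <= IZR (n + 1) / alpha) by nra.
    rewrite Rmin_left, Rmax_right in ht by auto; nra.
- apply (ex_RInt_continuous (V := R_CompleteNormedModule)); intros; apply hG.
Qed.

(** Finitely many cells on which [[alpha t]] is constant cover a bounded interval, and
    the values at their end points do not influence the integral. *)
Lemma ex_RInt_floor (G : Z -> R -> R) (alpha a b : R) :
  (forall l t, continuous (G l) t) ->
  ex_RInt (fun t => G (Int_part (alpha * t)) t) a b.
Proof.
intros hG; destruct (Req_dec alpha 0) as [->|ha].
- apply (ex_RInt_ext (G (Int_part 0))).
  + intros t _; now rewrite Rmult_0_l.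
  + apply (ex_RInt_continuous (V := R_CompleteNormedModule)); intros; apply hG.
- set (f := fun t => G (Int_part (alpha * t)) t).
  assert (C : forall z (k : nat), ex_RInt f (IZR z / alpha) (IZR (z + Z.of_nat k) / alpha)).
  { intros z k; induction k as [|k IH].
    - rewrite Z.add_0_r; apply (ex_RInt_point (V := R_NormedModule)).
    - apply (ex_RInt_Chasles (V := R_NormedModule)) with (1 := IH).
      replace (z + Z.of_nat (S k))%Z with (z + Z.of_nat k + 1)%Z by lia.
      now apply ex_RInt_floor_cell. }
  destruct (nfloor_ex (Rabs alpha * (Rabs a + Rabs b))) as [N [_ hN]].
  { apply Rmult_le_pos; [apply Rabs_pos|]; apply Rplus_le_le_0_compat; apply Rabs_pos. }
  assert (pa : 0 < Rabs alpha) by now apply Rabs_pos_lt.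
  set (e := INR (S N) / Rabs alpha).
  assert (he : Rabs a + Rabs b <= e).
  { apply (Rle_div_r _ (INR (S N)) (Rabs alpha)); auto; rewrite S_INR; lra. }
  pose proof (Rabs_pos a); pose proof (Rabs_pos b).
  apply (ex_RInt_inside (V := R_CompleteNormedModule)) with (x := 0) (e := e);
    rewrite ?Rminus_0_r; try lra.
  specialize (C (- Z.of_nat (S N))%Z (2 * S N)%nat).
  replace (- Z.of_nat (S N) + Z.of_nat (2 * S N))%Z with (Z.of_nat (S N)) in C by lia.
  rewrite opp_IZR, <- INR_IZR_INZ in C.
  unfold e; destruct (Rdichotomy _ _ ha) as [h|h].
  + apply (ex_RInt_swap (V := R_NormedModule)).
    rewrite Rabs_left by auto.
    replace (0 + INR (S N) / - alpha) with (- INR (S N) / alpha) by (field; lra).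
    replace (0 - INR (S N) / - alpha) with (INR (S N) / alpha) by (field; lra).
    exact C.
  + rewrite Rabs_pos_eq by lra.
    replace (0 + INR (S N) / alpha) with (INR (S N) / alpha) by (field; lra).
    replace (0 - INR (S N) / alpha) with (- INR (S N) / alpha) by (field; lra).
    exact C.
Qed.

(** Fractional part of [alpha t]. *)
Definition drift (alpha t : R) : R := alpha * t - IZR (Int_part (alpha * t)).

Lemma drift_bounds (alpha t : R) : 0 <= drift alpha t <= 1.
Proof. unfold drift; destruct (base_Int_part (alpha * t)); lra. Qed.

Lemma CInt_shift (h : R -> C) (p a b : R) :
  ex_CInt h (a + p) (b + p) -> CInt (fun t => h (t + p)) a b = CInt h (a + p) (b + p).
Proof.
intros [h1 h2]; unfold CInt.
pose proof (RInt_comp_lin (V := R_CompleteNormedModule) (fun x => Re (h x)) 1 p a b) as E1.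
pose proof (RInt_comp_lin (V := R_CompleteNormedModule) (fun x => Im (h x)) 1 p a b) as E2.
rewrite !Rmult_1_l in E1, E2.
rewrite <- E1, <- E2 by auto.
f_equal; apply (RInt_ext (V := R_CompleteNormedModule)); intros x _;
  unfold scal; simpl; unfold mult; simpl; rewrite !Rmult_1_l; reflexivity.
Qed.

(** Comparing the integral with its translate by [p] gives [(q - 1)] times the
    integral up to two end pieces, so it is bounded on all intervals. *)
Lemma CInt_quasiperiodic (h : R -> C) (p : R) (q : C) :
  (forall a b, ex_CInt h a b) -> (forall t, Cmod (h t) <= 1) -> 0 < p ->
  q <> RtoC 1 -> (forall t, h (t + p) = (q * h t)%C) ->
  exists K, forall a b, Cmod (CInt h a b) <= K.
Proof.
intros ex hb hp hq hper.
assert (nq : 0 < Cmod (q - 1)).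
{ apply Cmod_gt_0; intros e; apply hq.
  replace q with (q - 1 + 1)%C by ring; rewrite e; ring. }
exists (4 * p / Cmod (q - 1)); intros a b.
assert (E : ((q - 1) * CInt h a b)%C = (CInt h b (b + p) - CInt h a (a + p))%C).
{ assert (E1 : (q * CInt h a b)%C = CInt h (a + p) (b + p)).
  { rewrite <- CInt_shift, <- (proj2 (CInt_scal q h a b (ex a b))) by auto.
    apply CInt_ext; intros x _; now rewrite hper. }
  pose proof (CInt_Chasles h a (a + p) (b + p) (ex _ _) (ex _ _)) as E2.
  pose proof (CInt_Chasles h a b (b + p) (ex _ _) (ex _ _)) as E3.
  replace ((q - 1) * CInt h a b)%C with (q * CInt h a b - CInt h a b)%C by ring.
  rewrite E1.
  replace (CInt h (a + p) (b + p))
    with (CInt h a (a + p) + CInt h (a + p) (b + p) - CInt h a (a + p))%C by ring.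
  rewrite E2, <- E3; ring. }
apply (Rle_div_r (Cmod (CInt h a b)) (4 * p) (Cmod (q - 1))); auto.
rewrite Rmult_comm, <- Cmod_mult, E.
assert (B : forall c, Cmod (CInt h c (c + p)) <= 2 * ((c + p - c) * 1)).
{ intros c; apply Cmod_CInt_le; [lra|auto|auto]. }
unfold Cminus; eapply Rle_trans; [apply Cmod_triangle|].
rewrite Cmod_opp; pose proof (B a); pose proof (B b); lra.
Qed.

Lemma expi_1 (x : R) : expi x = RtoC 1 -> exists n : Z, x = 2 * PI * IZR n.
Proof.
intros h; injection h as hc hs.
destruct (sin_eq_0_0 x hs) as [k hk].
destruct (Z.Even_or_Odd k) as [[n ->]|[n ->]].
- exists n; rewrite hk, mult_IZR; ring.
- exfalso; rewrite hk, plus_IZR, mult_IZR in hc.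
  replace ((2 * IZR n + 1) * PI) with (2 * IZR n * PI + PI) in hc by ring.
  rewrite neg_cos in hc.
  assert (s0 : sin (IZR n * PI) = 0) by (apply sin_eq_0_1; now exists n).
  replace (2 * IZR n * PI) with (2 * (IZR n * PI)) in hc by ring.
  rewrite cos_2a_sin, s0 in hc; lra.
Qed.

Lemma ex_CInt_beat (alpha beta gamma a b : R) :
  ex_CInt (fun t => expi (beta * t - gamma * drift alpha t)) a b.
Proof.
assert (c : forall l t, continuous (fun t => beta * t - gamma * (alpha * t - IZR l)) t)
  by (intros; continuous_by_derivative).
split.
- apply (ex_RInt_floor (fun l t => cos (beta * t - gamma * (alpha * t - IZR l)))).
  intros l t; apply (continuous_comp (fun t => beta * t - gamma * (alpha * t - IZR l)) cos);
    [apply c|apply continuous_cos].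
- apply (ex_RInt_floor (fun l t => sin (beta * t - gamma * (alpha * t - IZR l)))).
  intros l t; apply (continuous_comp (fun t => beta * t - gamma * (alpha * t - IZR l)) sin);
    [apply c|apply continuous_sin].
Qed.

(** The interference of two stationary points: [drift] has period [1 / |alpha|],
    and over one period the beat is multiplied by [exp (i beta / |alpha|)], which
    nonresonance keeps away from [1]. For [alpha = 0] the drift vanishes, and
    translation by [pi / |beta|] changes the sign. *)
Lemma CInt_beat_bounded (alpha beta gamma : R) :
  (forall n : Z, beta <> 2 * PI * alpha * IZR n) ->
  exists K, forall a b,
    Cmod (CInt (fun t => expi (beta * t - gamma * drift alpha t)) a b) <= K.
Proof.
intros hn.
pose proof PI_RGT_0 as pPI.
assert (S : exists p, 0 < p /\ expi (beta * p) <> RtoC 1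
  /\ exists z : Z, alpha * p = IZR z).
{ destruct (Req_dec alpha 0) as [e|ha].
  - assert (hb : beta <> 0) by (intros e'; apply (hn 0%Z); rewrite e', e; ring).
    assert (pb : 0 < Rabs beta) by now apply Rabs_pos_lt.
    exists (PI / Rabs beta); split; [apply Rdiv_lt_0_compat; auto|split].
    + intros h; injection h as hc _.
      assert (E : cos (beta * (PI / Rabs beta)) = cos PI).
      { unfold Rabs in *; destruct (Rcase_abs beta).
        - replace (beta * (PI / - beta)) with (- PI) by (field; auto); apply cos_neg.
        - f_equal; field; auto. }
      rewrite cos_PI in E; lra.
    + exists 0%Z; rewrite e; ring.
  - assert (pa : 0 < Rabs alpha) by now apply Rabs_pos_lt.
    exists (/ Rabs alpha); split; [now apply Rinv_0_lt_compat|split].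
    + intros h; destruct (expi_1 _ h) as [n E].
      assert (E' : beta = 2 * PI * IZR n * Rabs alpha) by (rewrite <- E; field; lra).
      unfold Rabs in E'; destruct (Rcase_abs alpha).
      * apply (hn (- n)%Z); rewrite E', opp_IZR; ring.
      * apply (hn n); rewrite E'; ring.
    + unfold Rabs; destruct (Rcase_abs alpha).
      * exists (-1)%Z; field; auto.
      * exists 1%Z; field; auto. }
destruct S as [p [pp [hq [z hz]]]].
apply (CInt_quasiperiodic _ p (expi (beta * p))); auto.
- intros a b; apply ex_CInt_beat.
- intros t; rewrite Cmod_expi; lra.
- intros t; rewrite <- expi_plus; f_equal.
  unfold drift.
  rewrite !Rmult_plus_distr_l, hz, Int_part_add, plus_IZR; ring.
Qed.

Definition total_weight (ld : list (R * C)) : R :=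
  fold_right (fun p w => Cmod (snd p) ^ 2 + w) 0 ld.

Lemma cross_term_bounded (phi : R -> R) (alpha x : R) (d : C) (ld : list (R * C)) :
  (forall q, In q ld -> forall n : Z, phi x - phi (fst q) <> 2 * PI * alpha * IZR n) ->
  let h := fun t => (d * expi (t * phi x - drift alpha t * x)
                     * Cconj (wave phi ld t (drift alpha t)))%C in
  (forall a b, ex_CInt h a b) /\ exists K, forall a b, Cmod (CInt h a b) <= K.
Proof.
induction ld as [|[y e] ld IH]; intros hn h.
- assert (h0 : forall t, h t = (RtoC 0 * expi (0 * t - 0 * drift alpha t))%C).
  { intros t; unfold h, wave; simpl fold_right.
    replace (Cconj (RtoC 0)) with (RtoC 0) by (unfold Cconj, RtoC; simpl; f_equal; ring).
    ring. }
  assert (E : forall a b, ex_CInt h a b /\ CInt h a b = RtoC 0).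
  { intros a b.
    destruct (CInt_scal (RtoC 0) _ a b (ex_CInt_beat alpha 0 0 a b)) as [[h1 h2] E]; split.
    - split; [revert h1|revert h2]; apply ex_RInt_ext; intros x0 _; now rewrite h0.
    - rewrite (CInt_ext h _ a b (fun x _ => h0 x)), E; ring. }
  split; [intros a b; apply E|].
  exists 0; intros a b; rewrite (proj2 (E a b)), Cmod_0; lra.
- destruct IH as [ex [K HK]]; [intros q hq; apply hn; now right|].
  set (g := fun t => (d * expi (t * phi x - drift alpha t * x)
                     * Cconj (wave phi ld t (drift alpha t)))%C) in *.
  set (k := fun t => (d * Cconj e
     * expi ((phi x - phi y) * t - (x - y) * drift alpha t))%C).
  assert (hh : forall t, h t = (k t + g t)%C).
  { intros t; unfold h, k, g, wave; simpl fold_right; simpl fst; simpl snd.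
    rewrite Cplus_conj, Cmult_conj.
    replace ((phi x - phi y) * t - (x - y) * drift alpha t)
      with ((t * phi x - drift alpha t * x) + - (t * phi y - drift alpha t * y)) by ring.
    rewrite expi_plus.
    replace (Cconj (expi (t * phi y - drift alpha t * y)))
      with (expi (- (t * phi y - drift alpha t * y))).
    - ring.
    - unfold expi, Cconj; simpl; now rewrite cos_neg, sin_neg. }
  destruct (CInt_beat_bounded alpha (phi x - phi y) (x - y)) as [K' HK'].
  { apply (hn (y, e)); now left. }
  assert (A : forall a b, ex_CInt k a b /\ CInt k a b = (d * Cconj e * CInt
     (fun t => expi ((phi x - phi y) * t - (x - y) * drift alpha t)) a b)%C).
  { intros a b; apply (CInt_scal (d * Cconj e)%C), ex_CInt_beat. }
  assert (E : forall a b, ex_CInt h a b /\ CInt h a b = (CInt k a b + CInt g a b)%C).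
  { intros a b; destruct (CInt_plus k g a b (proj1 (A a b)) (ex a b)) as [[h1 h2] E]; split.
    - split; [revert h1|revert h2]; apply ex_RInt_ext; intros x0 _; now rewrite hh.
    - now rewrite (CInt_ext h _ a b (fun x _ => hh x)), E. }
  split; [intros a b; apply E|].
  exists (Cmod (d * Cconj e) * K' + K); intros a b.
  rewrite (proj2 (E a b)); eapply Rle_trans; [apply Cmod_triangle|].
  apply Rplus_le_compat; [|apply HK].
  rewrite (proj2 (A a b)), Cmod_mult; apply Rmult_le_compat_l; [apply Cmod_ge_0|apply HK'].
Qed.

Lemma Cmod_plus_sqr (u v : C) :
  Cmod (u + v) ^ 2 = Cmod u ^ 2 + Cmod v ^ 2 + 2 * Re (u * Cconj v).
Proof.
assert (P : forall z : C, Cmod z ^ 2 = fst z ^ 2 + snd z ^ 2).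
{ intros z; unfold Cmod; apply pow2_sqrt, Rplus_le_le_0_compat; apply pow2_ge_0. }
rewrite !P; unfold Re; simpl; ring.
Qed.

(** Expanding the square leaves the diagonal and cross terms, and the integrals of
    the latter are bounded on all intervals: interference averages out. *)
Lemma wave_energy (phi : R -> R) (alpha : R) (ld : list (R * C)) :
  NoDup (map fst ld) ->
  (forall p q, In p ld -> In q ld -> fst p <> fst q ->
     forall n : Z, phi (fst p) - phi (fst q) <> 2 * PI * alpha * IZR n) ->
  let W := fun t => Cmod (wave phi ld t (drift alpha t)) ^ 2 in
  (forall a b, ex_RInt W a b) /\
  exists K, forall a b, Rabs (RInt W a b - (b - a) * total_weight ld) <= K.
Proof.
induction ld as [|[x d] ld IH]; intros nd hn W.
- assert (E : forall t, W t = 0) by (intros t; unfold W, wave; simpl fold_right; rewrite Cmod_0; ring).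
  assert (EI : forall a b, is_RInt W a b 0).
  { intros a b; apply (is_RInt_ext (V := R_NormedModule) (fun _ => 0)); [intros; now rewrite E|].
    pose proof (is_RInt_const (V := R_NormedModule) a b 0) as Q.
    now rewrite (scal_zero_r (V := R_NormedModule)) in Q. }
  split; [intros a b; eexists; apply EI|].
  exists 0; intros a b.
  rewrite (is_RInt_unique (V := R_CompleteNormedModule) _ _ _ _ (EI a b)); simpl.
  rewrite Rmult_0_r, Rminus_0_r, Rabs_R0; lra.
- simpl in nd; apply NoDup_cons_iff in nd; destruct nd as [nx nd].
  destruct IH as [ex [K HK]]; auto.
  { intros p q hp hq; apply hn; now right. }
  set (V := fun t => Cmod (wave phi ld t (drift alpha t)) ^ 2) in *.
  destruct (cross_term_bounded phi alpha x d ld) as [exh [K' HK']].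
  { intros q hq; apply (hn (x, d) q); [now left|now right|].
    simpl; intros e; apply nx; rewrite e; now apply in_map. }
  set (h := fun t => (d * expi (t * phi x - drift alpha t * x)
                     * Cconj (wave phi ld t (drift alpha t)))%C) in *.
  assert (E : forall t, W t = Cmod d ^ 2 + (1 * V t + 2 * Re (h t))).
  { intros t; unfold W, V, h, wave; simpl fold_right.
    rewrite Cmod_plus_sqr, Cmod_mult; simpl fst; simpl snd; rewrite Cmod_expi; ring. }
  assert (EI : forall a b, is_RInt W a b
    ((b - a) * Cmod d ^ 2 + (1 * RInt V a b + 2 * Re (CInt h a b)))).
  { intros a b.
    apply (is_RInt_ext (V := R_NormedModule) (fun t => Cmod d ^ 2 + (1 * V t + 2 * Re (h t)))).
    { intros t _; symmetry; apply E. }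
    apply (is_RInt_plus (V := R_NormedModule) (fun _ => Cmod d ^ 2)).
    - apply (is_RInt_const (V := R_NormedModule)).
    - apply is_RInt_lin2; [apply ex|apply exh]. }
  split; [intros a b; eexists; apply EI|].
  exists (K + 2 * K'); intros a b.
  rewrite (is_RInt_unique (V := R_CompleteNormedModule) _ _ _ _ (EI a b)); simpl total_weight.
  match goal with |- Rabs ?z <= _ => replace z
    with ((RInt V a b - (b - a) * total_weight ld) + 2 * Re (CInt h a b)) by ring end.
  eapply Rle_trans; [apply Rabs_triang|].
  apply Rplus_le_compat; [apply HK|].
  rewrite Rabs_mult, Rabs_pos_eq by lra; apply Rmult_le_compat_l; [lra|].
  eapply Rle_trans; [apply re_le_Cmod|apply HK'].
Qed.

(** Averages over windows whose length tends to infinity see neither a bounded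
    error of the integral nor a vanishing error of the integrand. *)
Lemma average_limit (f W : R -> R) (S K : R) :
  (forall a b, ex_RInt f a b) -> (forall a b, ex_RInt W a b) ->
  (forall a b, Rabs (RInt W a b - (b - a) * S) <= K) ->
  (forall eps, 0 < eps -> exists t0, forall t, t0 <= t -> Rabs (f t - W t) <= eps) ->
  is_lim (fun T => / sqrt T * RInt f T (T + sqrt T)) p_infty S.
Proof.
intros exf exW hW hf.
apply is_lim_spec; intros eps.
assert (pe : 0 < eps / 4) by (pose proof (cond_pos eps); lra).
destruct (hf _ pe) as [t0 ht0].
assert (pK : 0 <= K) by (eapply Rle_trans; [apply Rabs_pos|apply (hW 0 0)]).
set (m := 4 * (K + 1) / eps).
assert (pm : 0 < m) by (apply Rdiv_lt_0_compat; [lra|apply cond_pos]).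
exists (Rmax t0 (m * m)); intros T hT.
assert (hT1 : t0 < T) by (eapply Rle_lt_trans; [apply Rmax_l|exact hT]).
assert (hT2 : m * m < T) by (eapply Rle_lt_trans; [apply Rmax_r|exact hT]).
assert (hs : m < sqrt T).
{ rewrite <- (sqrt_square m) by lra; apply sqrt_lt_1; nra. }
set (s := sqrt T) in *.
assert (ps : 0 < s) by lra.
assert (D : Rabs (RInt f T (T + s) - RInt W T (T + s)) <= (T + s - T) * (eps / 4)).
{ pose proof (RInt_minus (V := R_CompleteNormedModule) f W T (T + s) (exf _ _) (exW _ _)) as E.
  unfold minus in E; unfold plus, opp in E; simpl in E.
  unfold Rminus at 1; rewrite <- E.
  apply abs_RInt_le_const; [lra| |].
  - apply (ex_RInt_minus (V := R_CompleteNormedModule)); auto.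
  - intros t ht; apply ht0; lra. }
specialize (hW T (T + s)).
replace (T + s - T) with s in D, hW by ring.
assert (KS : K <= s * (eps / 4)).
{ assert (m * (eps / 4) = K + 1) by (unfold m; field; pose proof (cond_pos eps); lra).
  nra. }
assert (B : Rabs (RInt f T (T + s) - s * S) <= s * (eps / 2)).
{ replace (RInt f T (T + s) - s * S)
    with ((RInt f T (T + s) - RInt W T (T + s)) + (RInt W T (T + s) - s * S)) by ring.
  eapply Rle_trans; [apply Rabs_triang|lra]. }
replace (/ s * RInt f T (T + s) - S) with (/ s * (RInt f T (T + s) - s * S)) by (field; lra).
rewrite Rabs_mult, Rabs_pos_eq by (left; now apply Rinv_0_lt_compat).
apply Rle_lt_trans with (/ s * (s * (eps / 2))).
- apply Rmult_le_compat_l; [left; now apply Rinv_0_lt_compat|auto].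
- replace (/ s * (s * (eps / 2))) with (eps / 2) by (field; lra).
  pose proof (cond_pos eps); lra.
Qed.

Lemma Cmod_wave_le (phi : R -> R) (ld : list (R * C)) : exists B, 0 <= B /\
  forall t s, Cmod (wave phi ld t s) <= B.
Proof.
induction ld as [|[x d] ld [B [pB hB]]].
- exists 0; split; [lra|]; intros t s; unfold wave; simpl; rewrite Cmod_0; lra.
- exists (Cmod d + B); split; [pose proof (Cmod_ge_0 d); lra|].
  intros t s; unfold wave; simpl; eapply Rle_trans; [apply Cmod_triangle|].
  rewrite Cmod_mult, Cmod_expi, Rmult_1_r; apply Rplus_le_compat_l, hB.
Qed.

Lemma asymptotics_sqr (phi : R -> R) (M : nat) (a b alpha : R) (ld : list (R * C)) :
  asymptotics phi M a b ld ->
  forall eps, 0 < eps -> exists t0, forall t, t0 <= t ->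
    Rabs (root M t ^ 2 * Cmod (osc phi t (drift alpha t) a b) ^ 2
          - Cmod (wave phi ld t (drift alpha t)) ^ 2) <= eps.
Proof.
intros h eps he.
destruct (Cmod_wave_le phi ld) as [B [pB hB]].
set (e := Rmin 1 (eps / (2 * B + 1))).
assert (pe : 0 < e) by (apply Rmin_pos; [lra|apply Rdiv_lt_0_compat; lra]).
assert (e1 : e <= 1) by apply Rmin_l.
assert (e2 : e * (2 * B + 1) <= eps).
{ apply (Rle_div_r e eps (2 * B + 1)); [lra|apply Rmin_r]. }
destruct (h e pe) as [t0 ht0]; exists t0; intros t ht.
specialize (ht0 t ht (drift alpha t) (drift_bounds alpha t)).
specialize (hB t (drift alpha t)).
set (w := wave phi ld t (drift alpha t)) in *.
set (o := osc phi t (drift alpha t) a b) in *.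
replace (root M t ^ 2 * Cmod o ^ 2) with (Cmod (RtoC (root M t) * o) ^ 2).
2:{ rewrite Cmod_mult, Cmod_R, Rabs_pos_eq by (left; apply root_pos); ring. }
set (y := (RtoC (root M t) * o)%C) in *.
assert (T1 : Cmod y <= Cmod w + e).
{ replace y with (w + (y - w))%C by ring; eapply Rle_trans; [apply Cmod_triangle|lra]. }
assert (T2 : Cmod w <= Cmod y + e).
{ replace w with (y + - (y - w))%C by ring; eapply Rle_trans; [apply Cmod_triangle|].
  rewrite Cmod_opp; lra. }
pose proof (Cmod_ge_0 y); pose proof (Cmod_ge_0 w).
apply Rabs_le; split; nra.
Qed.

Lemma lipschitz_continuous (g : R -> R) (K x : R) :
  (forall y, Rabs (g y - g x) <= K * Rabs (y - x)) -> continuous g x.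
Proof.
intros h; apply continuity_pt_filterlim.
intros eps he.
set (K' := Rmax K 0 + 1).
pose proof (Rmax_l K 0); pose proof (Rmax_r K 0).
assert (pK : 0 < K') by (unfold K'; lra).
exists (eps / K'); split; [apply Rdiv_lt_0_compat; auto|].
intros y [_ hy]; simpl in *; unfold R_dist in *.
eapply Rle_lt_trans; [apply h|].
pose proof (Rabs_pos (y - x)).
apply Rle_lt_trans with (K' * Rabs (y - x)); [apply Rmult_le_compat_r; unfold K'; lra|].
apply (Rlt_div_r (Rabs (y - x)) eps K') in hy; auto; lra.
Qed.

(** The integral depends on [t] in a Lipschitz way since [P] is bounded. *)
Lemma amplitude_sqr_continuous (X : Z -> Z -> C) (L : nat) (a : Z -> C) (l : Z) (t : R) :
  finite_support L X -> isotropic a X ->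
  continuous (fun t => t * Cmod (amplitude X l t) ^ 2) t.
Proof.
intros hfs hi.
pose proof PI_RGT_0 as pPI.
destruct (bounded_on_segment (genfun L a) 0 (0 + 2 * PI)) as [B [pB hB]]; [lra| |].
{ intros x _; apply genfun_continuous. }
assert (C : forall tau, continuous
   (fun t => RInt (fun x => cos (tau + (t * genfun L a x + IZR l * x))) 0 (0 + 2 * PI)) t).
{ intros tau; apply (lipschitz_continuous _ ((0 + 2 * PI - 0) * B)); intros u.
  assert (ex : forall u, ex_RInt (fun x => cos (tau + (u * genfun L a x + IZR l * x))) 0 (0 + 2 * PI)).
  { intros v; apply (ex_RInt_phase (genfun L a)), genfun_continuous. }
  pose proof (RInt_minus (V := R_CompleteNormedModule) _ _ _ _ (ex u) (ex t)) as E.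
  unfold minus in E; unfold plus, opp in E; simpl in E.
  unfold Rminus at 1; rewrite <- E, Rmult_assoc.
  apply abs_RInt_le_const; [lra| |].
  - apply (ex_RInt_minus (V := R_CompleteNormedModule)); auto.
  - intros x hx; eapply Rle_trans; [apply cos_lipschitz|].
    replace (tau + (u * genfun L a x + IZR l * x) - (tau + (t * genfun L a x + IZR l * x)))
      with (genfun L a x * (u - t)) by ring.
    rewrite Rabs_mult; apply Rmult_le_compat_r; [apply Rabs_pos|auto]. }
apply (continuous_ext (fun t => t * ((/ (2 * PI)) ^ 2 *
   (RInt (fun x => cos (0 + (t * genfun L a x + IZR l * x))) 0 (0 + 2 * PI) ^ 2
   + RInt (fun x => cos (- (PI / 2) + (t * genfun L a x + IZR l * x))) 0 (0 + 2 * PI) ^ 2)))).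
- intros u; rewrite (amplitude_integral X L a 0 l u hfs hi), Cmod_mult, Cmod_R.
  rewrite Rabs_pos_eq by (left; apply Rinv_0_lt_compat; lra).
  rewrite Rpow_mult_distr; do 2 f_equal.
  unfold Cmod; rewrite pow2_sqrt by (apply Rplus_le_le_0_compat; apply pow2_ge_0).
  unfold CInt; simpl fst; simpl snd; f_equal; f_equal;
    apply (RInt_ext (V := R_CompleteNormedModule)); intros x _.
  + rewrite Rplus_0_l; reflexivity.
  + replace (- (PI / 2) + (u * genfun L a x + IZR l * x))
      with (- (PI / 2 - (u * genfun L a x + IZR l * x))) by ring.
    rewrite cos_neg, cos_shift; reflexivity.
- assert (C2 := fun tau => continuous_Rpow _ 2 _ (C tau)).
  assert (CS := continuous_plus (V := R_NormedModule) _ _ _ (C2 0) (C2 (- (PI / 2)))).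
  assert (CM := continuous_mult (K := R_AbsRing) (fun _ => (/ (2 * PI)) ^ 2) _ _
    (continuous_const _ _) CS).
  exact (continuous_mult (K := R_AbsRing) (fun t => t) _ _ (continuous_id _) CM).
Qed.

Lemma ex_RInt_rescaled (X : Z -> Z -> C) (L : nat) (a : Z -> C) (alpha u v : R) :
  finite_support L X -> isotropic a X -> ex_RInt (rescaled_prob X alpha) u v.
Proof.
intros hfs hi.
apply (ex_RInt_floor (fun l t => t * Cmod (amplitude X l t) ^ 2)).
intros l t; now apply (amplitude_sqr_continuous X L a).
Qed.

Lemma rescaled_prob_osc (X : Z -> Z -> C) (L : nat) (a : Z -> C) (alpha b t : R) :
  finite_support L X -> isotropic a X ->
  rescaled_prob X alpha t
  = t * ((/ (2 * PI)) ^ 2 *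
         Cmod (osc (phase L a alpha 0) t (drift alpha t) b (b + 2 * PI)) ^ 2).
Proof.
intros hfs hi; unfold rescaled_prob.
rewrite (amplitude_integral X L a b _ t hfs hi), Cmod_mult, Cmod_R.
pose proof PI_RGT_0.
rewrite Rabs_pos_eq by (left; apply Rinv_0_lt_compat; lra).
rewrite Rpow_mult_distr; do 4 f_equal.
apply CInt_ext; intros x _; f_equal.
rewrite phase_0; unfold omega, drift; ring.
Qed.

(** Nondegenerate case: the scale [t^(-1/2)] of the amplitude is exactly absorbed
    by the rescaling. *)
Lemma average_limit_nondegenerate (X : Z -> Z -> C) (L : nat) (a : Z -> C)
    (alpha b : R) (ld : list (R * C)) :
  finite_support L X -> isotropic a X ->
  asymptotics (phase L a alpha 0) 2 b (b + 2 * PI) ld ->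
  NoDup (map fst ld) ->
  (forall p q, In p ld -> In q ld -> fst p <> fst q -> forall n : Z,
     phase L a alpha 0 (fst p) - phase L a alpha 0 (fst q) <> 2 * PI * alpha * IZR n) ->
  is_lim (avg_rescaled_prob X alpha) p_infty ((/ (2 * PI)) ^ 2 * total_weight ld).
Proof.
intros hfs hi has nd hn.
pose proof PI_RGT_0 as pPI.
assert (pi2 : 0 < (/ (2 * PI)) ^ 2) by (apply pow_lt, Rinv_0_lt_compat; lra).
set (c := (/ (2 * PI)) ^ 2) in *.
destruct (wave_energy (phase L a alpha 0) alpha ld nd hn) as [exW [K HK]].
set (W := fun t => Cmod (wave (phase L a alpha 0) ld t (drift alpha t)) ^ 2) in *.
apply (average_limit (rescaled_prob X alpha) (fun t => c * W t) _ (c * K)).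
- intros u v; now apply (ex_RInt_rescaled X L a).
- intros u v; apply (ex_RInt_scal (V := R_CompleteNormedModule) W); auto.
- intros u v.
  rewrite (RInt_scal (V := R_CompleteNormedModule) W) by auto.
  unfold scal; simpl; unfold mult; simpl.
  replace (c * RInt W u v - (v - u) * (c * total_weight ld))
    with (c * (RInt W u v - (v - u) * total_weight ld)) by ring.
  rewrite Rabs_mult, Rabs_pos_eq by lra; apply Rmult_le_compat_l; [lra|apply HK].
- intros eps he.
  destruct (asymptotics_sqr _ _ _ _ alpha _ has (eps / c)) as [t0 ht0].
  { apply Rdiv_lt_0_compat; auto. }
  exists (Rmax 1 t0); intros t ht.
  pose proof (Rmax_l 1 t0); pose proof (Rmax_r 1 t0).
  specialize (ht0 t ltac:(lra)).
  rewrite (root_pow 2 t) in ht0 by (auto; lra).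
  rewrite (rescaled_prob_osc X L a alpha b t hfs hi); fold c.
  match goal with |- Rabs (t * (c * ?o) - c * W t) <= _ =>
    replace (t * (c * o) - c * W t) with (c * (t * o - W t)) by ring end.
  rewrite Rabs_mult, Rabs_pos_eq by lra.
  apply Rle_trans with (c * (eps / c)); [|right; field; lra].
  apply Rmult_le_compat_l; [lra|exact ht0].
Qed.

(** Degenerate case: a stationary point of order [M >= 3] contributes on the scale
    [t^(-1/M)], and [t * t^(-2/M)] is unbounded. *)
Lemma average_limit_degenerate (X : Z -> Z -> C) (L : nat) (a : Z -> C)
    (alpha b : R) (M : nat) (ld : list (R * C)) :
  finite_support L X -> isotropic a X -> (3 <= M)%nat ->
  asymptotics (phase L a alpha 0) M b (b + 2 * PI) ld ->
  NoDup (map fst ld) ->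
  (forall p q, In p ld -> In q ld -> fst p <> fst q -> forall n : Z,
     phase L a alpha 0 (fst p) - phase L a alpha 0 (fst q) <> 2 * PI * alpha * IZR n) ->
  0 < total_weight ld ->
  is_lim (avg_rescaled_prob X alpha) p_infty p_infty.
Proof.
intros hfs hi hM has nd hn pw.
pose proof PI_RGT_0 as pPI.
assert (pi2 : 0 < (/ (2 * PI)) ^ 2) by (apply pow_lt, Rinv_0_lt_compat; lra).
set (c := (/ (2 * PI)) ^ 2) in *.
destruct (wave_energy (phase L a alpha 0) alpha ld nd hn) as [exW [K HK]].
set (W := fun t => Cmod (wave (phase L a alpha 0) ld t (drift alpha t)) ^ 2) in *.
set (S := total_weight ld) in *.
assert (hM3 : 3 <= INR M) by (apply (le_INR 3 M) in hM; simpl in hM; lra).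
set (eta := 1 - 2 * / INR M).
assert (peta : 0 < eta).
{ assert (/ INR M <= / 3) by (apply Rinv_le_contravar; lra); unfold eta; lra. }
assert (AW : is_lim (fun T => / sqrt T * RInt W T (T + sqrt T)) p_infty S).
{ apply (average_limit W W S K); auto.
  intros eps he; exists 0; intros t _; rewrite Rminus_diag, Rabs_R0; lra. }
apply is_lim_spec in AW.
assert (pS4 : 0 < S / 4) by lra.
destruct (AW (mkposreal _ pS4)) as [t1 ht1]; simpl in ht1.
destruct (asymptotics_sqr _ _ _ _ alpha _ has (S / 4) pS4) as [t2 ht2].
apply is_lim_spec; intros B.
set (B' := Rmax B 1).
assert (pB : 0 < B') by (unfold B'; pose proof (Rmax_r B 1); lra).
destruct (Rpower_decay eta (c * S / 4 / B') peta) as [t3 [h3 ht3]].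
{ repeat apply Rdiv_lt_0_compat; try lra; apply Rmult_lt_0_compat; auto. }
exists (Rmax t1 (Rmax t2 t3)); intros T hT.
pose proof (Rmax_l t1 (Rmax t2 t3)); pose proof (Rmax_r t1 (Rmax t2 t3)).
pose proof (Rmax_l t2 t3); pose proof (Rmax_r t2 t3).
specialize (ht1 T ltac:(lra)); specialize (ht3 T ltac:(lra)).
assert (ps : 0 < sqrt T) by (apply sqrt_lt_R0; lra).
set (s := sqrt T) in *.
set (g := Rpower T eta).
assert (pg : 0 < g) by apply exp_pos.
assert (hg : B' <= g * (c * S / 4)).
{ rewrite Rpower_Ropp in ht3; fold g in ht3.
  apply (Rmult_le_compat_l (g * B')) in ht3; [|apply Rmult_le_pos; lra].
  replace (g * B' * / g) with B' in ht3 by (field; lra).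
  replace (g * B' * (c * S / 4 / B')) with (g * (c * S / 4)) in ht3 by (field; lra).
  exact ht3. }
assert (LB : forall t, T <= t -> g * c * (W t - S / 4) <= rescaled_prob X alpha t).
{ intros t ht; specialize (ht2 t ltac:(lra)).
  rewrite (rescaled_prob_osc X L a alpha b t hfs hi); fold c.
  set (o := Cmod (osc _ _ _ _ _) ^ 2) in *.
  assert (po : 0 <= o) by apply pow2_ge_0.
  apply Rabs_le_between in ht2.
  change (- (S / 4) <= root M t ^ 2 * o - W t <= S / 4) in ht2.
  assert (pr : 0 < root M t ^ 2) by apply pow_lt, root_pos.
  assert (et : t = Rpower t eta * root M t ^ 2).
  { rewrite <- (Rpower_pow 2) by apply root_pos; unfold root.
    rewrite Rpower_mult, <- Rpower_plus.
    replace (eta + / INR M * INR 2) with 1 by (unfold eta; simpl; ring).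
    rewrite Rpower_1; lra. }
  assert (hgt : g <= Rpower t eta) by (apply Rle_Rpower_l; lra).
  apply Rle_trans with (g * (c * (root M t ^ 2 * o))).
  - rewrite Rmult_assoc.
    apply Rmult_le_compat_l; [lra|]; apply Rmult_le_compat_l; lra.
  - replace (t * (c * o)) with (Rpower t eta * root M t ^ 2 * (c * o))
      by (now rewrite <- et).
    replace (Rpower t eta * root M t ^ 2 * (c * o))
      with (Rpower t eta * (c * (root M t ^ 2 * o))) by ring.
    apply Rmult_le_compat_r; auto.
    apply Rmult_le_pos; [lra|apply Rmult_le_pos; lra]. }
assert (I : g * c * (RInt W T (T + s) - s * (S / 4)) <= RInt (rescaled_prob X alpha) T (T + s)).
{ apply (is_RInt_le (fun t => g * c * (W t - S / 4)) (rescaled_prob X alpha) T (T + s)); [lra| | |].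
  - apply (is_RInt_scal (V := R_NormedModule) (fun t => W t - S / 4) _ _ (g * c)).
    apply (is_RInt_minus (V := R_NormedModule) W (fun _ => S / 4)).
    + apply (RInt_correct (V := R_CompleteNormedModule)), exW.
    + replace s with (T + s - T) at 2 by ring.
      apply (is_RInt_const (V := R_NormedModule)).
  - apply (RInt_correct (V := R_CompleteNormedModule)), (ex_RInt_rescaled X L a); auto.
  - intros t ht; apply LB; lra. }
unfold avg_rescaled_prob; fold s.
apply Rlt_le_trans with (/ s * (g * c * (RInt W T (T + s) - s * (S / 4)))).
2:{ apply Rmult_le_compat_l; [left; now apply Rinv_0_lt_compat|exact I]. }
apply Rabs_lt_between in ht1.
replace (/ s * (g * c * (RInt W T (T + s) - s * (S / 4))))
  with (g * c * (/ s * RInt W T (T + s) - S / 4)) by (field; lra).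
assert (pgc : 0 < g * c) by (apply Rmult_lt_0_compat; auto).
assert (B <= B') by apply Rmax_l.
nra.
Qed.

(** * The limit of the averaged probability *)

Lemma NoDup_map_inj (A B : Type) (f : A -> B) (l : list A) (x y : A) :
  NoDup (map f l) -> In x l -> In y l -> f x = f y -> x = y.
Proof.
induction l as [|z l IH]; [easy|].
simpl; intros nd hx hy e; apply NoDup_cons_iff in nd; destruct nd as [nz nd].
destruct hx as [<-|hx], hy as [<-|hy]; auto.
- exfalso; apply nz; rewrite e; now apply in_map.
- exfalso; apply nz; rewrite <- e; now apply in_map.
Qed.

(** A period that starts just below 0 has all the solutions in [[0, 2 pi)] in its
    interior, and by periodicity it contains no other ones. *)
Lemma exists_period_start (L : nat) (a : Z -> C) (alpha : R) (theta : list R) :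
  stationary_points L a alpha theta -> exists b,
  (forall x, In x theta -> b < x < b + 2 * PI) /\
  (forall x, b <= x <= b + 2 * PI -> phase L a alpha 1 x = 0 -> In x theta).
Proof.
intros [nd st].
pose proof PI_RGT_0 as pPI.
destruct (exists_gap (- (2 * PI)) (map (fun x => (- x, RtoC 0)) theta)) as [g0 [pg0 hg0]].
{ intros q hq; apply in_map_iff in hq; destruct hq as [x [<- hx]]; simpl.
  apply st in hx; lra. }
set (g := Rmin g0 PI).
assert (pg : 0 < g) by (apply Rmin_pos; auto).
assert (g1 : g <= PI) by apply Rmin_r.
assert (hg : forall x, In x theta -> x + g < 2 * PI).
{ intros x hx.
  pose proof (hg0 (- x, RtoC 0) (in_map (fun x => (- x, RtoC 0)) theta x hx)) as h.
  simpl in h; assert (g <= g0) by apply Rmin_l; lra. }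
exists (- g); split.
- intros x hx; pose proof (hg x hx); apply st in hx; lra.
- intros x hx ex; rewrite phase_1 in ex.
  destruct (Rle_lt_dec 0 x) as [h|h]; [apply st; split; lra|].
  exfalso.
  assert (h' : In (x + 2 * PI * IZR 1) theta).
  { apply st; split; [simpl; lra|].
    rewrite Derive_genfun, genfun_deriv_periodic, <- Derive_genfun; lra. }
  apply hg in h'; lra.
Qed.

Lemma maximal_order (phi : nat -> R -> R) (theta : list R) :
  theta <> nil -> (forall x, In x theta -> exists m, order phi x m) ->
  exists M x0, In x0 theta /\ order phi x0 M /\
    forall x, In x theta -> exists m, order phi x m /\ (m <= M)%nat.
Proof.
induction theta as [|y theta IH]; [easy|intros _ h].
destruct (h y (or_introl eq_refl)) as [m hm].
destruct theta as [|z theta].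
- exists m, y; split; [now left|split; auto].
  intros x [<-|[]]; exists m; auto.
- destruct IH as [M [x0 [h0 [hM hall]]]]; [easy|intros x hx; apply h; now right|].
  destruct (Nat.le_gt_cases m M).
  + exists M, x0; split; [now right|split; auto].
    intros x [<-|hx]; [exists m; auto|auto].
  + exists m, y; split; [now left|split; auto].
    intros x [<-|hx]; [exists m; auto|].
    destruct (hall x hx) as [k [hk1 hk2]]; exists k; split; auto; lia.
Qed.

Lemma choose_coefficients (P : R -> C -> Prop) (theta : list R) :
  (forall x, In x theta -> exists d, P x d) ->
  exists ld, map fst ld = theta /\ forall p, In p ld -> P (fst p) (snd p).
Proof.
induction theta as [|x theta IH]; intros h.
- exists nil; split; auto; easy.
- destruct IH as [ld [e hl]]; [intros y hy; apply h; now right|].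
  destruct (h x (or_introl eq_refl)) as [d hd].
  exists ((x, d) :: ld); split; [simpl; now rewrite e|].
  intros p [<-|hp]; auto.
Qed.

Lemma total_weight_pos (ld : list (R * C)) (p : R * C) :
  In p ld -> snd p <> RtoC 0 -> 0 < total_weight ld.
Proof.
assert (N : forall l, 0 <= total_weight l).
{ induction l as [|q l IH]; simpl; [lra|].
  apply Rplus_le_le_0_compat; [apply pow2_ge_0|exact IH]. }
induction ld as [|q ld IH]; [easy|]; intros [<-|hp] hn; simpl.
- pose proof (N ld); assert (0 < Cmod (snd q) ^ 2); [|simpl in *; lra].
  apply pow_lt, Cmod_gt_0, hn.
- specialize (IH hp hn); pose proof (pow2_ge_0 (Cmod (snd q))); simpl in *; lra.
Qed.

(** The factor [1 / (4 pi^2)] of the squared amplitude meets the value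
    [2 pi / |P''|] that comes from the Fresnel integral. *)
Lemma limit_prob_finite (L : nat) (a : Z -> C) (ld : list (R * C)) :
  (forall p, In p ld -> Derive_n (genfun L a) 2 (fst p) <> 0 /\
     Cmod (snd p) ^ 2 = 2 * PI / Rabs (Derive_n (genfun L a) 2 (fst p))) ->
  limit_prob L a (map fst ld) = Finite ((/ (2 * PI)) ^ 2 * total_weight ld).
Proof.
intros h; pose proof PI_RGT_0 as pPI; unfold limit_prob.
assert (E : fold_right Rbar_plus (Finite 0)
    (map (fun x => recip (Rabs (Derive_n (genfun L a) 2 x))) (map fst ld))
  = Finite (/ (2 * PI) * total_weight ld)).
{ induction ld as [|p ld IH]; cbn [map fold_right total_weight].
  - f_equal; simpl; ring.
  - rewrite IH by (intros q hq; apply h; now right).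
    destruct (h p (or_introl eq_refl)) as [hn hw].
    apply Rabs_no_R0 in hn.
    unfold recip; destruct (Req_EM_T _ 0) as [e|_]; [easy|].
    cbn [Rbar_plus Rbar_plus']; f_equal.
    change (fold_right (fun p w => Cmod (snd p) ^ 2 + w) 0 ld) with (total_weight ld).
    rewrite hw; field; split; auto; lra. }
rewrite E; cbn [Rbar_mult Rbar_mult']; f_equal; ring.
Qed.

(** All summands are nonnegative or [+oo], so one infinite summand cannot be
    compensated. *)
Lemma limit_prob_infinite (L : nat) (a : Z -> C) (theta : list R) (x : R) :
  In x theta -> Derive_n (genfun L a) 2 x = 0 -> limit_prob L a theta = p_infty.
Proof.
intros hx h0; pose proof PI_RGT_0 as pPI; unfold limit_prob.
assert (N : forall l, fold_right Rbar_plus (Finite 0)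
    (map (fun x => recip (Rabs (Derive_n (genfun L a) 2 x))) l) <> m_infty).
{ induction l as [|y l IH]; [easy|].
  cbn [map fold_right].
  destruct (fold_right _ _ _) as [r| |]; [| |easy];
    unfold recip; destruct (Req_EM_T _ 0); easy. }
assert (E : fold_right Rbar_plus (Finite 0)
    (map (fun x => recip (Rabs (Derive_n (genfun L a) 2 x))) theta) = p_infty).
{ induction theta as [|y l IH]; [easy|]; cbn [map fold_right].
  destruct hx as [<-|hx].
  - specialize (N l); rewrite h0, Rabs_R0; unfold recip.
    destruct (Req_EM_T 0 0) as [_|e]; [|easy].
    destruct (fold_right _ _ _); easy.
  - rewrite (IH hx); unfold recip; destruct (Req_EM_T _ 0); easy. }
rewrite E.
assert (pi : 0 < / (2 * PI)) by (apply Rinv_0_lt_compat; lra).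
unfold Rbar_mult, Rbar_mult'.
destruct (Rle_dec 0 (/ (2 * PI))) as [h|h]; [|lra].
destruct (Rle_lt_or_eq_dec 0 (/ (2 * PI)) h); [easy|lra].
Qed.

Theorem corollary1p2 :
  forall (X : Z -> Z -> C) (L : nat) (a : Z -> C) (alpha : R),
    hermitian X -> finite_support L X -> isotropic a X ->
    (forall (K : nat) (theta : list R),
       stationary_points L a alpha theta -> length theta = K -> (0 < K)%nat ->
       NoDup (map (omega L a alpha) theta) ->
       nonresonant L a alpha theta ->
       is_lim (avg_rescaled_prob X alpha) p_infty (limit_prob L a theta)) /\
    ((forall x : R, Derive (genfun L a) x <> - alpha) ->
       is_lim (avg_rescaled_prob X alpha) p_infty (Finite 0)).
Proof.
intros X L a alpha _ hfs hi.
assert (ch := phase_chain L a alpha).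
split.
- intros K theta st hK hpos ndo nres.
  assert (nnil : theta <> nil) by (destruct theta; [simpl in hK; lia|easy]).
  destruct (exists_period_start L a alpha theta st) as [b [hin hall]].
  destruct (maximal_order (phase L a alpha) theta nnil) as [M [x0 [hx0 [hM hord]]]].
  { intros x hx; exact (stationary_order L a alpha theta x st hx). }
  destruct (choose_coefficients (fun x d =>
      local_coefficient (phase L a alpha 0) M x d /\
      (x = x0 -> (3 <= M)%nat -> d <> RtoC 0) /\
      (M = 2%nat -> Cmod d ^ 2 = 2 * PI / Rabs (phase L a alpha 2 x))) theta)
    as [ld [eld hld]].
  { intros x hx.
    destruct (Req_dec x x0) as [->|ne].
    - destruct (local_coefficient_exists _ M M x0 ch hM (le_n _)) as [d [h1 [h2 h3]]].
      exists d; repeat split; auto.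
    - destruct (hord x hx) as [m [hm hmM]].
      destruct (local_coefficient_exists _ M m x ch hm hmM) as [d [h1 [h2 h3]]].
      exists d; repeat split; auto; easy. }
  assert (nd : NoDup (map fst ld)) by (rewrite eld; apply st).
  assert (hth : forall p, In p ld -> In (fst p) theta)
    by (intros p hp; rewrite <- eld; now apply in_map).
  assert (has : asymptotics (phase L a alpha 0) M b (b + 2 * PI) ld).
  { pose proof PI_RGT_0.
    apply stationary_phase; auto; [apply hM|lra| |].
    - intros p hp; split; [apply hin, hth, hp|apply (hld p hp)].
    - intros x hx ex; rewrite eld; auto. }
  assert (hn : forall p q, In p ld -> In q ld -> fst p <> fst q -> forall n : Z,
     phase L a alpha 0 (fst p) - phase L a alpha 0 (fst q) <> 2 * PI * alpha * IZR n).
  { intros p q hp hq hne n e; rewrite !phase_0 in e.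
    destruct (Z.eq_dec n 0) as [->|hz].
    - apply hne, (NoDup_map_inj _ _ _ _ _ _ ndo); auto; lra.
    - apply (nres (fst p) (fst q) (hth p hp) (hth q hq) hne n hz); lra. }
  destruct (Nat.eq_dec M 2) as [->|hM2].
  + rewrite <- eld, limit_prob_finite.
    * apply (average_limit_nondegenerate X L a alpha b ld); auto.
    * intros p hp; rewrite <- (phase_2 L a alpha); split; [|now apply (hld p hp)].
      destruct (hord _ (hth p hp)) as [m [[hm1 [_ hm2]] hm3]].
      now replace 2%nat with m by lia.
  + assert (hM3 : (3 <= M)%nat) by (destruct hM; lia).
    rewrite (limit_prob_infinite L a theta x0 hx0).
    * apply (average_limit_degenerate X L a alpha b M ld); auto.
      rewrite <- eld in hx0; apply in_map_iff in hx0; destruct hx0 as [p [e hp]].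
      apply (total_weight_pos ld p hp), (hld p hp); auto.
    * rewrite <- (phase_2 L a alpha); apply hM; lia.
- intros hns.
  replace (Finite 0) with (Finite ((/ (2 * PI)) ^ 2 * total_weight nil))
    by (f_equal; simpl; ring).
  apply (average_limit_nondegenerate X L a alpha 0 nil); auto.
  + apply asymptotics_nonstationary; auto.
    * pose proof PI_RGT_0; lra.
    * intros x _ e; rewrite phase_1 in e; apply (hns x); lra.
  + constructor.
Qed.
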